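(* For $j=1,2$ let $\Omega_j\subset\mathbb{R}^{n_j}$ be a bounded, connected, Lipschitz open set which is locally star-shaped, and let $\omega\subset\Omega_1\times\Omega_2$. Let $\omega_2=\pi_2(\omega)$ be the projection of $\omega$ on $\Omega_2$, and for each $y\in\omega_2$ let $$\omega_y:=\pi_1\left(\omega\cap(\Omega_1\times\{y\})\right)\subset\Omega_1$$ be the horizontal slice of $\omega$. If there exist $C,\beta>0$ such that $\mathrm{spec}(\Omega_2,\omega_2,C,\beta)$ holds and, for every $y\in\omega_2$, $\mathrm{spec}(\Omega_1,\omega_y,C,\beta)$ holds, then there exists $C'>0$ such that $\mathrm{spec}(\Omega_1\times\Omega_2,\omega,C',\beta)$ holds.
   Context: Locally star-shaped: a bounded Lipschitz open set $\Omega\subset\mathbb{R}^n$ is locally star-shaped if for every $p\in\partial\Omega$ there exist $x_p\in\Omega$ and $r_p>0$ such that $|p-x_p|<r_p$ and $B(x_p,r_p)\cap\Omega$ is star-shaped with center $x_p$. $\pi_1,\pi_2$ are the coordinate projections of $\Omega_1\times\Omega_2$ onto $\Omega_1$ and $\Omega_2$. Spectral projector: for a bounded domain $\Omega$, $(\varphi_k)_{k\ge1}$ is an orthonormal basis of $L^2(\Omega)$ of Dirichlet eigenfunctions, $\varphi_k\in H^1_0(\Omega)$, $-\Delta\varphi_k=\lambda_k\varphi_k$, and $\Pi_\Lambda u=\sum_{\lambda_k\le\Lambda}\langle u,\varphi_k\rangle_{L^2}\varphi_k$ for $u\in L^2(\Omega)$, $\Lambda>0$ (a continuous function on $\Omega$).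 The property $\mathrm{spec}(\Omega,\omega,C,\beta)$ is said to hold if $$\|\Pi_\Lambda u\|_{L^2(\Omega)}\le C\exp(C\Lambda^\beta)\sup_{x\in\omega}|\Pi_\Lambda u(x)|\qquad\text{for all }\Lambda>0\text{ and all }u\in L^2(\Omega).$$ *)

(* Defs.v *)
From HB Require Import structures.
From mathcomp Require Import all_boot all_order all_algebra.
From mathcomp Require Import all_classical all_reals all_analysis.

Set Implicit Arguments.
Unset Strict Implicit.
Unset Printing Implicit Defensive.

Import Order.TTheory GRing.Theory Num.Theory.
Import numFieldNormedType.Exports.

Local Open Scope classical_set_scope.
Local Open Scope ring_scope.

(* R^n is 'rV[R]_n. Its library norm is the sup norm; it is used below only
   through notions that do not depend on the choice of an equivalent norm
   (topology, boundedness, existence of a Lipschitz constant). *)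

Section EuclideanSpace.
Context {R : realType} {n : nat}.
Implicit Types (x y c : 'rV[R]_n) (A : set 'rV[R]_n).

Definition dotp x y : R := \sum_i x 0 i * y 0 i.

Definition enorm x : R := Num.sqrt (dotp x x).

Definition eball c (r : R) : set 'rV[R]_n := [set x | enorm (x - c) < r].

Definition star_shaped c A : Prop :=
  A c /\ forall x (t : R), A x -> 0 <= t <= 1 -> A (c + t *: (x - c)).

Definition boundary A : set 'rV[R]_n := closure A `\` A°.

(* Near each boundary point, Omega is the part of a ball lying strictly above
   the graph of a Lipschitz function g over the hyperplane orthogonal to the
   unit vector e. *)
Definition lipschitz_boundary (Omega : set 'rV[R]_n) : Prop :=
  forall p, boundary Omega p ->
  exists (r : R) (e : 'rV[R]_n) (g : 'rV[R]_n -> R^o),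
    [/\ 0 < r, enorm e = 1,
        [lipschitz g z | z in [set z | dotp z e = 0]] &
        Omega `&` eball p r =
        [set x | g (x - dotp x e *: e) < dotp x e] `&` eball p r].

Definition locally_star_shaped (Omega : set 'rV[R]_n) : Prop :=
  forall p, boundary Omega p ->
  exists (x : 'rV[R]_n) (r : R),
    [/\ Omega x, 0 < r, enorm (p - x) < r &
        star_shaped x (eball x r `&` Omega)].

End EuclideanSpace.

Section LebesgueMeasure.
Context {R : realType}.

(* The sigma-algebra of 'rV[R]_n generated by the coordinate functions, that
   is, the Borel sigma-algebra. *)
Section RowMeasurable.
Variable n : nat.

Let coord (i : 'I_n) (x : 'rV[R]_n) : measurableTypeR R := x 0 i.

Let rV_set0 : g_sigma_preimage coord set0.
Proof. exact: sigma_algebra0. Qed.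

Let rV_setC A : g_sigma_preimage coord A -> g_sigma_preimage coord (~` A).
Proof. exact: sigma_algebraC. Qed.

Let rV_bigcup (F : (set 'rV[R]_n)^nat) :
  (forall i, g_sigma_preimage coord (F i)) ->
  g_sigma_preimage coord (\bigcup_i (F i)).
Proof. exact: sigma_algebra_bigcup. Qed.

Definition rV_display : measure_display. Proof. exact. Qed.

HB.instance Definition _ := @isMeasurable.Build rV_display 'rV[R]_n
  (g_sigma_preimage coord) rV_set0 rV_setC rV_bigcup.

End RowMeasurable.

Lemma measurable_coord n (i : 'I_n) :
  measurable_fun [set: 'rV[R]_n] (fun x => x 0 i : measurableTypeR R).
Proof.
move=> _ Y mY; rewrite setTI; apply: sub_sigma_algebra => /=.
rewrite -bigcup_seq/=; exists i => /=; first by rewrite mem_index_enum.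
by exists Y => //; rewrite setTI.
Qed.

Definition rV_cons n (z : measurableTypeR R * 'rV[R]_n) : 'rV[R]_n.+1 :=
  \row_(i < n.+1) oapp (z.2 0) z.1 (unlift ord0 i).

Lemma measurable_rV_cons n : measurable_fun setT (@rV_cons n).
Proof.
have mco (i : 'I_n.+1) :
    measurable_fun setT (fun z => rV_cons z 0 i : measurableTypeR R).
  rewrite /rV_cons; under eq_fun do rewrite mxE.
  case: unliftP => [j _|_] /=; last exact: measurable_fst.
  by apply: (measurableT_comp (@measurable_coord n j)); exact: measurable_snd.
have h : g_sigma_preimage (fun i z => @rV_cons n z 0 i : measurableTypeR R)
    `<=` measurable.
  apply: smallest_sub; first exact: sigma_algebra_measurable.
  rewrite -bigcup_mkord_ord; apply: bigcup_sub => i _ B [C mC <-].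
  exact: mco.
move=> _ A mA; rewrite setTI; apply: h.
rewrite (g_sigma_preimage_comp
  (fun i (x : 'rV[R]_n.+1) => x 0 i : measurableTypeR R) (@rV_cons n)).
by exists A => //; rewrite setTI.
Qed.

Definition rV_lebesgue_succ n (mu : {measure set 'rV[R]_n -> \bar R}) :
    set 'rV[R]_n.+1 -> \bar R :=
  pushforward (lebesgue_measure \x^ mu)%E (@rV_cons n).

HB.instance Definition _ n mu := Measure.copy (@rV_lebesgue_succ n mu)
  (measure_function_pushforward__canonical__measure_function_Measure
     (lebesgue_measure \x^ mu)%E (@measurable_rV_cons n)).

(* Lebesgue measure on R^n, as the n-fold product of the one-dimensional one.
   Only Borel sets are measurable, so that classes in L^2 are given by their
   Borel representatives. *)
Fixpoint rV_lebesgue n : {measure set 'rV[R]_n -> \bar R} :=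
  if n is m.+1 then rV_lebesgue_succ (rV_lebesgue m) else \d_(0 : 'rV[R]_0).

End LebesgueMeasure.

Section Dirichlet.
Context {R : realType} {n : nat}.
Implicit Types (Omega omega : set 'rV[R]_n) (f g u v psi : 'rV[R]_n -> R^o).

Definition partial (i : 'I_n) f : 'rV[R]_n -> R^o := 'D_(delta_mx 0 i) f.

Definition laplacian f : 'rV[R]_n -> R^o :=
  fun x => \sum_i partial i (partial i f) x.

Fixpoint Ck (k : nat) f : Prop :=
  continuous f /\
  if k is m.+1 then
    forall i, (forall x, derivable f x (delta_mx 0 i)) /\ Ck m (partial i f)
  else True.

Definition test_function Omega psi : Prop :=
  [/\ forall k, Ck k psi,
      compact (closure [set x | psi x != 0]) &
      closure [set x | psi x != 0] `<=` Omega].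

(* Elements of L^2(Omega) are real-valued and only their values on Omega
   matter: they are extended by 0. *)
Definition L2 Omega u : Prop := u \_ Omega \in Lfun (rV_lebesgue n) 2%:E.

Definition L2norm Omega u : \bar R :=
  ('N[rV_lebesgue n]_2%:E [EFin \o (u \_ Omega)])%E.

Definition L2inner Omega u v : R := Rintegral (rV_lebesgue n) Omega (u \* v).

Definition weak_partial Omega (i : 'I_n) u g : Prop :=
  forall psi, test_function Omega psi ->
    L2inner Omega u (partial i psi) = - L2inner Omega g psi.

(* The closure of the test functions in H^1(Omega). *)
Definition H10 Omega u : Prop :=
  L2 Omega u /\
  exists (g : 'I_n -> 'rV[R]_n -> R^o) (psi : nat -> 'rV[R]_n -> R^o),
    [/\ forall i, L2 Omega (g i) /\ weak_partial Omega i u (g i),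
        forall j, test_function Omega (psi j),
        L2norm Omega (psi j \- u) @[j --> \oo] --> 0%E &
        forall i,
          L2norm Omega (partial i (psi j) \- g i) @[j --> \oo] --> 0%E].

(* phi is in H^1_0(Omega) and - Delta phi = lambda phi in the sense of
   distributions. Such a phi has a continuous representative (elliptic
   regularity), and it is this representative that is meant: pointwise values
   on sets of measure 0 are used below. *)
Definition dirichlet_eigenfunction Omega (lambda : R) (phi : 'rV[R]_n -> R^o) :
    Prop :=
  [/\ H10 Omega phi,
      {in Omega, continuous phi} &
      forall psi, test_function Omega psi ->
        L2inner Omega phi (fun x => - laplacian psi x) =
        lambda * L2inner Omega phi psi].

Definition dirichlet_eigenbasis Omega (phi : nat -> 'rV[R]_n -> R^o)
    (lambda : nat -> R) : Prop :=
  [/\ forall k, dirichlet_eigenfunction Omega (lambda k) (phi k),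
      forall k l, L2inner Omega (phi k) (phi l) = (k == l)%:R &
      forall u, L2 Omega u ->
        L2norm Omega
          (fun x => \sum_(k < N) L2inner Omega u (phi k) * phi k x - u x)
          @[N --> \oo] --> 0%E].

(* The sum is finite: a bounded domain has finitely many Dirichlet
   eigenvalues, with multiplicity, below any bound. *)
Definition spectral_projector Omega (phi : nat -> 'rV[R]_n -> R^o)
    (lambda : nat -> R) (Lambda : R) u : 'rV[R]_n -> R^o :=
  fun x => \sum_(k \in [set k | lambda k <= Lambda])
    (L2inner Omega u (phi k) * phi k x).

(* The projector does not depend on the eigenbasis used to compute it; the
   inequality is required for all of them, and their existence is included so
   that it is never satisfied vacuously. The supremum is taken in [-oo, +oo],
   with value -oo if omega is empty. *)
Definition spec Omega omega (C beta : R) : Prop :=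
  (exists phi lambda, dirichlet_eigenbasis Omega phi lambda) /\
  forall phi lambda, dirichlet_eigenbasis Omega phi lambda ->
  forall (Lambda : R) u, 0 < Lambda -> L2 Omega u ->
    (L2norm Omega (spectral_projector Omega phi lambda Lambda u) <=
     (C * expR (C * Lambda `^ beta))%:E *
     ereal_sup [set `|spectral_projector Omega phi lambda Lambda u x|%:E
               | x in omega])%E.

End Dirichlet.

Section Products.
Context {R : realType} {n1 n2 : nat}.

(* R^n1 x R^n2 is identified with R^(n1 + n2) by concatenation; lsubmx and
   rsubmx are then the coordinate projections. *)
Definition rV_setX (A : set 'rV[R]_n1) (B : set 'rV[R]_n2) :
    set 'rV[R]_(n1 + n2) :=
  [set z | A (lsubmx z) /\ B (rsubmx z)].

Definition proj_right (omega : set 'rV[R]_(n1 + n2)) : set 'rV[R]_n2 :=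
  rsubmx @` omega.

Definition hslice (Omega1 : set 'rV[R]_n1) (omega : set 'rV[R]_(n1 + n2))
    (y : 'rV[R]_n2) : set 'rV[R]_n1 :=
  lsubmx @` (omega `&` rV_setX Omega1 [set y]).

End Products.

Definition star_shaped_lipschitz_domain (R : realType) (n : nat)
    (Omega : set 'rV[R]_n) : Prop :=
  [/\ open Omega, bounded_set Omega, connected Omega,
      lipschitz_boundary Omega & locally_star_shaped Omega].

(* Main.v *)
Require Import Defs.
From HB Require Import structures.
From mathcomp Require Import all_boot all_order all_algebra.
From mathcomp Require Import all_classical all_reals all_analysis.
From mathcomp Require Import measurable_realfun ring lra zify.
Import Order.TTheory GRing.Theory Num.Theory.
Import numFieldNormedType.Exports.

Set Implicit Arguments.
Unset Strict Implicit.
Unset Printing Implicit Defensive.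

Local Open Scope classical_set_scope.
Local Open Scope ring_scope.

(** The Dirichlet Laplacian of a product separates variables. If (phi_i) and
    (psi_j) are eigenbases of Omega1 and Omega2 with eigenvalues lambda_i and mu_j,
    the functions phi_i(x) psi_j(y) form an eigenbasis of the product with
    eigenvalues lambda_i + mu_j ([tensor_eigenbasis]). A spectral projection v onto
    the eigenvalues at most Lambda, whatever eigenbasis it is computed in, is
    therefore a finite sum

      v(x, y) = sum_ij c_ij phi_i(x) psi_j(y)

    at every point of the product ([projector_change_basis]), and only pairs with
    lambda_i <= Lambda and mu_j <= Lambda occur because Dirichlet eigenvalues are
    nonnegative.

    Let S be the supremum of |v| over omega and K = C exp(C Lambda^beta). For y in
    the projection of omega, v(., y) is a combination of the phi_i with
    coefficients a_i(y) = sum_j c_ij psi_j(y) and is bounded by S on the slice at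
    y, so the inequality in x gives sum_i a_i(y)^2 <= (K S)^2. Each a_i is thus
    bounded by K S on the projection of omega, and, being a combination of the
    psi_j, satisfies sum_j c_ij^2 <= (K^2 S)^2 by the inequality in y. Summing over
    i bounds ||v||^2 by (K^2 S)^2 times the number of indices i with
    lambda_i <= Lambda ([coefficients_le]). This number grows at most polynomially
    in Lambda ([eigenvalue_count]), and since beta > 0 a polynomial is absorbed by
    the exponential ([polynomial_le_exp]).

    For the count, Omega1 is placed in a grid of small cubes. Poincare's inequality
    on all the cubes at once ([poincare_cells]) says that a function of H^1_0 of
    norm 1 with moderate gradient has at least half of its mass in the span of the
    indicators of the cubes. Bessel's inequality then limits the number of
    orthonormal eigenfunctions by twice the number of cubes.

    The tensors solve the eigenvalue equation weakly because a test function on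
    the product restricts to test functions on the slices ([eigenfunction_tensor]).
    They are complete by Parseval's identity in x for almost every y, followed by
    Parseval's identity in y ([parseval_tensor]). Eigenfunctions being continuous,
    their expansions hold pointwise and not only almost everywhere
    ([eigenfunction_expansion]); this matters because omega may be null. *)

(** * Square-integrable functions *)

Section SquareIntegrable.
Context d (T : measurableType d) (R : realType).
Variable mu : {measure set T -> \bar R}.
Implicit Types f g h u : T -> R.

Local Notation L2 := (Lfun mu 2%:E).

Lemma Lnorm2E f :
  ('N[mu]_2%:E[EFin \o f] = (\int[mu]_x (f x ^+ 2)%:E) `^ 2^-1)%E.
Proof.
rewrite unlock; congr (_ `^ _)%E; apply: eq_integral => x _.
by rewrite /= powR_mulrn ?real_normK ?num_real.
Qed.

Lemma Lfun2P f : f \in L2 <->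
  measurable_fun setT f /\ mu.-integrable setT (EFin \o (fun x => f x ^+ 2)).
Proof.
split=> [fL|[mf fi]].
  split; last exact: Lfun2_integrable_sqr.
  by move: fL; rewrite inE => /andP[/[!inE]].
rewrite inE; apply/andP; split; rewrite inE//= /finite_norm Lnorm2E.
apply: poweR_lty; move/integrableP: fi => [_]; apply: le_lt_trans.
rewrite le_eqVlt; apply/orP; left; apply/eqP/eq_integral => x _.
by rewrite /= ger0_norm ?sqr_ge0.
Qed.

Lemma Lfun2_measurable f : f \in L2 -> measurable_fun setT f.
Proof. by move/Lfun2P => []. Qed.

Lemma Lfun2_integrableM f g : f \in L2 -> g \in L2 ->
  mu.-integrable setT (EFin \o (fun x => f x * g x)).
Proof. by move=> fL gL; apply/Lfun1_integrable/Lfun2_mul_Lfun1. Qed.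

Lemma Lfun2D f g : f \in L2 -> g \in L2 -> (fun x => f x + g x) \in L2.
Proof.
move=> fL gL; apply/Lfun2P; split.
  by apply: measurable_funD; exact: Lfun2_measurable.
rewrite (_ : EFin \o _ = fun x => ((f x ^+ 2)%:E + 2%:E * (f x * g x)%:E +
    (g x ^+ 2)%:E)%E); last first.
  by apply/funext => x /=; rewrite -!EFinD; congr _%:E; ring.
apply: integrableD => //; last exact: Lfun2_integrable_sqr.
apply: integrableD => //; first exact: Lfun2_integrable_sqr.
by apply: integrableZl => //; exact: Lfun2_integrableM.
Qed.

Lemma Lfun2Z a f : f \in L2 -> (fun x => a * f x) \in L2.
Proof.
move=> fL; apply/Lfun2P; split.
  by apply: measurable_funM => //; exact: Lfun2_measurable.
rewrite (_ : EFin \o _ = fun x => ((a ^+ 2)%:E * (f x ^+ 2)%:E)%E).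
  by apply: integrableZl => //; exact: Lfun2_integrable_sqr.
by apply/funext => x /=; rewrite -EFinM exprMn.
Qed.

Lemma Lfun2N f : f \in L2 -> (fun x => - f x) \in L2.
Proof.
by move=> /(Lfun2Z (-1)); under eq_fun do rewrite mulN1r.
Qed.

Lemma Lfun2B f g : f \in L2 -> g \in L2 -> (fun x => f x - g x) \in L2.
Proof. by move=> fL /Lfun2N; exact: Lfun2D. Qed.

Lemma Lfun2_0 : (fun=> 0 : R) \in L2.
Proof.
apply/Lfun2P; split => //.
by under eq_fun do rewrite expr0n/=; exact: integrable0.
Qed.

Lemma Lfun2_sum I (s : seq I) (P : pred I) (F : I -> T -> R) :
  (forall i, P i -> F i \in L2) ->
  (fun x => \sum_(i <- s | P i) F i x) \in L2.
Proof.
move=> FL; elim: s => [|i s ih].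
  by under eq_fun do rewrite big_nil; exact: Lfun2_0.
under eq_fun do rewrite big_cons.
by case Pi: (P i) => //; exact: Lfun2D (FL _ Pi) ih.
Qed.

Definition inner f g : R := \int[mu]_x (f x * g x).

Lemma innerC f g : inner f g = inner g f.
Proof. by rewrite /inner; under eq_Rintegral do rewrite mulrC. Qed.

Lemma innerDl f g h : f \in L2 -> g \in L2 -> h \in L2 ->
  inner (fun x => f x + g x) h = inner f h + inner g h.
Proof.
move=> fL gL hL; rewrite /inner; under eq_Rintegral do rewrite mulrDl.
by rewrite RintegralD//; exact: Lfun2_integrableM.
Qed.

Lemma innerZl a f h : f \in L2 -> h \in L2 ->
  inner (fun x => a * f x) h = a * inner f h.
Proof.
move=> fL hL; rewrite /inner; under eq_Rintegral do rewrite -mulrA.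
by rewrite RintegralZl//; exact: Lfun2_integrableM.
Qed.

Lemma innerZr a f h : f \in L2 -> h \in L2 ->
  inner h (fun x => a * f x) = a * inner h f.
Proof. by move=> fL hL; rewrite innerC innerZl// innerC. Qed.

Lemma innerBl f g h : f \in L2 -> g \in L2 -> h \in L2 ->
  inner (fun x => f x - g x) h = inner f h - inner g h.
Proof.
move=> fL gL hL; rewrite /inner; under eq_Rintegral do rewrite mulrBl.
by rewrite RintegralB//; exact: Lfun2_integrableM.
Qed.

Lemma inner_0l h : inner (fun=> 0) h = 0.
Proof.
rewrite /inner; under eq_Rintegral do rewrite mul0r.
by rewrite Rintegral_cst// mul0r.
Qed.

Lemma inner_suml I (s : seq I) (P : pred I) (F : I -> T -> R) h :
  (forall i, P i -> F i \in L2) -> h \in L2 ->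
  inner (fun x => \sum_(i <- s | P i) F i x) h =
  \sum_(i <- s | P i) inner (F i) h.
Proof.
move=> FL hL; elim: s => [|i s ih].
  by under eq_fun do rewrite big_nil; rewrite inner_0l big_nil.
under eq_fun do rewrite big_cons.
rewrite big_cons; case Pi: (P i) => //.
by rewrite innerDl ?ih//; [exact: FL|exact: Lfun2_sum].
Qed.

Lemma inner_sumr I (s : seq I) (P : pred I) (F : I -> T -> R) h :
  (forall i, P i -> F i \in L2) -> h \in L2 ->
  inner h (fun x => \sum_(i <- s | P i) F i x) =
  \sum_(i <- s | P i) inner h (F i).
Proof.
move=> FL hL; rewrite innerC inner_suml//.
by apply: eq_bigr => i _; rewrite innerC.
Qed.

Lemma inner_ge0 f : 0 <= inner f f.
Proof. by apply: Rintegral_ge0 => x _; rewrite -expr2 sqr_ge0. Qed.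

Lemma integral_sqrE f : f \in L2 ->
  (\int[mu]_x (f x ^+ 2)%:E = (inner f f)%:E)%E.
Proof.
move=> fL; rewrite /inner /Rintegral fineK.
  by under eq_integral do rewrite expr2.
apply: integrable_fin_num => //; exact: Lfun2_integrableM.
Qed.

Lemma Lnorm2_inner f : f \in L2 ->
  'N[mu]_2%:E[EFin \o f]%E = (Num.sqrt (inner f f))%:E.
Proof.
by move=> fL; rewrite Lnorm2E integral_sqrE//= powR12_sqrt// inner_ge0.
Qed.

Lemma inner_sqrB f g : f \in L2 -> g \in L2 ->
  inner (fun x => f x - g x) (fun x => f x - g x) =
  inner f f - 2 * inner f g + inner g g.
Proof.
move=> fL gL; have fgL := Lfun2B fL gL.
rewrite innerBl// (innerC f) (innerC g) !innerBl// (innerC g f); ring.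
Qed.

(** The discriminant of the nonnegative quadratic t |-> ||f - t g||^2. *)
Lemma inner_cauchy_schwarz f g : f \in L2 -> g \in L2 ->
  (inner f g) ^+ 2 <= inner f f * inner g g.
Proof.
move=> fL gL.
have h t : 0 <= inner f f - 2 * t * inner f g + t ^+ 2 * inner g g.
  have tgL := Lfun2Z t gL.
  have := inner_ge0 (fun x => f x - t * g x).
  rewrite inner_sqrB// innerZl// !innerZr//.
  by congr (_ <= _); ring.
have [g0|g0] := eqVneq (inner g g) 0.
  rewrite g0 mulr0; have [->|fg0] := eqVneq (inner f g) 0.
    by rewrite expr0n.
  (* The quadratic is affine in t and equals -1 at this value. *)
  have := h ((inner f f + 1) / (2 * inner f g)).
  rewrite g0 mulr0 addr0.
  rewrite (_ : 2 * _ * _ = inner f f + 1); last by field.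
  by rewrite opprD addrA subrr add0r oppr_ge0 ler10.
have gp : 0 < inner g g by rewrite lt_def g0 inner_ge0.
have := h (inner f g / inner g g).
have -> : inner f f - 2 * (inner f g / inner g g) * inner f g +
  (inner f g / inner g g) ^+ 2 * inner g g =
  inner f f - (inner f g) ^+ 2 / inner g g by field.
by rewrite subr_ge0 ler_pdivrMr.
Qed.

End SquareIntegrable.

(** * Limits and orthonormal systems *)

Lemma eq_cvg_to (R : realType) (f g : nat -> R) (l : R) :
  f x @[x --> \oo] --> l -> f =1 g -> g x @[x --> \oo] --> l.
Proof. by move=> fl /funext <-. Qed.

Section InnerLimits.
Context d (T : measurableType d) (R : realType).
Variable mu : {measure set T -> \bar R}.
Implicit Types f g h u : T -> R.

Local Notation L2 := (Lfun mu 2%:E).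
Local Notation inner := (inner mu).

(** Limits in norm are handled through squared norms, which expand by
    bilinearity. *)
Lemma Lnorm2_cvg0P (w : nat -> T -> R) : (forall j, w j \in L2) ->
  ('N[mu]_2%:E[EFin \o w j]%E @[j --> \oo] --> 0%E) <->
  (inner (w j) (w j) @[j --> \oo] --> 0).
Proof.
move=> wL; under eq_fun do rewrite Lnorm2_inner//.
split=> [/fine_cvg /= h|h].
  have {}h : Num.sqrt (inner (w j) (w j)) * Num.sqrt (inner (w j) (w j))
      @[j --> \oo] --> (0 : R) * 0 by apply: cvgM.
  rewrite mulr0 in h; apply: (eq_cvg_to h) => j /=.
  by rewrite -expr2 sqr_sqrtr ?inner_ge0.
apply: cvg_EFin; first by apply: nearW.
rewrite -[X in _ --> X]sqrtr0.
exact: (continuous_cvg _ (@sqrt_continuous R 0) h).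
Qed.

Lemma inner_cvg (w : nat -> T -> R) f g :
  (forall j, w j \in L2) -> f \in L2 -> g \in L2 ->
  inner (fun x => w j x - f x) (fun x => w j x - f x) @[j --> \oo] --> 0 ->
  inner (w j) g @[j --> \oo] --> inner f g.
Proof.
move=> wL fL gL wf; apply/cvgrPdist_le => /= e e0.
pose K := inner g g + 1.
have K0 : 0 < K by rewrite ltr_wpDl// inner_ge0.
have /cvgrPdist_le/(_ (e ^+ 2 / K)) := wf.
rewrite divr_gt0 ?exprn_gt0// => /(_ isT); apply: filterS => j.
rewrite sub0r normrN ger0_norm ?inner_ge0// => dj.
have wfL := Lfun2B (wL j) fL.
rewrite distrC -innerBl// -(@ler_pXn2r _ 2)// ?nnegrE ?(ltW e0)//.
rewrite real_normK ?num_real//.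
apply: le_trans (inner_cauchy_schwarz wfL gL) _.
apply: (@le_trans _ _ (e ^+ 2 / K * K)); last by rewrite divfK// gt_eqF.
by apply: ler_pM => //; rewrite ?inner_ge0// lerDl.
Qed.

Lemma inner_sqr_cvg (w : nat -> T -> R) f :
  (forall j, w j \in L2) -> f \in L2 ->
  inner (fun x => w j x - f x) (fun x => w j x - f x) @[j --> \oo] --> 0 ->
  inner (w j) (w j) @[j --> \oo] --> inner f f.
Proof.
move=> wL fL wf.
have h : inner (fun x => w j x - f x) (fun x => w j x - f x) +
    2 * inner (w j) f - inner f f @[j --> \oo] -->
    0 + 2 * inner f f - inner f f.
  apply: cvgB; last exact: cvg_cst.
  by apply: cvgD => //; apply: cvgMr; exact: inner_cvg.
rewrite (_ : _ - _ = inner f f) in h; last by ring.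
apply: (eq_cvg_to h) => j /=.
by rewrite inner_sqrB//=; ring.
Qed.

Lemma inner_eq0_ae f : f \in L2 -> inner f f = 0 -> {ae mu, forall x, f x = 0}.
Proof.
move=> fL f0.
have /Lnorm_eq0_eq0 : 'N[mu]_2%:E[EFin \o f]%E = 0%E.
  by rewrite Lnorm2_inner// f0 sqrtr0.
have /measurable_EFinP mf := Lfun2_measurable fL.
move=> /(_ mf (ltr0n _ 2)); apply: filterS => x /(_ I) /=.
by case.
Qed.

End InnerLimits.

Section Orthonormal.
Context d (T : measurableType d) (R : realType).
Variable mu : {measure set T -> \bar R}.
Local Notation L2 := (Lfun mu 2%:E).
Local Notation inner := (inner mu).
Variable phi : nat -> T -> R.
Hypothesis phiL : forall k, phi k \in L2.
Hypothesis phi1 : forall k l, inner (phi k) (phi l) = (k == l)%:R.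

Lemma inner_comb N (c : nat -> R) l : (l < N)%N ->
  inner (fun x => \sum_(k < N) c k * phi k x) (phi l) = c l.
Proof.
move=> lN; rewrite inner_suml//; last by move=> i _; exact: Lfun2Z.
rewrite (bigD1 (Ordinal lN))//= innerZl// phi1 eqxx mulr1 big1 ?addr0//.
move=> i; rewrite -val_eqE/= => /negbTE il.
by rewrite innerZl// phi1 il mulr0.
Qed.

Lemma inner_comb_sqr N (c : nat -> R) :
  inner (fun x => \sum_(k < N) c k * phi k x)
        (fun x => \sum_(k < N) c k * phi k x) = \sum_(k < N) c k ^+ 2.
Proof.
rewrite inner_sumr; last 2 first.
- by move=> i _; exact: Lfun2Z.
- by apply: Lfun2_sum => i _; exact: Lfun2Z.
apply: eq_bigr => k _; rewrite innerZr ?inner_comb// -?expr2//.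
by apply: Lfun2_sum => i _; exact: Lfun2Z.
Qed.

Lemma inner_residual f N : f \in L2 ->
  let r x := \sum_(k < N) inner f (phi k) * phi k x - f x in
  inner r r = inner f f - \sum_(k < N) inner f (phi k) ^+ 2.
Proof.
move=> fL; have sL : (fun x => \sum_(k < N) inner f (phi k) * phi k x) \in L2.
  by apply: Lfun2_sum => i _; exact: Lfun2Z.
rewrite /= inner_sqrB// (inner_comb_sqr _ (fun k => inner f (phi k))).
rewrite inner_suml//; last by move=> i _; exact: Lfun2Z.
under [X in _ - 2 * X]eq_bigr do rewrite innerZl// (innerC _ (phi _)) -expr2.
ring.
Qed.

Lemma bessel f N : f \in L2 -> \sum_(k < N) inner f (phi k) ^+ 2 <= inner f f.
Proof.
by move=> fL; rewrite -subr_ge0 -inner_residual// inner_ge0.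
Qed.

(** By Pythagoras the squared norm of the residual is ||f||^2 minus the partial
    sum of squared coefficients. *)
Lemma parsevalP f : f \in L2 ->
  ('N[mu]_2%:E[EFin \o
     (fun x => \sum_(k < N) inner f (phi k) * phi k x - f x)%R]%E
     @[N --> \oo] --> 0%E) <->
  (\sum_(k < N) inner f (phi k) ^+ 2 @[N --> \oo] --> inner f f).
Proof.
move=> fL.
rewrite Lnorm2_cvg0P; last first.
  move=> N; apply: Lfun2B => //.
  by apply: Lfun2_sum => i _; exact: Lfun2Z.
under eq_fun do rewrite (inner_residual _ fL).
split=> [h|h].
  have {}h : inner f f - (inner f f - \sum_(k < N) inner f (phi k) ^+ 2)
      @[N --> \oo] --> inner f f - 0 by apply: cvgB; [exact: cvg_cst|exact: h].
  rewrite subr0 in h; apply: (eq_cvg_to h) => j /=.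
  by rewrite opprB addrC subrK.
have {}h : inner f f - \sum_(k < N) inner f (phi k) ^+ 2
    @[N --> \oo] --> inner f f - inner f f by apply: cvgB => //; exact: cvg_cst.
by rewrite subrr in h; exact: (eq_cvg_to h).
Qed.

End Orthonormal.

(** * Lebesgue measure on rows *)

Section RowMeasure.
Context {R : realType}.

Lemma measurable_rV d (T : measurableType d) n (f : T -> 'rV[R]_n) :
  (forall i, measurable_fun setT (fun t => f t 0 i : R)) ->
  measurable_fun setT f.
Proof.
move=> mf.
have h : g_sigma_preimage (fun i t => f t 0 i : measurableTypeR R)
    `<=` measurable.
  apply: smallest_sub; first exact: sigma_algebra_measurable.
  rewrite -bigcup_seq; apply: bigcup_sub => i _ B [C mC <-].
  exact: mf.
move=> _ A mA; rewrite setTI; apply: h.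
rewrite (g_sigma_preimage_comp
  (fun i (x : 'rV[R]_n) => x 0 i : measurableTypeR R) f).
by exists A => //; rewrite setTI.
Qed.

Lemma measurable_row_mx n1 n2 :
  measurable_fun setT (fun z : 'rV[R]_n1 * 'rV[R]_n2 => row_mx z.1 z.2).
Proof.
apply: measurable_rV => i; under eq_fun do rewrite mxE.
case: (fintype.split i) => j.
  by apply: (measurableT_comp (@measurable_coord R n1 j)); exact: measurable_fst.
by apply: (measurableT_comp (@measurable_coord R n2 j)); exact: measurable_snd.
Qed.

Lemma measurable_lsubmx n1 n2 :
  measurable_fun setT (fun z : 'rV[R]_(n1 + n2) => lsubmx z).
Proof.
apply: measurable_rV => i; under eq_fun do rewrite mxE.
exact: measurable_coord.
Qed.

Lemma measurable_rsubmx n1 n2 :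
  measurable_fun setT (fun z : 'rV[R]_(n1 + n2) => rsubmx z).
Proof.
apply: measurable_rV => i; under eq_fun do rewrite mxE.
exact: measurable_coord.
Qed.

Lemma ball_rVP n (c x : 'rV[R]_n) e : 0 < e ->
  ball c e x <-> forall i, `|c 0 i - x 0 i| < e.
Proof.
move=> e0; split=> [[_ cx] i|cx]; first exact: cx.
by split=> // i j; rewrite ord1; exact: cx.
Qed.

Lemma measurable_ball_rV n (c : 'rV[R]_n) e : 0 < e -> measurable (ball c e).
Proof.
move=> e0; rewrite (_ : ball c e = \bigcap_(i in [set: 'I_n])
    ((fun x : 'rV[R]_n => x 0 i) @^-1` ball (c 0 i) e)).
  apply: fin_bigcap_measurable => // i _; rewrite -[X in measurable X]setTI.
  by apply: measurable_coord => //; exact: measurable_ball.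
apply/seteqP; split => x.
  by move=> /(ball_rVP _ _ e0) cx i _; exact: cx.
by move=> cx; apply/(ball_rVP _ _ e0) => i; exact: cx.
Qed.

Lemma rV_cons0 n t (x : 'rV[R]_n) : rV_cons (t, x) 0 ord0 = t.
Proof. by rewrite mxE unlift_none. Qed.

Lemma rV_consS n t (x : 'rV[R]_n) i : rV_cons (t, x) 0 (lift ord0 i) = x 0 i.
Proof. by rewrite mxE liftK. Qed.

Lemma rV_lebesgueS n (A : set 'rV[R]_n.+1) :
  rV_lebesgue n.+1 A =
  (lebesgue_measure \x^ rV_lebesgue n)%E (@rV_cons R n @^-1` A).
Proof. by []. Qed.

Lemma rV_lebesgue_ball n (c : 'rV[R]_n) (e : R) : 0 < e ->
  rV_lebesgue n (ball c e) = ((2 * e) ^+ n)%:E.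
Proof.
move=> e0; elim: n c => [|n ih] c.
  rewrite /= diracE expr0 mem_set//; apply/(ball_rVP _ _ e0) => -[]//.
rewrite rV_lebesgueS.
have -> : @rV_cons R n @^-1` ball c e =
    ball (c 0 ord0 : R) e `*` ball (\row_i c 0 (lift ord0 i)) e.
  apply/seteqP; split => -[t x].
    move=> /(ball_rVP _ _ e0) cx; split; first by have := cx ord0; rewrite rV_cons0.
    by apply/(ball_rVP _ _ e0) => j; rewrite mxE; have := cx (lift ord0 j); rewrite rV_consS.
  move=> [ct /(ball_rVP _ _ e0) cx]; apply/(ball_rVP _ _ e0) => j.
  case: (unliftP ord0 j) => [k ->|->].
    by have := cx k; rewrite mxE rV_consS.
  by rewrite rV_cons0.
rewrite product_measure2E//; last 2 first.
- exact: measurable_ball.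
- exact: measurable_ball_rV.
rewrite exprS EFinM; congr (_ * _)%E; last exact: ih.
by apply: etrans (lebesgue_measure_ball _ (ltW e0)) _; rewrite mulr_natl.
Qed.

Lemma rV_lebesgue_sigma_finite n :
  sigma_finite setT (rV_lebesgue n : set 'rV[R]_n -> \bar R).
Proof.
exists (fun k => ball (0 : 'rV[R]_n) k.+1%:R).
  apply/esym/seteqP; split => // x _.
  have [k kx] : exists k : nat, forall i, `|x 0 i| < k.+1%:R.
    exists (Num.truncn (\sum_i `|x 0 i|)) => i.
    apply: le_lt_trans (truncnS_gt _).
    by rewrite (bigD1 i)//= lerDl sumr_ge0.
  exists k => //; apply/ball_rVP => // i; rewrite mxE sub0r normrN; exact: kx.
move=> k; split; first exact: measurable_ball_rV.
by rewrite rV_lebesgue_ball// ltry.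
Qed.

(** Lebesgue measure under a name that can carry its sigma-finiteness, on which
    Fubini's theorem relies. *)
Definition rV_leb n : set 'rV[R]_n -> \bar R := rV_lebesgue n.

HB.instance Definition _ n := Measure.copy (@rV_leb n) (rV_lebesgue n).

HB.instance Definition _ n := Measure_isSigmaFinite.Build _ _ _ (@rV_leb n)
  (@rV_lebesgue_sigma_finite n).

End RowMeasure.
Arguments rV_leb {R} n%_nat_scope A%_classical_set_scope.

(** * Lebesgue measure of a concatenation *)

Section RowProduct.
Context {R : realType}.

Lemma preimage_row_mx_measurable n1 n2 (A : set 'rV[R]_(n1 + n2)) :
  measurable A -> measurable ((fun z => row_mx z.1 z.2) @^-1` A).
Proof.
by move=> mA; rewrite -[X in measurable X]setTI; exact: measurable_row_mx.
Qed.

Lemma row_mx_rV_cons n1 n2 t (x : 'rV[R]_n1) (y : 'rV[R]_n2) :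
  row_mx (rV_cons (t, x)) y = rV_cons (t, row_mx x y) :> 'rV[R]_(n1 + n2).+1.
Proof.
apply/rowP => i; rewrite [RHS]mxE; case: unliftP => [j ->|->] /=; last first.
  rewrite (_ : ord0 = lshift n2 (ord0 : 'I_n1.+1)); last exact: val_inj.
  by apply: etrans (row_mxEl (rV_cons (t, x)) y 0 ord0) _; rewrite rV_cons0.
case: (split_ordP j) => k ->.
  rewrite row_mxEl (_ : lift _ _ = lshift n2 (lift ord0 k)); last exact: val_inj.
  apply: etrans (row_mxEl (rV_cons (t, x)) y 0 (lift ord0 k)) _.
  by rewrite rV_consS.
rewrite row_mxEr (_ : lift _ _ = rshift n1.+1 k); last exact: val_inj.
exact: (row_mxEr (rV_cons (t, x)) y 0 k).
Qed.

(** Induction on n1: the first coordinate is peeled off and the order of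
    integration exchanged. *)
Lemma rV_leb_row_mx n1 n2 (A : set 'rV[R]_(n1 + n2)) : measurable A ->
  rV_leb (n1 + n2) A =
  (rV_leb n1 \x rV_leb n2)%E ((fun z => row_mx z.1 z.2) @^-1` A).
Proof.
elim: n1 A => [|n1 ih] A mA.
  have mP := preimage_row_mx_measurable mA.
  have mX := measurable_fun_xsection (rV_leb n2) mP.
  rewrite /product_measure1 [RHS](integral_dirac _ measurableT mX).
  rewrite diracT mul1e/=; congr (rV_leb n2 _).
  apply/seteqP; split => y; rewrite /xsection/= inE/= row_thin_mx//.
have mP := preimage_row_mx_measurable mA.
have mC := measurable_rV_cons (n := (n1 + n2)%N).
have mB : measurable (@rV_cons R (n1 + n2) @^-1` A).
  by rewrite -[X in measurable X]setTI; exact: mC.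
have mrow := measurable_row_mx (R := R) (n1 := n1) (n2 := n2).
have ihI (f : 'rV[R]_(n1 + n2) -> \bar R) : measurable_fun setT f ->
    (forall x, 0 <= f x)%E ->
    (\int[rV_leb (n1 + n2)]_w f w =
     \int[rV_leb n2]_y \int[rV_leb n1]_x f (row_mx x y))%E.
  move=> mf f0.
  rewrite (eq_measure_integral
    (pushforward (rV_leb n1 \x rV_leb n2)%E (fun z => row_mx z.1 z.2))).
    rewrite ge0_integral_pushforward// preimage_setT fubini_tonelli2//.
      exact: measurableT_comp.
    by move=> z; exact: f0.
  by move=> B mB' _; exact: ih.
have mG := measurable_fun_ysection lebesgue_measure mB.
transitivity (\int[rV_leb n2]_y \int[rV_leb n1]_x
   lebesgue_measure (ysection (@rV_cons R (n1 + n2) @^-1` A) (row_mx x y)))%E.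
  by rewrite -(ihI _ mG).
transitivity (\int[rV_leb n1.+1 \x rV_leb n2]_z
    (\1_((fun z => row_mx z.1 z.2) @^-1` A) z)%:E)%E; last first.
  by rewrite integral_indic// setIT.
rewrite fubini_tonelli2//; last first.
  by apply/measurable_EFinP; exact: measurable_indic.
apply: eq_integral => y _; rewrite indic_fubini_tonelli_GE//.
transitivity (rV_lebesgue n1.+1
    (ysection ((fun z => row_mx z.1 z.2) @^-1` A) y)); last by [].
rewrite rV_lebesgueS; apply: eq_integral => x _ /=.
congr lebesgue_measure; apply/funext => t; apply/propext.
rewrite /ysection/= !inE/=.
have E : A (row_mx (rV_cons (t, x)) y) = A (rV_cons (t, row_mx x y)).
  by congr A; exact: row_mx_rV_cons.
by split=> [h|/set_mem /= h]; [apply: mem_set; rewrite /= E|rewrite -E].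
Qed.

End RowProduct.

(** * Fubini in product coordinates *)

(** Concatenation of rows and prepending a coordinate both present a measured
    space as a product up to a bijection; the Fubini arguments are made once for
    all such presentations. *)
Record product_coordinates d d1 d2 (T : measurableType d)
    (T1 : measurableType d1) (T2 : measurableType d2) (R : realType)
    (mu : {measure set T -> \bar R}) (m1 : {sigma_finite_measure set T1 -> \bar R})
    (m2 : {sigma_finite_measure set T2 -> \bar R})
    (pr : T1 * T2 -> T) (p1 : T -> T1) (p2 : T -> T2) : Prop := {
  measurable_pr : measurable_fun setT pr;
  measurable_p1 : measurable_fun setT p1;
  measurable_p2 : measurable_fun setT p2;
  p1K : forall x y, p1 (pr (x, y)) = x;
  p2K : forall x y, p2 (pr (x, y)) = y;
  product_measureE : forall A, measurable A -> mu A = (m1 \x m2)%E (pr @^-1` A)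
}.

Section ProductSpace.
Context d d1 d2 (T : measurableType d) (T1 : measurableType d1)
  (T2 : measurableType d2) (R : realType).
Variables (mu : {measure set T -> \bar R})
  (m1 : {sigma_finite_measure set T1 -> \bar R})
  (m2 : {sigma_finite_measure set T2 -> \bar R}).
Variables (pr : T1 * T2 -> T) (p1 : T -> T1) (p2 : T -> T2).
Hypothesis PC : product_coordinates mu m1 m2 pr p1 p2.

Local Notation L2 := (Lfun mu 2%:E).
Local Notation L2_1 := (Lfun m1 2%:E).
Local Notation L2_2 := (Lfun m2 2%:E).

Let mpr := measurable_pr PC.
Let mp1 := measurable_p1 PC.
Let mp2 := measurable_p2 PC.

Lemma ge0_integral_product (f : T -> \bar R) : measurable_fun setT f ->
  (forall z, 0 <= f z)%E ->
  (\int[mu]_z f z = \int[m1 \x m2]_z f (pr z))%E.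
Proof.
move=> mf f0; rewrite (eq_measure_integral (pushforward (m1 \x m2)%E pr)).
  by rewrite ge0_integral_pushforward// preimage_setT.
by move=> A mA _; exact: (product_measureE PC).
Qed.

Lemma ge0_integral_product2 (f : T -> \bar R) : measurable_fun setT f ->
  (forall z, 0 <= f z)%E ->
  (\int[mu]_z f z = \int[m2]_y \int[m1]_x f (pr (x, y)))%E.
Proof.
move=> mf f0; rewrite ge0_integral_product// fubini_tonelli2//.
exact: measurableT_comp.
Qed.

Lemma integrable_product (f : T -> \bar R) : mu.-integrable setT f ->
  (m1 \x m2)%E.-integrable setT (f \o pr).
Proof.
move=> /integrableP[mf fi]; apply/integrableP; split.
  exact: measurableT_comp.
move: fi; rewrite ge0_integral_product//; exact: measurableT_comp.
Qed.

Lemma integral_product (f : T -> \bar R) : mu.-integrable setT f ->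
  (\int[mu]_z f z = \int[m1 \x m2]_z f (pr z))%E.
Proof.
move=> fi; have mf := measurable_int _ fi.
rewrite (eq_measure_integral (pushforward (m1 \x m2)%E pr)).
  rewrite integral_pushforward// preimage_setT; exact: integrable_product.
by move=> A mA _; exact: (product_measureE PC).
Qed.

Lemma ae_integrable_slice (f : T -> \bar R) : mu.-integrable setT f ->
  \forall y \ae m2, m1.-integrable setT (fun x => f (pr (x, y))).
Proof. by move=> /integrable_product /ae_integrable2. Qed.

Lemma measurable_integral_slice (f : T -> \bar R) : measurable_fun setT f ->
  measurable_fun setT (fun y => \int[m1]_x f (pr (x, y)))%E.
Proof.
move=> mf.
rewrite (_ : (fun y => _) =
    (fubini_G m1 (f^\+ \o pr) \- fubini_G m1 (f^\- \o pr))%E); last first.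
  apply/funext => y; rewrite [LHS]integralE; congr (_ - _)%E;
    by apply: eq_integral => x _; rewrite /= ?funeposE ?funenegE.
have h (g : T -> \bar R) : measurable_fun setT g -> (forall z, 0 <= g z)%E ->
    measurable_fun setT (fubini_G m1 (g \o pr)).
  move=> mg g0; apply: measurable_fun_fubini_tonelli_G => //.
    exact: measurableT_comp.
  by move=> z; exact: g0.
apply: emeasurable_funB.
  exact: (h _ (measurable_funepos mf) (fun=> funepos_ge0 _ _)).
exact: (h _ (measurable_funeneg mf) (fun=> funeneg_ge0 _ _)).
Qed.

Lemma measurable_Rintegral_slice (f : T -> R) : measurable_fun setT f ->
  measurable_fun setT (fun y => \int[m1]_x f (pr (x, y))).
Proof.
move=> mf; apply: measurableT_comp => //.
apply: (measurable_integral_slice (f := EFin \o f)).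
exact/measurable_EFinP.
Qed.

Lemma ae_eq_Rintegral d' (S : measurableType d') (m : {measure set S -> \bar R})
    (f g : S -> R) : measurable_fun setT f -> measurable_fun setT g ->
  {ae m, forall x, f x = g x} -> \int[m]_x f x = \int[m]_x g x.
Proof.
move=> mf mg fg; congr fine; apply: ae_eq_integral => //.
- exact/measurable_EFinP.
- exact/measurable_EFinP.
- by apply: filterS fg => x ->.
Qed.

Lemma Rintegral_product (f : T -> R) : mu.-integrable setT (EFin \o f) ->
  \int[mu]_z f z = \int[m2]_y (\int[m1]_x f (pr (x, y))).
Proof.
move=> fi; have mf : measurable_fun setT f.
  by apply/measurable_EFinP; exact: measurable_int fi.
have fpi := integrable_product fi.
rewrite /Rintegral integral_product// -(integral21_prod_meas1 fpi).
congr fine; apply: ae_eq_integral => //.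
- exact: (measurable_fubini_G fpi).
- by apply/measurable_EFinP; exact: measurable_Rintegral_slice.
- have := ae_integrable2 fpi; apply: filterS => y yi _.
  by rewrite /= fineK//; exact: integrable_fin_num yi.
Qed.

Definition tensor (a : T1 -> R) (b : T2 -> R) (z : T) : R := a (p1 z) * b (p2 z).

Lemma tensor_pr a b x y : tensor a b (pr (x, y)) = a x * b y.
Proof. by rewrite /tensor (p1K PC) (p2K PC). Qed.

Lemma measurable_tensor a b : measurable_fun setT a -> measurable_fun setT b ->
  measurable_fun setT (tensor a b).
Proof.
by move=> ma mb; apply: measurable_funM; exact: measurableT_comp.
Qed.

Lemma Lfun2_tensor a b : a \in L2_1 -> b \in L2_2 -> tensor a b \in L2.
Proof.
move=> aL bL; have ma := Lfun2_measurable aL; have mb := Lfun2_measurable bL.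
have mab := measurable_tensor ma mb.
apply/Lfun2P; split => //; apply/integrableP; split.
  by apply/measurable_EFinP; exact: measurable_funX.
under eq_integral do rewrite /= ger0_norm ?sqr_ge0//.
rewrite ge0_integral_product2//; last 2 first.
- by apply/measurable_EFinP; exact: measurable_funX.
- by move=> z; rewrite lee_fin sqr_ge0.
have mb2 : measurable_fun setT (fun y => (b y ^+ 2)%:E).
  by apply/measurable_EFinP; exact: measurable_funX.
have ma2 : measurable_fun setT (fun y => (a y ^+ 2)%:E).
  by apply/measurable_EFinP; exact: measurable_funX.
under eq_integral => y _.
  under eq_integral do rewrite tensor_pr exprMn mulrC EFinM.
  rewrite ge0_integralZl ?lee_fin ?sqr_ge0//; last first.
    by move=> x _; rewrite lee_fin sqr_ge0.
  rewrite integral_sqrE// muleC.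
  over.
rewrite ge0_integralZl ?lee_fin ?inner_ge0//; last first.
  by move=> x _; rewrite lee_fin sqr_ge0.
by rewrite integral_sqrE// -EFinM ltry.
Qed.

Lemma inner_tensor a b a' b' : a \in L2_1 -> b \in L2_2 -> a' \in L2_1 ->
  b' \in L2_2 ->
  inner mu (tensor a b) (tensor a' b') = inner m1 a a' * inner m2 b b'.
Proof.
move=> aL bL a'L b'L; rewrite {1}/inner Rintegral_product; last first.
  by apply: Lfun2_integrableM; exact: Lfun2_tensor.
rewrite /= mulrC -RintegralZr//; last exact: Lfun2_integrableM.
apply: eq_Rintegral => y _.
under eq_Rintegral do rewrite !tensor_pr mulrACA mulrC.
by rewrite RintegralZl//; exact: Lfun2_integrableM.
Qed.

(** The Fourier coefficient along a of the slices of f, as a function of the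
    second variable. *)
Definition partial_inner (f : T -> R) (a : T1 -> R) (y : T2) : R :=
  inner m1 (fun x => f (pr (x, y))) a.

Lemma ae_slice_Lfun2 f : f \in L2 ->
  \forall y \ae m2, (fun x => f (pr (x, y))) \in L2_1.
Proof.
move=> fL; have mf := Lfun2_measurable fL.
have := ae_integrable_slice (Lfun2_integrable_sqr fL); apply: filterS => y fi.
apply/Lfun2P; split => //.
by apply: (measurableT_comp mf); apply: (measurableT_comp mpr); exact: pair2_measurable.
Qed.

Lemma measurable_partial_inner f a : measurable_fun setT f ->
  measurable_fun setT a -> measurable_fun setT (partial_inner f a).
Proof.
move=> mf ma.
have h : measurable_fun setT (fun z => f z * a (p1 z)).
  by apply: measurable_funM => //; exact: measurableT_comp.
have := measurable_Rintegral_slice h; congr measurable_fun.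
by apply/funext => y; apply: eq_Rintegral => x _; rewrite (p1K PC).
Qed.

Lemma integral_sqr_slice f : f \in L2 ->
  (\int[m2]_y \int[m1]_x (f (pr (x, y)) ^+ 2)%:E = (inner mu f f)%:E)%E.
Proof.
move=> fL; rewrite -integral_sqrE// [RHS]ge0_integral_product2//.
- by apply/measurable_EFinP/measurable_funX; exact: Lfun2_measurable fL.
- by move=> z; rewrite lee_fin sqr_ge0.
Qed.

Lemma measurable_sqr_slice f : f \in L2 ->
  measurable_fun setT (fun y => \int[m1]_x (f (pr (x, y)) ^+ 2)%:E)%E.
Proof.
move=> fL; apply: (measurable_integral_slice (f := fun z => (f z ^+ 2)%:E)).
by apply/measurable_EFinP/measurable_funX; exact: Lfun2_measurable fL.
Qed.

(** Cauchy-Schwarz on almost every slice, integrated over the second variable. *)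
Lemma Lfun2_partial_inner f a : f \in L2 -> a \in L2_1 ->
  partial_inner f a \in L2_2.
Proof.
move=> fL aL.
have mU := measurable_partial_inner (Lfun2_measurable fL) (Lfun2_measurable aL).
have mU2 : measurable_fun setT (fun y => (partial_inner f a y ^+ 2)%:E).
  by apply/measurable_EFinP; exact: measurable_funX.
apply/Lfun2P; split => //; apply/integrableP; split => //.
under eq_integral do rewrite /= ger0_norm ?sqr_ge0//.
apply: (@le_lt_trans _ _ (\int[m2]_y ((inner m1 a a)%:E *
    \int[m1]_x (f (pr (x, y)) ^+ 2)%:E))%E).
  apply: ae_ge0_le_integral => //.
  - by move=> y _; rewrite lee_fin sqr_ge0.
  - move=> y _; rewrite mule_ge0 ?lee_fin ?inner_ge0//.
    by apply: integral_ge0 => x _; rewrite lee_fin sqr_ge0.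
  - by apply: emeasurable_funM => //; exact: measurable_sqr_slice.
  have := ae_slice_Lfun2 fL; apply: filterS => y yL _.
  rewrite integral_sqrE// -EFinM lee_fin mulrC.
  exact: inner_cauchy_schwarz.
rewrite ge0_integralZl ?lee_fin ?inner_ge0//; last 2 first.
- exact: measurable_sqr_slice.
- by move=> y _; apply: integral_ge0 => x _; rewrite lee_fin sqr_ge0.
by rewrite integral_sqr_slice// -EFinM ltry.
Qed.

Lemma inner_partial_inner f a b : f \in L2 -> a \in L2_1 -> b \in L2_2 ->
  inner mu f (tensor a b) = inner m2 (partial_inner f a) b.
Proof.
move=> fL aL bL; have abL := Lfun2_tensor aL bL.
have fabi := Lfun2_integrableM fL abL.
rewrite {1}/inner Rintegral_product//; apply: ae_eq_Rintegral.
- apply: (measurable_Rintegral_slice (f := fun z => f z * tensor a b z)).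
  by apply: measurable_funM; [exact: Lfun2_measurable fL|
    exact: Lfun2_measurable abL].
- by apply: measurable_funM; [
    exact: Lfun2_measurable (Lfun2_partial_inner fL aL)|
    exact: Lfun2_measurable bL].
have := ae_slice_Lfun2 fL; apply: filterS => y yL.
under eq_Rintegral do rewrite tensor_pr mulrA.
by rewrite RintegralZr//; exact: Lfun2_integrableM yL aL.
Qed.

End ProductSpace.

(** * Parseval's identity for tensor products *)

Section SumsAlongEnumerations.
Context (R : realType).

Lemma ler_sum_subset (I : eqType) (s t : seq I) (g : I -> R) :
  (forall i, 0 <= g i) -> uniq s -> {subset s <= t} ->
  \sum_(i <- s) g i <= \sum_(i <- t) g i.
Proof.
move=> g0; elim: s t => [|x s ih] t /=; first by rewrite big_nil sumr_ge0.
move=> /andP[xs us] st; have xt : x \in t by apply: st; rewrite mem_head.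
rewrite (perm_big _ (perm_to_rem xt)) !big_cons lerD2l ih// => y ys.
apply: rem_mem; last by apply: st; rewrite inE ys orbT.
by apply: contraNneq xs => <-.
Qed.

Lemma cvg_sumr (T : Type) (G : set_system T) {FG : Filter G} (I : Type)
    (s : seq I) (u : I -> T -> R) (l : I -> R) :
  (forall i, u i x @[x --> G] --> l i) ->
  \sum_(i <- s) u i x @[x --> G] --> \sum_(i <- s) l i.
Proof.
move=> ul; elim: s => [|i s ih].
  by under eq_fun do rewrite big_nil; rewrite big_nil; exact: cvg_cst.
by under eq_fun do rewrite big_cons; rewrite big_cons; exact: cvgD.
Qed.

(** Nonnegative terms may be summed in any order: a finite rectangle carrying
    almost all of the iterated sum is covered by the enumeration, while F bounds
    its partial sums from above. *)
Lemma cvg_sum_enumeration (c : nat * nat -> R) (g : nat -> R) (F : R)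
    (e : nat -> nat * nat) :
  (forall p, 0 <= c p) ->
  (forall i, \sum_(j < M) c (i, val j) @[M --> \oo] --> g i) ->
  \sum_(i < N) g i @[N --> \oo] --> F ->
  (forall p, exists m, e m = p) ->
  (forall n, \sum_(m < n) c (e m) <= F) ->
  \sum_(m < n) c (e m) @[n --> \oo] --> F.
Proof.
move=> c0 cg gF esurj sF; apply/cvgrPdist_le => /= eps eps0.
have eps2 : 0 < eps / 2 by rewrite divr_gt0.
have /cvgrPdist_le/(_ _ eps2)[N _ /(_ N (leqnn N)) /= hN] := gF.
have cgN : \sum_(i < N) \sum_(j < M) c (val i, val j) @[M --> \oo] -->
    \sum_(i < N) g i by apply: cvg_sumr => i; exact: cg.
have /cvgrPdist_le/(_ _ eps2)[M _ /(_ M (leqnn M)) /= hM] := cgN.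
have [inv invK] := choice esurj.
pose s := [seq (i, j) | i <- iota 0 N, j <- iota 0 M].
exists (\max_(p <- s) inv p).+1 => // n /= hn.
rewrite ger0_norm ?subr_ge0 ?sF//.
suff : \sum_(i < N) \sum_(j < M) c (i : nat, j : nat) <= \sum_(m < n) c (e m).
  move=> h; move: hN hM => /ler_normlP[_ hN] /ler_normlP[_ hM].
  have := lerD (lerD hN hM) h; lra.
have -> : \sum_(m < n) c (e m) = \sum_(p <- [seq e m | m <- iota 0 n]) c p.
  by rewrite big_map -[in RHS](subn0 n) -/(index_iota 0 n) big_mkord.
have -> : \sum_(i < N) \sum_(j < M) c (i : nat, j : nat) = \sum_(p <- s) c p.
  rewrite big_allpairs -[in RHS](subn0 N) -/(index_iota 0 N) big_mkord.
  apply: eq_bigr => i _.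
  by rewrite -[in RHS](subn0 M) -/(index_iota 0 M) big_mkord.
apply: ler_sum_subset => //.
  by apply: allpairs_uniq; rewrite ?iota_uniq// => -[? ?] [? ?] _ _ [-> ->].
move=> p ps; apply/mapP; exists (inv p); last by rewrite invK.
rewrite mem_iota add0n leq0n/=; apply: leq_trans hn.
exact: leq_bigmax_seq.
Qed.

End SumsAlongEnumerations.

(** Completeness of phi among the square-integrable functions vanishing off D,
    in the form of Parseval's identity. *)
Definition parseval_on d (T : measurableType d) (R : realType)
    (mu : {measure set T -> \bar R}) (D : set T) (phi : nat -> T -> R) : Prop :=
  forall f, f \in Lfun mu 2%:E -> (forall x, ~ D x -> f x = 0) ->
  \sum_(k < N) inner mu f (phi k) ^+ 2 @[N --> \oo] --> inner mu f f.

Section TensorBasis.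
Context d d1 d2 (T : measurableType d) (T1 : measurableType d1)
  (T2 : measurableType d2) (R : realType).
Variables (mu : {measure set T -> \bar R})
  (m1 : {sigma_finite_measure set T1 -> \bar R})
  (m2 : {sigma_finite_measure set T2 -> \bar R}).
Variables (pr : T1 * T2 -> T) (p1 : T -> T1) (p2 : T -> T2).
Hypothesis PC : product_coordinates mu m1 m2 pr p1 p2.
Variables (phi : nat -> T1 -> R) (psi : nat -> T2 -> R).
Hypothesis phiL : forall i, phi i \in Lfun m1 2%:E.
Hypothesis psiL : forall j, psi j \in Lfun m2 2%:E.
Hypothesis phi1 : forall k l, inner m1 (phi k) (phi l) = (k == l)%:R.
Hypothesis psi1 : forall k l, inner m2 (psi k) (psi l) = (k == l)%:R.
Variable e : nat -> nat * nat.
Hypothesis einj : injective e.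
Hypothesis esurj : forall p, exists m, e m = p.

Definition tensor_basis m : T -> R := tensor p1 p2 (phi (e m).1) (psi (e m).2).

Lemma Lfun2_tensor_basis m : tensor_basis m \in Lfun mu 2%:E.
Proof. exact: (Lfun2_tensor PC). Qed.

Lemma tensor_basis_orthonormal k l :
  inner mu (tensor_basis k) (tensor_basis l) = (k == l)%:R.
Proof.
rewrite (inner_tensor PC)// phi1 psi1 -natrM mulnb.
rewrite (_ : (k == l) = (e k == e l)); last by rewrite inj_eq.
by case: (e k) => a b; case: (e l) => a' b'; rewrite xpair_eqE.
Qed.

(** Parseval on almost every slice, integrated over the second variable by
    monotone convergence. *)
Lemma cvg_norm_slices D1 f : parseval_on m1 D1 phi -> f \in Lfun mu 2%:E ->
  (forall z, ~ D1 (p1 z) -> f z = 0) ->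
  \sum_(i < N) inner m2 (partial_inner m1 pr f (phi i))
    (partial_inner m1 pr f (phi i)) @[N --> \oo] --> inner mu f f.
Proof.
move=> P1 fL f0; pose U i := partial_inner m1 pr f (phi i).
have UL i : U i \in Lfun m2 2%:E by exact: (Lfun2_partial_inner PC).
pose G n y := (\sum_(i < n) U i y ^+ 2)%:E.
have mU2 i : measurable_fun setT (fun y => (U i y ^+ 2)%:E).
  by apply/measurable_EFinP/measurable_funX; exact: Lfun2_measurable (UL i).
have mG n : measurable_fun setT (G n).
  apply/measurable_EFinP; apply: measurable_sum => i.
  by apply: measurable_funX; exact: Lfun2_measurable (UL i).
have G0 n y : setT y -> (0 <= G n y)%E.
  by move=> _; rewrite lee_fin sumr_ge0// => i _; exact: sqr_ge0.
have ndG y : setT y -> {homo G^~ y : n m / (n <= m)%N >-> (n <= m)%E}.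
  move=> _; apply/nondecreasing_seqP => n.
  by rewrite lee_fin big_ord_recr/= lerDl sqr_ge0.
have IG n : (\int[m2]_y G n y = (\sum_(i < n) inner m2 (U i) (U i))%:E)%E.
  rewrite /G; under eq_integral do rewrite -sumEFin.
  rewrite (@ge0_integral_sum _ _ _ _ _ _ _ (fun (i : 'I_n) y => (U i y ^+ 2)%:E))//.
    by rewrite -sumEFin; apply: eq_bigr => i _; rewrite integral_sqrE.
  by move=> i y _; rewrite lee_fin sqr_ge0.
have := cvg_monotone_convergence (mu := m2) measurableT mG G0 ndG.
rewrite (_ : (\int[m2]_y _)%E = (inner mu f f)%:E); last first.
  rewrite -(integral_sqr_slice PC fL); apply: ge0_ae_eq_integral => //.
  - apply: (emeasurable_fun_cvg G) => // y _.
    exact: ereal_nondecreasing_is_cvgn (ndG y I).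
  - exact: (measurable_sqr_slice PC).
  - by move=> y _; apply: lime_ge; [exact: ereal_nondecreasing_is_cvgn (ndG y I)|
      apply: nearW => n; exact: G0].
  - by move=> y _; apply: integral_ge0 => x _; rewrite lee_fin sqr_ge0.
  have := ae_slice_Lfun2 PC fL; apply: filterS => y yL _ /=.
  rewrite integral_sqrE//; apply/cvg_lim => //; apply: cvg_EFin.
    exact: nearW.
  apply: (P1 _ yL) => x D1x; apply: f0; by rewrite (p1K PC).
under eq_fun do rewrite IG.
by move/fine_cvg.
Qed.

(** Expand first in x for almost every y, then in y each of the resulting
    coefficients. *)
Lemma parseval_tensor D1 D2 : parseval_on m1 D1 phi -> parseval_on m2 D2 psi ->
  parseval_on mu [set z | D1 (p1 z) /\ D2 (p2 z)] tensor_basis.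
Proof.
move=> P1 P2 f fL f0.
pose U i := partial_inner m1 pr f (phi i).
have UL i : U i \in Lfun m2 2%:E by exact: (Lfun2_partial_inner PC).
pose c p := inner mu f (tensor p1 p2 (phi p.1) (psi p.2)).
apply: (@cvg_sum_enumeration R (fun p => c p ^+ 2)
  (fun i => inner m2 (U i) (U i))) => //.
- by move=> p; exact: sqr_ge0.
- move=> i; under eq_fun do under eq_bigr do
    rewrite /c/= (inner_partial_inner PC)//.
  apply: P2 => // y D2y; rewrite /U /partial_inner.
  rewrite (_ : (fun x => _) = fun=> 0) ?inner_0l//.
  by apply/funext => x; apply: f0; rewrite /= (p1K PC) (p2K PC) => -[].
- by apply: (cvg_norm_slices P1) => // z D1z; apply: f0 => -[].
- move=> n; apply: (bessel Lfun2_tensor_basis tensor_basis_orthonormal n fL).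
Qed.

End TensorBasis.

(** * Borel sets and continuous functions *)

Section BorelRows.
Context {R : realType} {n : nat}.
Implicit Types A : set 'rV[R]_n.

(** Every open set is a countable union of balls with rational centre and
    radius. *)
Lemma open_measurable_rV A : open A -> measurable A.
Proof.
move=> oA.
pose F k : set 'rV[R]_n :=
  if (unpickle k : option ('rV[rat]_n * rat)) is Some (q, r) then
    if `[< 0 < ratr r :> R /\ ball (map_mx ratr q : 'rV[R]_n) (ratr r) `<=` A >]
    then ball (map_mx ratr q : 'rV[R]_n) (ratr r) else set0
  else set0.
have mF k : measurable (F k).
  rewrite /F; case: (unpickle k) => [[q r]|]; last exact: measurable0.
  by case: asboolP => [[r0 _]|_]; [exact: measurable_ball_rV|exact: measurable0].
rewrite (_ : A = \bigcup_k F k); first exact: bigcupT_measurable.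
apply/seteqP; split=> x; last first.
  move=> [k _]; rewrite /F; case: (unpickle k) => [[q r]|//].
  by case: asboolP => [[_ h]|//]; exact: h.
move=> Ax; have /nbhs_ballP[e /= e0 eA] : nbhs x A by exact: open_nbhs_nbhs.
have [r] := @rat_in_itvoo R 0 (e / 2) (divr_gt0 e0 (ltr0n _ 2)).
rewrite in_itv/= => /andP[r0 re].
have /choice[q qE] : forall i, exists q : rat,
    ratr q \in `](x 0 i - ratr r : R), (x 0 i + ratr r)[.
  by move=> i; apply: rat_in_itvoo; rewrite ltrD2l; lra.
pose Q : 'rV[rat]_n := \row_i q i.
have xQ i : `|x 0 i - (map_mx ratr Q : 'rV[R]_n) 0 i| < ratr r.
  rewrite !mxE ltr_norml; have := qE i; rewrite in_itv/= => /andP[]; lra.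
exists (pickle (Q, r)) => //; rewrite /F pickleK.
rewrite asboolT; first by apply/ball_rVP => // i; rewrite distrC.
split=> // y /(ball_rVP _ _ r0) yQ; apply: eA; apply/(ball_rVP _ _ e0) => i.
have := ler_distD ((map_mx ratr Q : 'rV[R]_n) 0 i) (x 0 i) (y 0 i).
have := xQ i; have := yQ i; lra.
Qed.

Lemma continuous_measurable_rV (f : 'rV[R]_n -> R^o) : continuous f ->
  measurable_fun setT (f : 'rV[R]_n -> R).
Proof.
move=> /continuousP cf; apply: (measurability _ (RGenOpens.measurableE R)).
move=> _ [_ [a [b ->] <-]]; rewrite setTI; apply: open_measurable_rV.
by apply: cf; exact: interval_open.
Qed.

Lemma rV_lebesgue_bounded A : measurable A -> bounded_set A ->
  (rV_lebesgue n A < +oo)%E.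
Proof.
move=> mA [M [_ bA]]; pose K := Num.max 1 (M + 1).
have K0 : 0 < K by rewrite lt_max ltr01.
have MK : M < K by rewrite lt_max; apply/orP; right; lra.
apply: (@le_lt_trans _ _ (rV_lebesgue n (ball (0 : 'rV[R]_n) (K + 1)))).
  apply: le_measure; rewrite ?inE//.
    by apply: measurable_ball_rV; lra.
  move=> x /(bA _ MK) /= xK; rewrite -ball_normE /= sub0r normrN; lra.
by rewrite rV_lebesgue_ball ?ltry//; lra.
Qed.

Lemma Lfun2_bounded_support (f : 'rV[R]_n -> R) A (M : R) :
  measurable_fun setT f -> measurable A -> bounded_set A ->
  (forall x, ~ A x -> f x = 0) -> (forall x, `|f x| <= M) ->
  f \in Lfun (rV_lebesgue n) 2%:E.
Proof.
move=> mf mA bA f0 fM; apply/Lfun2P; split => //.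
apply/integrableP; split.
  by apply/measurable_EFinP; exact: measurable_funX.
apply: (@le_lt_trans _ _ (\int[rV_lebesgue n]_x ((M ^+ 2)%:E * (\1_A x)%:E))%E).
  apply: ge0_le_integral => //.
  - apply: measurableT_comp => //; apply/measurable_EFinP; exact: measurable_funX.
  - apply: emeasurable_funM => //; apply/measurable_EFinP.
    exact: measurable_indic.
  - move=> x _; rewrite /= ger0_norm ?sqr_ge0// -EFinM lee_fin indicE.
    have [xA|xA] := boolP (x \in A).
      rewrite mulr1 -[leLHS]real_normK ?num_real//.
      by rewrite ler_pXn2r ?nnegrE// (le_trans _ (fM x)).
    by rewrite f0 ?expr0n ?mulr0//; move/negP: xA => + /mem_set.
rewrite ge0_integralZl ?lee_fin ?sqr_ge0//; last first.
  by apply/measurable_EFinP; exact: measurable_indic.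
rewrite integral_indic// setIT lte_mul_pinfty ?lee_fin ?sqr_ge0//.
exact: rV_lebesgue_bounded.
Qed.

(** A nonzero value at a point of A would persist on a ball, and balls have
    positive measure. *)
Lemma continuous_ae_eq0 A (f : 'rV[R]_n -> R^o) : open A ->
  {in A, continuous f} -> {ae rV_lebesgue n, forall x, A x -> f x = 0} ->
  forall x, A x -> f x = 0.
Proof.
move=> oA cf [N [mN N0 sN]] x Ax; apply/eqP/negPn/negP => fx.
have : nbhs x (A `&` [set y | f y != 0]).
  apply: filterI; first exact: open_nbhs_nbhs.
  apply: (cf x (mem_set Ax) [set y | y != 0]); apply: open_nbhs_nbhs; split => //.
move=> /nbhs_ballP[e /= e0 eB].
have : (rV_lebesgue n (ball x e) <= rV_lebesgue n N)%E.
  apply: le_measure; rewrite ?inE//; first exact: measurable_ball_rV.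
  move=> y /eB[Ay /eqP fy]; apply: sN => /=; apply: contra_not fy; exact.
by rewrite N0 rV_lebesgue_ball// lee_fin leNgt exprn_gt0// mulr_gt0.
Qed.

End BorelRows.

(** * Partial derivatives of slices and tensors *)

Section RowContinuity.
Context {R : realType}.

Lemma continuous_rV (T : topologicalType) n (f : T -> 'rV[R]_n) :
  (forall i, continuous (fun t => f t 0 i)) -> continuous f.
Proof.
move=> cf t; apply/cvg_ballP => e e0.
have : \forall t' \near t, forall i, ball (f t 0 i) e (f t' 0 i).
  apply: filter_forall => i; have /cvg_ballP := cf i t; exact.
by apply: filterS => t' h; apply/ball_rVP.
Qed.

Lemma continuous_row_mxl n1 n2 (y : 'rV[R]_n2) :
  continuous (fun x : 'rV[R]_n1 => row_mx x y).
Proof.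
apply: continuous_rV => i; case: (split_ordP i) => j ->.
  under eq_fun do rewrite row_mxEl; exact: coord_continuous.
by under eq_fun do rewrite row_mxEr; exact: cst_continuous.
Qed.

Lemma continuous_row_mxr n1 n2 (x : 'rV[R]_n1) :
  continuous (fun y : 'rV[R]_n2 => row_mx x y).
Proof.
apply: continuous_rV => i; case: (split_ordP i) => j ->.
  by under eq_fun do rewrite row_mxEl; exact: cst_continuous.
by under eq_fun do rewrite row_mxEr; exact: coord_continuous.
Qed.

Lemma continuous_row_mx n1 n2 :
  continuous (fun z : 'rV[R]_n1 * 'rV[R]_n2 => row_mx z.1 z.2).
Proof.
apply: continuous_rV => i; case: (split_ordP i) => j ->.
  under eq_fun do rewrite row_mxEl.
  move=> z; apply: (@continuous_comp _ _ _ fst (fun x : 'rV[R]_n1 => x 0 j)).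
    exact: cvg_fst.
  exact: coord_continuous.
under eq_fun do rewrite row_mxEr.
move=> z; apply: (@continuous_comp _ _ _ snd (fun x : 'rV[R]_n2 => x 0 j)).
  exact: cvg_snd.
exact: coord_continuous.
Qed.

Lemma continuous_lsubmx n1 n2 : continuous (fun z : 'rV[R]_(n1 + n2) => lsubmx z).
Proof.
apply: continuous_rV => i; under eq_fun do rewrite mxE.
exact: coord_continuous.
Qed.

Lemma continuous_rsubmx n1 n2 : continuous (fun z : 'rV[R]_(n1 + n2) => rsubmx z).
Proof.
apply: continuous_rV => i; under eq_fun do rewrite mxE.
exact: coord_continuous.
Qed.

Lemma continuous_rV_cons n t : continuous (fun x : 'rV[R]_n => rV_cons (t, x)).
Proof.
apply: continuous_rV => i; case: (unliftP ord0 i) => [j ->|->].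
  by under eq_fun do rewrite rV_consS; exact: coord_continuous.
by under eq_fun do rewrite rV_cons0; exact: cst_continuous.
Qed.

End RowContinuity.

Section Calculus.
Context {R : realType}.

(** The inclusions of coordinate slices have this form. Difference quotients
    along basis vectors are preserved exactly, so that partial derivatives
    commute with such maps. *)
Record coordinate_embedding m n (iota : 'I_m -> 'I_n) (A : 'rV[R]_m -> 'rV[R]_n)
    : Prop := {
  embedding_continuous : continuous A;
  embedding_direction : forall i h x,
    A (h *: delta_mx 0 i + x) = h *: delta_mx 0 (iota i) + A x
}.

Lemma row_mxl_embedding n1 n2 (y : 'rV[R]_n2) :
  coordinate_embedding (@lshift n1 n2) (fun x => row_mx x y).
Proof.
split=> [|i h x]; first exact: continuous_row_mxl.
apply/rowP => j; case: (split_ordP j) => k ->.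
  by rewrite [RHS]mxE !row_mxEl !mxE !eqxx !(inj_eq (@lshift_inj _ _)).
by rewrite [RHS]mxE !row_mxEr !mxE eq_rlshift andbF mulr0 add0r.
Qed.

Lemma row_mxr_embedding n1 n2 (x : 'rV[R]_n1) :
  coordinate_embedding (@rshift n1 n2) (fun y => row_mx x y).
Proof.
split=> [|i h y]; first exact: continuous_row_mxr.
apply/rowP => j; case: (split_ordP j) => k ->.
  by rewrite [RHS]mxE !row_mxEl !mxE eq_lrshift andbF mulr0 add0r.
by rewrite [RHS]mxE !row_mxEr !mxE !eqxx !(inj_eq (@rshift_inj _ _)).
Qed.

Lemma rV_cons_embedding n t :
  coordinate_embedding (lift ord0) (fun x : 'rV[R]_n => rV_cons (t, x)).
Proof.
split=> [|i h x]; first exact: continuous_rV_cons.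
apply/rowP => j; case: (unliftP ord0 j) => [k ->|->].
  by rewrite [RHS]mxE !rV_consS !mxE !eqxx (inj_eq lift_inj).
by rewrite [RHS]mxE !rV_cons0 !mxE (negbTE (neq_lift _ _)) andbF mulr0 add0r.
Qed.

Section Embedding.
Context {m n : nat} (iota : 'I_m -> 'I_n) (A : 'rV[R]_m -> 'rV[R]_n).
Hypothesis embA : coordinate_embedding iota A.
Implicit Type f : 'rV[R]_n -> R^o.

Lemma difference_quotient_embedding f i x :
  (fun h : R => h^-1 *: (((fun x => f (A x) : R^o) \o shift x)
     (h *: delta_mx 0 i) - f (A x))) =
  (fun h => h^-1 *: ((f \o shift (A x)) (h *: delta_mx 0 (iota i)) - f (A x))).
Proof. by apply/funext => h /=; rewrite (embedding_direction embA). Qed.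

Lemma partial_embedding f i x :
  partial i (fun x => f (A x)) x = partial (iota i) f (A x).
Proof. by rewrite /partial /derive difference_quotient_embedding. Qed.

Lemma derivable_embedding f i x : derivable f (A x) (delta_mx 0 (iota i)) ->
  derivable (fun x => f (A x) : R^o) x (delta_mx 0 i).
Proof. by rewrite /derivable difference_quotient_embedding. Qed.

Lemma Ck_embedding k f : Ck k f -> Ck k (fun x => f (A x)).
Proof.
have cA g : continuous g -> continuous (fun x => g (A x) : R^o).
  move=> cg x; apply: continuous_comp; last exact: cg.
  exact: (embedding_continuous embA).
elim: k f => [|k ih] f [cf df]; split => //; [exact: cA|exact: cA|move=> i].
split; first by move=> x; apply: derivable_embedding; exact: (df _).1.
rewrite (_ : partial i _ = fun x => partial (iota i) f (A x)).
  by apply: ih; exact: (df _).2.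
by apply/funext => x; rewrite partial_embedding.
Qed.

End Embedding.

Lemma CkW n k (f : 'rV[R]_n -> R^o) : Ck k.+1 f -> Ck k f.
Proof.
elim: k f => [|k ih] f [cf df]; split => // i.
by split; [exact: (df i).1|apply: ih; exact: (df i).2].
Qed.

Lemma Ck_continuous n k (f : 'rV[R]_n -> R^o) : Ck k f -> continuous f.
Proof. by case: k => [|k] []. Qed.

Section Tensor.
Context {n1 n2 : nat}.
Implicit Types (f : 'rV[R]_n1 -> R^o) (g : 'rV[R]_n2 -> R^o).

Definition rV_tensor f g : 'rV[R]_(n1 + n2) -> R^o :=
  tensor (@lsubmx R 1 n1 n2) (@rsubmx R 1 n1 n2) f g.

Lemma lsubmx_delta_l i h (z : 'rV[R]_(n1 + n2)) :
  lsubmx (h *: delta_mx 0 (lshift n2 i) + z) = h *: delta_mx 0 i + lsubmx z.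
Proof. by apply/rowP => j; rewrite !mxE (inj_eq (@lshift_inj _ _)). Qed.

Lemma rsubmx_delta_l i h (z : 'rV[R]_(n1 + n2)) :
  rsubmx (h *: delta_mx 0 (lshift n2 i) + z) = rsubmx z.
Proof. by apply/rowP => j; rewrite !mxE eq_rlshift andbF mulr0 add0r. Qed.

Lemma lsubmx_delta_r i h (z : 'rV[R]_(n1 + n2)) :
  lsubmx (h *: delta_mx 0 (rshift n1 i) + z) = lsubmx z.
Proof. by apply/rowP => j; rewrite !mxE eq_lrshift andbF mulr0 add0r. Qed.

Lemma rsubmx_delta_r i h (z : 'rV[R]_(n1 + n2)) :
  rsubmx (h *: delta_mx 0 (rshift n1 i) + z) = h *: delta_mx 0 i + rsubmx z.
Proof. by apply/rowP => j; rewrite !mxE (inj_eq (@rshift_inj _ _)). Qed.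

Lemma is_derive_tensor_l f g i z : derivable f (lsubmx z) (delta_mx 0 i) ->
  is_derive z (delta_mx 0 (lshift n2 i)) (rV_tensor f g)
    (partial i f (lsubmx z) * g (rsubmx z)).
Proof.
move=> df.
have h : (fun h => h^-1 *: ((rV_tensor f g \o shift z)
      (h *: delta_mx 0 (lshift n2 i)) - rV_tensor f g z)) @ 0^' -->
    (partial i f (lsubmx z) * g (rsubmx z) : R^o).
  rewrite (_ : (fun h => _) = fun h : R => (h^-1 *: ((f \o shift (lsubmx z))
      (h *: delta_mx 0 i) - f (lsubmx z))) * g (rsubmx z)).
    by apply: cvgM; [exact: df|exact: cvg_cst].
  apply/funext => h /=; rewrite /rV_tensor /tensor lsubmx_delta_l rsubmx_delta_l.
  by rewrite -mulrBl /GRing.scale/= mulrA.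
by apply: DeriveDef; [apply/cvg_ex; eexists; exact: h|exact: cvg_lim].
Qed.

Lemma is_derive_tensor_r f g i z : derivable g (rsubmx z) (delta_mx 0 i) ->
  is_derive z (delta_mx 0 (rshift n1 i)) (rV_tensor f g)
    (f (lsubmx z) * partial i g (rsubmx z)).
Proof.
move=> dg.
have h : (fun h => h^-1 *: ((rV_tensor f g \o shift z)
      (h *: delta_mx 0 (rshift n1 i)) - rV_tensor f g z)) @ 0^' -->
    (f (lsubmx z) * partial i g (rsubmx z) : R^o).
  rewrite (_ : (fun h => _) = fun h : R => f (lsubmx z) *
      (h^-1 *: ((g \o shift (rsubmx z)) (h *: delta_mx 0 i) - g (rsubmx z)))).
    by apply: cvgM; [exact: cvg_cst|exact: dg].
  apply/funext => h /=; rewrite /rV_tensor /tensor lsubmx_delta_r rsubmx_delta_r.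
  by rewrite -mulrBr /GRing.scale/= mulrCA.
by apply: DeriveDef; [apply/cvg_ex; eexists; exact: h|exact: cvg_lim].
Qed.

Lemma continuous_tensor_at f g z : {for lsubmx z, continuous f} ->
  {for rsubmx z, continuous g} -> {for z, continuous (rV_tensor f g)}.
Proof.
move=> cf cg.
have h1 : {for z, continuous (fun z => f (lsubmx z))}.
  by apply: continuous_comp; [exact: continuous_lsubmx|exact: cf].
have h2 : {for z, continuous (fun z => g (rsubmx z))}.
  by apply: continuous_comp; [exact: continuous_rsubmx|exact: cg].
exact: cvgM h1 h2.
Qed.

Lemma Ck_tensor k f g : Ck k f -> Ck k g -> Ck k (rV_tensor f g).
Proof.
elim: k f g => [|k ih] f g Cf Cg.
  split=> // z; apply: continuous_tensor_at; [exact: (Cf.1)|exact: (Cg.1)].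
split=> [z|].
  apply: continuous_tensor_at; [exact: (Cf.1)|exact: (Cg.1)].
move=> i; case: (split_ordP i) => j ->.
  have [df Cdf] := Cf.2 j.
  split=> [z|]; first by have [] := @is_derive_tensor_l f g j z (df _).
  rewrite (_ : partial _ _ = rV_tensor (partial j f) g).
    by apply: ih => //; exact: CkW.
  by apply/funext => z; have [_ ] := @is_derive_tensor_l f g j z (df _).
have [dg Cdg] := Cg.2 j.
split=> [z|]; first by have [] := @is_derive_tensor_r f g j z (dg _).
rewrite (_ : partial _ _ = rV_tensor f (partial j g)).
  by apply: ih => //; exact: CkW.
by apply/funext => z; have [_ ] := @is_derive_tensor_r f g j z (dg _).
Qed.

Lemma partial_tensor_l f g i : Ck 1 f ->
  partial (lshift n2 i) (rV_tensor f g) = rV_tensor (partial i f) g.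
Proof.
move=> [_ /(_ i)[df _]].
by apply/funext => z; have [_ ] := @is_derive_tensor_l f g i z (df _).
Qed.

Lemma partial_tensor_r f g i : Ck 1 g ->
  partial (rshift n1 i) (rV_tensor f g) = rV_tensor f (partial i g).
Proof.
move=> [_ /(_ i)[dg _]].
by apply/funext => z; have [_ ] := @is_derive_tensor_r f g i z (dg _).
Qed.

Lemma laplacian_slice_l (h : 'rV[R]_(n1 + n2) -> R^o) x y :
  laplacian (fun x => h (row_mx x y)) x =
  \sum_i partial (lshift n2 i) (partial (lshift n2 i) h) (row_mx x y).
Proof.
apply: eq_bigr => i _; rewrite -(partial_embedding (row_mxl_embedding n1 y)).
congr (partial i _ x); apply/funext => x'.
by rewrite (partial_embedding (row_mxl_embedding n1 y)).
Qed.

Lemma laplacian_slice_r (h : 'rV[R]_(n1 + n2) -> R^o) x y :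
  laplacian (fun y => h (row_mx x y)) y =
  \sum_i partial (rshift n1 i) (partial (rshift n1 i) h) (row_mx x y).
Proof.
apply: eq_bigr => i _; rewrite -(partial_embedding (row_mxr_embedding n2 x)).
congr (partial i _ y); apply/funext => y'.
by rewrite (partial_embedding (row_mxr_embedding n2 x)).
Qed.

End Tensor.
End Calculus.

(** * Test functions *)

Section RowProductCoordinates.
Context {R : realType}.

Definition rV_sfm n : {sigma_finite_measure set 'rV[R]_n -> \bar R} := rV_leb n.

Lemma rV_sfmE n : (rV_sfm n : {measure set 'rV[R]_n -> \bar R}) = rV_lebesgue n.
Proof. exact: eq_measure. Qed.

Lemma row_mx_coordinates n1 n2 : product_coordinates (rV_lebesgue (n1 + n2))
  (rV_sfm n1) (rV_sfm n2) (fun z => row_mx z.1 z.2)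
  (@lsubmx R 1 n1 n2) (@rsubmx R 1 n1 n2).
Proof.
split.
- exact: measurable_row_mx.
- exact: measurable_lsubmx.
- exact: measurable_rsubmx.
- by move=> x y; rewrite row_mxKl.
- by move=> x y; rewrite row_mxKr.
- by move=> A mA; exact: rV_leb_row_mx.
Qed.

End RowProductCoordinates.

Section Restriction.
Context {R : realType} {n : nat}.
Implicit Types (u v : 'rV[R]_n -> R^o) (A : set 'rV[R]_n).
Local Notation mu := (rV_lebesgue n).

Lemma restrict_in u A x : A x -> (u \_ A) x = u x.
Proof. by move=> Ax; rewrite patchE mem_set. Qed.

Lemma restrict_out u A x : ~ A x -> (u \_ A) x = 0.
Proof. by move=> Ax; rewrite patchE memNset. Qed.

Lemma restrict_supported u A : (forall x, ~ A x -> u x = 0) -> u \_ A = u.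
Proof.
move=> u0; apply/funext => x; have [Ax|Ax] := pselect (A x).
  by rewrite restrict_in.
by rewrite restrict_out// u0.
Qed.

Lemma L2innerE A u v : L2inner A u v = inner mu (u \_ A) (v \_ A).
Proof.
rewrite /L2inner Rintegral_mkcond; apply: eq_Rintegral => x _.
by rewrite !patchE; case: ifP => //= _; rewrite mul0r.
Qed.

Lemma restrictB u v A :
  (u \- v) \_ A = fun x => (u \_ A) x - (v \_ A) x.
Proof.
by apply/funext => x; rewrite !patchE; case: ifP => //= _; rewrite subr0.
Qed.

Lemma restrictZ a u A : (fun x => a * u x : R^o) \_ A = fun x => a * (u \_ A) x.
Proof.
by apply/funext => x; rewrite !patchE; case: ifP => //= _; rewrite mulr0.
Qed.

Lemma restrict_sum I (s : seq I) (F : I -> 'rV[R]_n -> R^o) A :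
  (fun x => \sum_(i <- s) F i x : R^o) \_ A = fun x => \sum_(i <- s) (F i \_ A) x.
Proof.
apply/funext => x; rewrite !patchE; case: ifP => xA.
  by apply: eq_bigr => i _; rewrite patchE xA.
by rewrite big1// => i _; rewrite patchE xA.
Qed.

End Restriction.

Lemma closure_subset_closed (T : topologicalType) (A B : set T) :
  closed B -> A `<=` B -> closure A `<=` B.
Proof. by move=> /closure_id cB AB; rewrite cB; exact: closure_subset. Qed.

Section TestFunctions.
Context {R : realType}.

Section Properties.
Context {n : nat}.
Variable Omega : set 'rV[R]_n.
Implicit Types psi : 'rV[R]_n -> R^o.
Local Notation mu := (rV_lebesgue n).

Lemma test_function_support psi x : test_function Omega psi -> ~ Omega x -> psi x = 0.
Proof.
move=> [_ _ sO] Ox; apply/eqP/negPn/negP => psix.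
by apply: Ox; apply: sO; exact: subset_closure.
Qed.

Lemma test_function_restrict psi : test_function Omega psi -> psi \_ Omega = psi.
Proof. by move=> tp; apply: restrict_supported => x; exact: test_function_support. Qed.

Lemma test_function_Lfun2 psi : test_function Omega psi ->
  (psi : 'rV[R]_n -> R) \in Lfun mu 2%:E.
Proof.
move=> [Cpsi cK _]; have cpsi := Ck_continuous (Cpsi 0%N).
set K := closure _ in cK.
have [M psiM] : exists M, forall x, `|psi x| <= M.
  have : compact (psi @` K).
    by apply: continuous_compact cK; exact: continuous_subspaceT.
  move=> /compact_bounded[M [_ bM]]; exists (Num.max (M + 1) 0) => x.
  have [->|psix] := eqVneq (psi x) 0; first by rewrite normr0 le_max lexx orbT.
  rewrite le_max; apply/orP; left; apply: (bM (M + 1)); first by rewrite ltrDl.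
  by exists x => //; exact: subset_closure.
apply: (@Lfun2_bounded_support _ _ _ K M) => //.
- exact: continuous_measurable_rV.
- rewrite -(setCK K); apply: measurableC; apply: open_measurable_rV.
  by rewrite openC; exact: closed_closure.
- exact: compact_bounded.
- move=> x Kx; apply/eqP/negPn/negP => psix; apply: Kx; exact: subset_closure.
Qed.

Lemma test_function_L2 psi : test_function Omega psi -> L2 Omega psi.
Proof.
by move=> tp; rewrite /L2 test_function_restrict//; exact: test_function_Lfun2.
Qed.

Lemma partial_support psi i x : ~ closure [set x | psi x != 0] x ->
  partial i psi x = 0.
Proof.
move=> cx; rewrite /partial (near_eq_derive (g := cst 0)) ?derive_cst//.
have : nbhs x (~` closure [set x | psi x != 0]).
  by apply: open_nbhs_nbhs; split => //; rewrite openC; exact: closed_closure.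
apply: filterS => y cy; apply/eqP/negPn/negP => psiy; apply: cy.
exact: subset_closure.
Qed.

Lemma test_function_partial psi i : test_function Omega psi ->
  test_function Omega (partial i psi).
Proof.
move=> [Cpsi cK sO].
have sK : closure [set x | partial i psi x != 0] `<=` closure [set x | psi x != 0].
  apply: closure_subset_closed => [|x /= px]; first exact: closed_closure.
  apply: contrapT => cx; move: px.
  by rewrite partial_support// eqxx.
split; first by move=> k; have [_ /(_ i)[]] := Cpsi k.+1.
- by apply: subclosed_compact cK sK; exact: closed_closure.
- exact: subset_trans sO.
Qed.

End Properties.

Section Product.
Context {n1 n2 : nat}.
Variables (Omega1 : set 'rV[R]_n1) (Omega2 : set 'rV[R]_n2).

(** The support of the slice is a closed subset of the image under B of the
    support of theta, hence compact. *)
Lemma test_function_slice n m (Omega : set 'rV[R]_n) (D : set 'rV[R]_m)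
    (iota : 'I_m -> 'I_n) (A : 'rV[R]_m -> 'rV[R]_n) (B : 'rV[R]_n -> 'rV[R]_m)
    (theta : 'rV[R]_n -> R^o) :
  coordinate_embedding iota A -> continuous B -> cancel A B ->
  (forall x, Omega (A x) -> D x) ->
  test_function Omega theta -> test_function D (fun x => theta (A x)).
Proof.
move=> embA cB AK OD [Ct cK sO].
have sK : closure [set x | theta (A x) != 0] `<=`
    A @^-1` closure [set x | theta x != 0].
  apply: closure_subset_closed => [|x /= px]; last exact: subset_closure.
  apply: closed_comp; last exact: closed_closure.
  by move=> x _; exact: (embedding_continuous embA).
split.
- by move=> k; exact: Ck_embedding embA _ _ _.
- apply: (@subclosed_compact _ _ (B @` closure [set x | theta x != 0])).
  + exact: closed_closure.
  + by apply: continuous_compact cK; exact: continuous_subspaceT.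
  + by move=> x /sK /= h; exists (A x).
- by move=> x /sK /= /sO; exact: OD.
Qed.

Lemma test_function_slice_l theta y : Omega2 y ->
  test_function (rV_setX Omega1 Omega2) theta ->
  test_function Omega1 (fun x => theta (row_mx x y)).
Proof.
move=> O2y; apply: (test_function_slice (row_mxl_embedding n1 y)
  (@continuous_lsubmx R n1 n2)); first by move=> x; exact: row_mxKl.
by move=> x []; rewrite row_mxKl.
Qed.

Lemma test_function_slice_r theta x : Omega1 x ->
  test_function (rV_setX Omega1 Omega2) theta ->
  test_function Omega2 (fun y => theta (row_mx x y)).
Proof.
move=> O1x; apply: (test_function_slice (row_mxr_embedding n2 x)
  (@continuous_rsubmx R n1 n2)); first by move=> y; exact: row_mxKr.
by move=> y []; rewrite row_mxKr.
Qed.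

Lemma test_function_tensor f g : test_function Omega1 f -> test_function Omega2 g ->
  test_function (rV_setX Omega1 Omega2) (rV_tensor f g).
Proof.
move=> [Cf cKf sf] [Cg cKg sg].
set Kf := closure _ in cKf sf; set Kg := closure _ in cKg sg.
have cKX : closed (rV_setX Kf Kg).
  apply: closedI.
    apply: (closed_comp (f := @lsubmx R 1 n1 n2)); last exact: closed_closure.
    by move=> x _; exact: continuous_lsubmx.
  apply: (closed_comp (f := @rsubmx R 1 n1 n2)); last exact: closed_closure.
  by move=> x _; exact: continuous_rsubmx.
have sK : closure [set z | rV_tensor f g z != 0] `<=` rV_setX Kf Kg.
  apply: closure_subset_closed => // z /=.
  rewrite /rV_tensor /tensor mulf_eq0 negb_or => /andP[fz gz].
  by split; exact: subset_closure.
split.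
- by move=> k; exact: Ck_tensor.
- apply: (@subclosed_compact _ _
    ((fun z : 'rV[R]_n1 * 'rV[R]_n2 => row_mx z.1 z.2) @` (Kf `*` Kg))).
  + exact: closed_closure.
  + apply: continuous_compact; last exact: compact_setX.
    by apply: continuous_subspaceT; exact: continuous_row_mx.
  + by move=> z /sK[? ?]; exists (lsubmx z, rsubmx z) => //; rewrite hsubmxK.
- by move=> z /sK[? ?]; split; [exact: sf|exact: sg].
Qed.

Lemma restrict_tensor f g :
  rV_tensor f g \_ (rV_setX Omega1 Omega2) = rV_tensor (f \_ Omega1) (g \_ Omega2).
Proof.
apply/funext => z; rewrite /rV_tensor /tensor.
have [ [oz1 oz2]|Oz] := pselect (rV_setX Omega1 Omega2 z).
  by rewrite !restrict_in.
rewrite restrict_out//; apply/esym/eqP; rewrite mulf_eq0; apply/orP.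
have [oz1|oz1] := pselect (Omega1 (lsubmx z)); [right|left].
  by rewrite restrict_out// => oz2; exact: Oz.
by rewrite restrict_out.
Qed.

End Product.
End TestFunctions.

(** * Weak gradients and Green's formula *)

Section DirichletForm.
Context {R : realType} {n : nat}.
Variable Omega : set 'rV[R]_n.
Implicit Types (u v : 'rV[R]_n -> R^o) (g h : 'I_n -> 'rV[R]_n -> R^o).
Local Notation mu := (rV_lebesgue n).

(** Membership in H^1_0 with its weak gradient g made explicit and the limits
    stated for squared norms. *)
Definition H10_gradient u g : Prop :=
  [/\ L2 Omega u, forall i, L2 Omega (g i),
    forall i, weak_partial Omega i u (g i) &
    exists psi : nat -> 'rV[R]_n -> R^o,
    [/\ forall j, test_function Omega (psi j),
      inner mu (fun x => psi j x - (u \_ Omega) x)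
        (fun x => psi j x - (u \_ Omega) x) @[j --> \oo] --> 0 &
      forall i, inner mu (fun x => partial i (psi j) x - (g i \_ Omega) x)
        (fun x => partial i (psi j) x - (g i \_ Omega) x) @[j --> \oo] --> 0]].

Lemma L2norm_cvg0P (psi : nat -> 'rV[R]_n -> R^o) u :
  (forall j, test_function Omega (psi j)) -> L2 Omega u ->
  (L2norm Omega (psi j \- u) @[j --> \oo] --> 0%E) <->
  (inner mu (fun x => psi j x - (u \_ Omega) x)
        (fun x => psi j x - (u \_ Omega) x) @[j --> \oo] --> 0).
Proof.
move=> tp uL; rewrite -Lnorm2_cvg0P; last first.
  by move=> j; apply: Lfun2B => //; exact: test_function_Lfun2 (tp j).
rewrite /L2norm; under eq_fun do rewrite restrictB (test_function_restrict (tp _)).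
by [].
Qed.

Lemma H10P u : H10 Omega u <-> exists g, H10_gradient u g.
Proof.
split=> [[uL [g [psi [gL tp pu pg]]]]|[g [uL gL wg [psi [tp pu pg]]]]].
  exists g; split => // [i|i|]; [exact: (gL i).1|exact: (gL i).2|].
  exists psi; split => //; first exact/L2norm_cvg0P.
  move=> i; apply/(L2norm_cvg0P (psi := fun j => partial i (psi j))) => //.
    by move=> j; exact: test_function_partial.
  exact: (gL i).1.
split=> //; exists g, psi; split => //; first exact/L2norm_cvg0P.
move=> i; apply/(L2norm_cvg0P (psi := fun j => partial i (psi j))) => //.
by move=> j; exact: test_function_partial.
Qed.

Lemma weak_laplacian u g psi : H10_gradient u g -> test_function Omega psi ->
  L2inner Omega u (fun x => - laplacian psi x) =
  \sum_i L2inner Omega (g i) (partial i psi).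
Proof.
move=> [uL gL wg _] tp.
have tpi i := test_function_partial i tp.
have tpii i := test_function_partial i (tpi i).
rewrite L2innerE [X in inner _ _ X]restrict_supported; last first.
  move=> x Ox; rewrite /laplacian big1 ?oppr0// => i _.
  exact: test_function_support (tpii i) Ox.
rewrite (_ : (fun x => - _) = fun x => \sum_i - 1 * partial i (partial i psi) x).
  rewrite inner_sumr//; last first.
    by move=> i _; apply: Lfun2Z; exact: test_function_Lfun2 (tpii i).
  apply: eq_bigr => i _; rewrite innerZr//; last first.
    exact: test_function_Lfun2 (tpii i).
  rewrite -[partial i (partial i psi)](test_function_restrict (tpii i)).
  by rewrite -L2innerE wg// mulN1r opprK.
by apply/funext => x; rewrite -mulr_sumr mulN1r.
Qed.

(** The eigenvalue equation of u is tested against test functions converging to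
    v in H^1, and both sides pass to the limit. *)
Lemma eigenfunction_green lambda u g v h :
  (forall psi, test_function Omega psi ->
    L2inner Omega u (fun x => - laplacian psi x) = lambda * L2inner Omega u psi) ->
  H10_gradient u g -> H10_gradient v h ->
  lambda * L2inner Omega u v = \sum_i L2inner Omega (g i) (h i).
Proof.
move=> eigu Hu [vL hL _ [psi [tp pv ph]]].
have [uL gL _ _] := Hu.
have lhs : lambda * L2inner Omega u (psi j) @[j --> \oo] -->
    lambda * L2inner Omega u v.
  apply: cvgMr; rewrite [X in _ --> X]L2innerE innerC.
  have := inner_cvg (fun j => test_function_Lfun2 (tp j)) vL uL pv.
  move=> /eq_cvg_to; apply => j.
  by rewrite L2innerE (test_function_restrict (tp j)) innerC.
have rhs : lambda * L2inner Omega u (psi j) @[j --> \oo] -->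
    \sum_i L2inner Omega (g i) (h i).
  have c i : L2inner Omega (g i) (partial i (psi j)) @[j --> \oo] -->
      L2inner Omega (g i) (h i).
    have tpi j := test_function_partial i (tp j).
    rewrite [X in _ --> X]L2innerE innerC.
    have := inner_cvg (fun j => test_function_Lfun2 (tpi j)) (hL i) (gL i) (ph i).
    move=> /eq_cvg_to; apply => j.
    by rewrite L2innerE (test_function_restrict (tpi j)) innerC.
  have cs : \sum_i L2inner Omega (g i) (partial i (psi j)) @[j --> \oo] -->
      \sum_i L2inner Omega (g i) (h i) by exact: cvg_sumr.
  apply: (eq_cvg_to cs) => j.
  by rewrite -eigu// (weak_laplacian Hu).
exact: (cvg_unique _ lhs rhs).
Qed.

Lemma eigenvalue_gradient lambda u g :
  (forall psi, test_function Omega psi ->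
    L2inner Omega u (fun x => - laplacian psi x) = lambda * L2inner Omega u psi) ->
  H10_gradient u g -> L2inner Omega u u = 1 ->
  lambda = \sum_i L2inner Omega (g i) (g i).
Proof. by move=> eu Hu u1; rewrite -(eigenfunction_green eu Hu Hu) u1 mulr1. Qed.

Lemma eigenvalue_ge0 lambda u : dirichlet_eigenfunction Omega lambda u ->
  L2inner Omega u u = 1 -> 0 <= lambda.
Proof.
move=> [/H10P[g Hg] _ eu] u1; rewrite (eigenvalue_gradient eu Hg u1).
by apply: sumr_ge0 => i _; rewrite L2innerE inner_ge0.
Qed.

(** The Dirichlet form of u and v equals both lambda1 and lambda2 times their
    inner product. *)
Lemma eigenfunction_orthogonal lambda1 lambda2 u v :
  dirichlet_eigenfunction Omega lambda1 u ->
  dirichlet_eigenfunction Omega lambda2 v ->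
  lambda1 != lambda2 -> L2inner Omega u v = 0.
Proof.
move=> [/H10P[g Hg] _ eu] [/H10P[h Hh] _ ev] l12.
have := eigenfunction_green ev Hh Hg.
have -> : L2inner Omega v u = L2inner Omega u v by rewrite !L2innerE innerC.
under eq_bigr do rewrite L2innerE innerC -L2innerE.
rewrite -(eigenfunction_green eu Hg Hh) => /eqP.
rewrite -subr_eq0 -mulrBl mulf_eq0 subr_eq0 eq_sym (negbTE l12)/=.
by move/eqP.
Qed.

End DirichletForm.

(** * Cells of a grid on the line *)

Section SumsOfSquares.
Context d (T : measurableType d) (R : realType).
Variable mu : {measure set T -> \bar R}.

Lemma integral_sum_sqr (J : finType) (u : J -> T -> R) :
  (forall q, u q \in Lfun mu 2%:E) ->
  (\int[mu]_x (\sum_q u q x ^+ 2)%:E = (\sum_q inner mu (u q) (u q))%:E)%E.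
Proof.
move=> uL; under eq_integral do rewrite -sumEFin.
rewrite (@ge0_integral_sum _ _ _ _ _ _ _ (fun q x => (u q x ^+ 2)%:E))//.
- by rewrite -sumEFin; apply: eq_bigr => q _; rewrite integral_sqrE.
- by move=> q; apply/measurable_EFinP/measurable_funX; exact: Lfun2_measurable (uL q).
- by move=> q x _; rewrite lee_fin sqr_ge0.
Qed.

Lemma measurable_sum_sqr (J : finType) (u : J -> T -> R) :
  (forall q, u q \in Lfun mu 2%:E) ->
  measurable_fun setT (fun x => (\sum_q u q x ^+ 2)%:E).
Proof.
move=> uL; apply/measurable_EFinP; apply: measurable_sum => q.
by apply: measurable_funX; exact: Lfun2_measurable (uL q).
Qed.

Lemma sum_inner_le (J K : finType) (u : J -> T -> R) (v : K -> T -> R) :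
  (forall q, u q \in Lfun mu 2%:E) -> (forall p, v p \in Lfun mu 2%:E) ->
  (forall x, \sum_q u q x ^+ 2 <= \sum_p v p x ^+ 2) ->
  \sum_q inner mu (u q) (u q) <= \sum_p inner mu (v p) (v p).
Proof.
move=> uL vL uv; rewrite -lee_fin -!integral_sum_sqr//.
apply: ge0_le_integral => //; try exact: measurable_sum_sqr.
- by move=> x _; rewrite lee_fin sumr_ge0// => q _; rewrite sqr_ge0.
- by move=> x _; rewrite lee_fin.
Qed.

Lemma Lfun2_mul_le1 (f c : T -> R) : f \in Lfun mu 2%:E -> measurable_fun setT c ->
  (forall x, c x ^+ 2 <= 1) -> (fun x => f x * c x) \in Lfun mu 2%:E.
Proof.
move=> fL mc c1; have mf := Lfun2_measurable fL.
apply/Lfun2P; split; first exact: measurable_funM.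
apply: le_integrable (Lfun2_integrable_sqr fL) => //.
  by apply/measurable_EFinP/measurable_funX; exact: measurable_funM.
move=> x _ /=; rewrite lee_fin !ger0_norm ?sqr_ge0// exprMn.
by rewrite ler_piMr ?sqr_ge0.
Qed.

End SumsOfSquares.

Section SliceSums.
Context d d1 d2 (T : measurableType d) (T1 : measurableType d1)
  (T2 : measurableType d2) (R : realType).
Variables (mu : {measure set T -> \bar R})
  (m1 : {sigma_finite_measure set T1 -> \bar R})
  (m2 : {sigma_finite_measure set T2 -> \bar R}).
Variables (pr : T1 * T2 -> T) (p1 : T -> T1) (p2 : T -> T2).
Hypothesis PC : product_coordinates mu m1 m2 pr p1 p2.

(** Bessel's inequality on almost every slice, integrated over the second
    variable. *)
Lemma bessel_slices (J : finType) (e : J -> T1 -> R) f :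
  (forall q, e q \in Lfun m1 2%:E) ->
  (forall g, g \in Lfun m1 2%:E -> \sum_q inner m1 g (e q) ^+ 2 <= inner m1 g g) ->
  f \in Lfun mu 2%:E ->
  \sum_q inner m2 (partial_inner m1 pr f (e q)) (partial_inner m1 pr f (e q)) <=
  inner mu f f.
Proof.
move=> eL be fL; have UL q := Lfun2_partial_inner PC fL (eL q).
rewrite -lee_fin -integral_sum_sqr// -(integral_sqr_slice PC)//.
apply: ae_ge0_le_integral => //.
- by move=> y _; rewrite lee_fin sumr_ge0// => q _; rewrite sqr_ge0.
- exact: measurable_sum_sqr.
- by move=> y _; apply: integral_ge0 => x _; rewrite lee_fin sqr_ge0.
- exact: (measurable_sqr_slice PC).
have := ae_slice_Lfun2 PC fL; apply: filterS => y yL _.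
by rewrite integral_sqrE// lee_fin; exact: be.
Qed.

End SliceSums.

Section Intervals.
Context {R : realType}.
Local Notation leb := (@lebesgue_measure R).
Variables (a h : R) (h0 : 0 < h).

Definition cell_itv (p : nat) : set R := `[a + p%:R * h, a + p.+1%:R * h[%classic.

Definition cell_indic (p : nat) : R -> R := \1_(cell_itv p).

Definition cell1 (p : nat) (t : R) : R := (Num.sqrt h)^-1 * cell_indic p t.

Lemma cell_itvP p t :
  cell_itv p t <-> a + p%:R * h <= t < a + p.+1%:R * h.
Proof. by rewrite /cell_itv/= in_itv/=. Qed.

Lemma cell_indicT p t : cell_itv p t -> cell_indic p t = 1.
Proof. by move=> pt; rewrite /cell_indic indicE mem_set. Qed.

Lemma cell_indicF p t : ~ cell_itv p t -> cell_indic p t = 0.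
Proof. by move=> pt; rewrite /cell_indic indicE memNset. Qed.

Lemma cell_indic_sqr p t : cell_indic p t ^+ 2 = cell_indic p t.
Proof.
have [pt|pt] := pselect (cell_itv p t).
  by rewrite cell_indicT// expr1n.
by rewrite cell_indicF// expr0n.
Qed.

Lemma cell_indic_le1 p t : cell_indic p t <= 1.
Proof. by rewrite /cell_indic indicE lern1; case: (_ \in _). Qed.

Lemma cell_itv_disjoint p q t : cell_itv p t -> cell_itv q t -> p = q.
Proof.
move=> /cell_itvP/andP[pt tp] /cell_itvP/andP[qt tq].
have pq : p%:R < q.+1%:R :> R by rewrite -(ltr_pM2r h0); lra.
have qp : q%:R < p.+1%:R :> R by rewrite -(ltr_pM2r h0); lra.
by apply/eqP; rewrite eqn_leq; move: pq qp; rewrite !ltr_nat !ltnS => -> ->.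
Qed.

Lemma sum_cell_indic_le1 M t : \sum_(p < M) cell_indic p t <= 1.
Proof.
have [[p pt]|np] := pselect (exists p : 'I_M, cell_itv p t).
  rewrite (bigD1 p)//= big1 ?addr0 ?cell_indic_le1// => q qp.
  apply: cell_indicF => qt; move: qp.
  by rewrite -val_eqE/= (cell_itv_disjoint qt pt) eqxx.
by rewrite big1// => p _; apply: cell_indicF => pt; apply: np; exists p.
Qed.

Lemma sum_cell_indic_ge1 M t : a <= t < a + M%:R * h ->
  1 <= \sum_(p < M) cell_indic p t.
Proof.
move=> /andP[ta tM].
pose p := Num.truncn ((t - a) / h).
have th : 0 <= (t - a) / h by rewrite divr_ge0 ?subr_ge0 ?(ltW h0).
have /andP[p1 p2] := truncn_itv th; rewrite -/p in p1 p2.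
rewrite ler_pdivlMr// in p1; rewrite ltr_pdivrMr// in p2.
have pM : (p < M)%N.
  by rewrite -(ltr_nat R) -(ltr_pM2r h0); lra.
have pt : cell_itv p t by apply/cell_itvP/andP; split; lra.
rewrite (bigD1 (Ordinal pM))//= (cell_indicT pt) lerDl.
by apply: sumr_ge0 => q _; rewrite /cell_indic indicE ler0n.
Qed.

Lemma measurable_cell_indic p : measurable_fun setT (cell_indic p).
Proof. by apply: measurable_indic; exact: measurable_itv. Qed.

Lemma lebesgue_cell_itv p : leb (cell_itv p) = h%:E.
Proof.
rewrite lebesgue_measure_itv/= lte_fin ltrD2l ltr_pM2r// ltr_nat ltnSn.
by rewrite -EFinB; congr _%:E; rewrite -natr1; ring.
Qed.

Lemma integral_cell_indic p : (\int[leb]_t (cell_indic p t)%:E = h%:E)%E.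
Proof.
rewrite integral_indic//; last exact: measurable_itv.
by rewrite setIT; exact: lebesgue_cell_itv.
Qed.

Lemma Lfun2_cut F p : F \in Lfun leb 2%:E ->
  (fun t => F t * cell_indic p t) \in Lfun leb 2%:E.
Proof.
move=> FL; apply: Lfun2_mul_le1 => //; first exact: measurable_cell_indic.
by move=> t; rewrite cell_indic_sqr cell_indic_le1.
Qed.

Lemma Lfun2_cell_indic p : cell_indic p \in Lfun leb 2%:E.
Proof.
apply/Lfun2P; split; first exact: measurable_cell_indic.
apply/integrableP; split.
  by apply/measurable_EFinP/measurable_funX; exact: measurable_cell_indic.
under eq_integral do rewrite /= cell_indic_sqr ger0_norm ?ler0n//.
by rewrite integral_cell_indic ltry.
Qed.

Lemma inner_cell_indic p q :
  inner leb (cell_indic p) (cell_indic q) = h * (p == q)%:R.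
Proof.
have [<-|pq] := eqVneq p q.
  apply/EFin_inj; rewrite -integral_sqrE//; last exact: Lfun2_cell_indic.
  by under eq_integral do rewrite cell_indic_sqr; rewrite integral_cell_indic mulr1.
rewrite mulr0 -[RHS](inner_0l leb (fun=> 0)); apply: eq_Rintegral => t _.
rewrite mulr0.
have [pt|pt] := pselect (cell_itv p t); last by rewrite cell_indicF// mul0r.
have [qt|qt] := pselect (cell_itv q t); last by rewrite (cell_indicF qt) mulr0.
by move: pq; rewrite (cell_itv_disjoint pt qt) eqxx.
Qed.

Lemma Lfun2_cell1 p : cell1 p \in Lfun leb 2%:E.
Proof. exact: Lfun2Z (Lfun2_cell_indic p). Qed.

Lemma cell1_orthonormal p q : inner leb (cell1 p) (cell1 q) = (p == q)%:R.
Proof.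
have [pL qL] := (Lfun2_cell_indic p, Lfun2_cell_indic q).
rewrite /cell1 innerZl// ?innerZr// ?inner_cell_indic; last exact: Lfun2Z.
by rewrite -{3}(sqr_sqrtr (ltW h0)); field; rewrite gt_eqF// sqrtr_gt0.
Qed.

(** Among the constants, the mean value over a cell approximates F best there. *)
Lemma cut_mean F p c : F \in Lfun leb 2%:E ->
  inner leb (fun t => F t * cell_indic p t) (fun t => F t * cell_indic p t) <=
  inner leb F (cell1 p) ^+ 2 +
  inner leb (fun t => (F t - c) * cell_indic p t)
    (fun t => (F t - c) * cell_indic p t).
Proof.
move=> FL; have pL := Lfun2_cell_indic p; have FpL := Lfun2_cut p FL.
rewrite (_ : (fun t => (F t - c) * _) =
    fun t => F t * cell_indic p t - c * cell_indic p t); last first.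
  by apply/funext => t; rewrite mulrBl.
have cpL := Lfun2Z c pL.
rewrite (inner_sqrB FpL cpL) (innerZr c pL FpL) (innerZl c pL cpL).
rewrite (innerZr c pL pL) inner_cell_indic eqxx mulr1.
have -> : inner leb (fun t => F t * cell_indic p t) (cell_indic p) =
    Num.sqrt h * inner leb F (cell1 p).
  rewrite /cell1 innerZr// mulrA divff ?mul1r ?gt_eqF ?sqrtr_gt0//.
  apply: eq_Rintegral => t _; by rewrite -mulrA -expr2 cell_indic_sqr.
have sh := sqr_sqrtr (ltW h0).
have := sqr_ge0 (inner leb F (cell1 p) - c * Num.sqrt h).
have : c * (c * h) = (c * Num.sqrt h) ^+ 2 by rewrite exprMn sh; ring.
lra.
Qed.

End Intervals.

(** * One-dimensional increments *)

Section FundamentalTheorem.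
Context {R : realType}.
Local Notation leb := (@lebesgue_measure R).

(** The fundamental theorem of calculus and Cauchy-Schwarz on [a, t]. *)
Lemma sqr_increment_le (G g : R -> R^o) (a t : R) : a <= t ->
  (forall x : R, is_derive x 1 (G : R^o -> R^o) (g x)) -> continuous g ->
  (((G t - G a) ^+ 2)%:E <=
    (t - a)%:E * \int[leb]_x ((g x * \1_(`[a, t]%classic) x) ^+ 2)%:E)%E.
Proof.
rewrite le_eqVlt => /predU1P[->|at_] dG cg.
  by rewrite !subrr expr0n mul0e.
pose chi : R -> R := \1_(`[a, t]%classic).
have chi2 x : chi x * chi x = chi x.
  by rewrite /chi indicE; case: (_ \in _); rewrite ?mulr1 ?mulr0.
have mchi : measurable_fun setT chi by apply: measurable_indic; exact: measurable_itv.
have mg : measurable_fun setT (g : R -> R) by exact: continuous_measurable_fun.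
have cG x : {for x, continuous (G : R -> R)}.
  apply: differentiable_continuous; apply/derivable1_diffP.
  by have [] := dG x.
have restr (u : R -> R) x : ((u \_ `[a, t]) x) = u x * chi x.
  by rewrite patchE /chi indicE; case: ifP; rewrite ?mulr1 ?mulr0.
have gint (u : R -> R) : continuous u -> leb.-integrable setT (EFin \o (fun x => u x * chi x)).
  move=> cu; rewrite (_ : _ \o _ = (EFin \o u) \_ `[a, t]); last first.
    by rewrite restrict_EFin; apply/funext => x /=; rewrite restr.
  have mD : measurable (`[a, t]%classic : set (measurableTypeR R)).
    exact: measurable_itv.
  apply: (iffLR (integrable_mkcond (mu := leb) (EFin \o u) mD)).
  apply: continuous_compact_integrable; first exact: segment_compact.
  exact: continuous_subspaceT.
have chiL : chi \in Lfun leb 2%:E.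
  apply/Lfun2P; split => //.
  rewrite (_ : _ \o _ = EFin \o (fun x => cst 1 x * chi x)); last first.
    by apply/funext => x /=; rewrite expr2 chi2 mul1r.
  by apply: gint; exact: cst_continuous.
have gL : (fun x => g x * chi x) \in Lfun leb 2%:E.
  apply/Lfun2P; split; first exact: measurable_funM.
  rewrite (_ : _ \o _ = EFin \o (fun x => (g x * g x) * chi x)); last first.
    by apply/funext => x /=; rewrite exprMn !expr2 chi2.
  by apply: gint => x; apply: continuousM; exact: cg.
have E : inner leb (fun x => g x * chi x) chi = G t - G a.
  rewrite /inner; under eq_Rintegral do rewrite -mulrA chi2 -restr.
  rewrite -Rintegral_mkcond /Rintegral (@continuous_FTC2 _ _ G)//.
  - exact: continuous_subspaceT.
  - split; first by move=> x _; have [] := dG x.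
      exact/cvg_at_right_filter/cG.
    exact/cvg_at_left_filter/cG.
  - by move=> x _; rewrite derive1E; have [_ ] := dG x.
have E1 : inner leb chi chi = t - a.
  rewrite /inner /Rintegral; under eq_integral do rewrite chi2.
  rewrite integral_indic//.
  rewrite setIT.
  have /= := lebesgue_measure_itv (Interval (BLeft a) (BRight t)).
  by rewrite lte_fin at_ => /(congr1 (@fine R)).
rewrite integral_sqrE// -EFinM lee_fin -E -E1 mulrC.
exact: inner_cauchy_schwarz.
Qed.

Lemma is_derive_first n (f : 'rV[R]_n.+1 -> R^o) t y :
  derivable f (rV_cons (t, y)) (delta_mx 0 ord0) ->
  is_derive (t : R^o) 1 (fun t => f (rV_cons (t, y)) : R^o)
    (partial ord0 f (rV_cons (t, y))).
Proof.
move=> df.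
have E : (fun h : R => h^-1 *: (((fun t => f (rV_cons (t, y)) : R^o) \o shift t)
      (h *: (1 : R^o)) - f (rV_cons (t, y)))) =
    fun h => h^-1 *: ((f \o shift (rV_cons (t, y))) (h *: delta_mx 0 ord0)
      - f (rV_cons (t, y))).
  apply/funext => h /=; congr (_ *: (f _ - _)); apply/rowP => i; rewrite [RHS]mxE.
  case: (unliftP ord0 i) => [j ->|->].
    by rewrite !rV_consS !mxE eq_sym (negbTE (neq_lift _ _)) andbF mulr0 add0r.
  by rewrite !rV_cons0 !mxE !eqxx.
by apply: DeriveDef; rewrite /derivable /derive E.
Qed.

End FundamentalTheorem.

(** * Poincare's inequality on a grid of cubes *)

Section Cells.
Context {R : realType}.
Local Notation leb := (@lebesgue_measure R).

Definition rV_tail n (x : 'rV[R]_n.+1) : 'rV[R]_n := \row_i x 0 (lift ord0 i).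
Definition rV_head n (x : 'rV[R]_n.+1) : measurableTypeR R := x 0 ord0.
(** The head is taken as the second factor, so that partial_inner integrates the
    tail out and leaves a function of one real variable. *)
Definition rV_swap_cons n (z : 'rV[R]_n * measurableTypeR R) : 'rV[R]_n.+1 :=
  rV_cons (z.2, z.1).

Lemma rV_tail_cons n t (x : 'rV[R]_n) : rV_tail (rV_cons (t, x)) = x.
Proof. by apply/rowP => i; rewrite mxE rV_consS. Qed.

Lemma rV_head_cons n t (x : 'rV[R]_n) : rV_head (rV_cons (t, x)) = t.
Proof. exact: rV_cons0. Qed.

Lemma rV_cons_coordinates n : product_coordinates (rV_lebesgue n.+1)
  (rV_sfm n) leb (@rV_swap_cons n) (@rV_tail n) (@rV_head n).
Proof.
split.
- apply: measurable_rV => i; rewrite /rV_swap_cons.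
  case: (unliftP ord0 i) => [j ->|->].
    under eq_fun do rewrite rV_consS.
    by apply: (measurableT_comp (@measurable_coord R n j)); exact: measurable_fst.
  by under eq_fun do rewrite rV_cons0; exact: measurable_snd.
- apply: measurable_rV => i; under eq_fun do rewrite mxE; exact: measurable_coord.
- exact: measurable_coord.
- by move=> x y; exact: rV_tail_cons.
- by move=> x y; exact: rV_head_cons.
move=> A mA; rewrite rV_lebesgueS; apply: eq_integral => x _ /=.
congr (leb _); apply/funext => t; apply/propext.
Qed.

Lemma continuous_rV_tail n : continuous (@rV_tail n).
Proof.
apply: continuous_rV => i; under eq_fun do rewrite mxE.
exact: coord_continuous.
Qed.

Variables (a h : R) (M : nat).
Hypothesis h0 : 0 < h.

Fixpoint cell_idx (n : nat) : finType :=
  if n is m.+1 then (cell_idx m * 'I_M)%type else unit.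

(** The L^2-normalized indicators of the cubes of side h of a grid, built one
    coordinate at a time for inductions on the dimension. *)
Fixpoint cell n : cell_idx n -> 'rV[R]_n -> R :=
  match n with
  | 0 => fun _ _ => 1
  | m.+1 => fun q => tensor (@rV_tail m) (@rV_head m) (cell q.1) (cell1 a h q.2)
  end.

Lemma card_cell_idx n : #|cell_idx n| = (M ^ n)%N.
Proof.
elim: n => [|n ih]; first by rewrite card_unit.
by rewrite card_prod ih card_ord expnSr.
Qed.

Lemma Lfun2_cell n q : cell (n := n) q \in Lfun (rV_lebesgue n) 2%:E.
Proof.
elim: n q => [|n ih] q.
  apply: (@Lfun2_bounded_support _ _ _ setT 1) => //.
  - exact: measurable_cst.
  - exists 0; split => // M' M'0 x _ /=; rewrite (_ : x = 0) ?normr0 ?ltW//.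
    by apply/rowP => -[].
  - by move=> x; apply: contra_notP => _.
  - by move=> x; rewrite /= normr1.
apply: (Lfun2_tensor (rV_cons_coordinates n)); last exact: Lfun2_cell1.
by rewrite rV_sfmE; exact: ih.
Qed.

Lemma integrable_row0 (f : 'rV[R]_0 -> R) : f \in Lfun (rV_lebesgue 0) 2%:E ->
  forall g, g \in Lfun (rV_lebesgue 0) 2%:E ->
  inner (rV_lebesgue 0) f g = f 0 * g 0.
Proof.
move=> fL g gL; rewrite /inner /Rintegral integral_dirac//; last first.
  by apply/measurable_EFinP; apply: measurable_funM;
    [exact: Lfun2_measurable fL|exact: Lfun2_measurable gL].
by rewrite diracT mul1e.
Qed.

Lemma bessel_cell n g : g \in Lfun (rV_lebesgue n) 2%:E ->
  \sum_q inner (rV_lebesgue n) g (cell q) ^+ 2 <= inner (rV_lebesgue n) g g.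
Proof.
elim: n g => [|n ih] g gL.
  rewrite (big_pred1 tt); last by case.
  by rewrite !integrable_row0// ?mulr1// (Lfun2_cell (n := 0) tt).
have PC := rV_cons_coordinates n.
have cL q : cell (n := n) q \in Lfun (rV_sfm n) 2%:E.
  by rewrite rV_sfmE; exact: Lfun2_cell.
apply: le_trans (bessel_slices PC (e := @cell n) cL _ gL); last first.
  by move=> u; rewrite rV_sfmE; exact: ih.
rewrite -(pair_bigA _ (fun q (p : 'I_M) => inner (rV_lebesgue n.+1) g
  (tensor (@rV_tail n) (@rV_head n) (cell q) (cell1 a h p)) ^+ 2))/=.
apply: ler_sum => q _.
under eq_bigr do rewrite (inner_partial_inner PC)// ?Lfun2_cell1//.
apply: bessel; [exact: Lfun2_cell1|exact: cell1_orthonormal|].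
exact: (Lfun2_partial_inner PC).
Qed.

Lemma inner_cell_le1 n q : inner (rV_lebesgue n) (cell q) (cell q) <= 1.
Proof.
(* With I the squared norm of the cell, Bessel's inequality reads I^2 <= I. *)
have cL := Lfun2_cell q; have := bessel_cell cL.
rewrite (bigD1 q)//= => /(le_trans _) - /(_ (inner (rV_lebesgue n) (cell q) (cell q) ^+ 2)).
rewrite lerDl sumr_ge0//; last by move=> *; exact: sqr_ge0.
move=> /(_ isT); set I := inner _ _ _ => II.
have : 0 <= I by exact: inner_ge0.
nra.
Qed.

Definition box n : set 'rV[R]_n := [set x | forall i, a < x 0 i < a + M%:R * h].

Arguments box n : clear implicits.

Section PoincareStep.
Variable n : nat.
Variable f : 'rV[R]_n.+1 -> R^o.
Hypothesis tf : test_function (box n.+1) f.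
Local Notation mu := (rV_lebesgue n.+1).
Local Notation m1 := (rV_sfm n).
Local Notation pr := (@rV_swap_cons n).

Let PC := rV_cons_coordinates n.
Let f0 := partial ord0 f.
Let tf0 : test_function (box n.+1) f0. Proof. exact: test_function_partial. Qed.
Let fL : (f : 'rV[R]_n.+1 -> R) \in Lfun mu 2%:E.
Proof. exact: test_function_Lfun2 tf. Qed.
Let f0L : (f0 : 'rV[R]_n.+1 -> R) \in Lfun mu 2%:E.
Proof. exact: test_function_Lfun2 tf0. Qed.
Let sl t : 'rV[R]_n -> R := fun x => f (rV_cons (t, x)).

Lemma test_function_slice_cons t : test_function (box n) (sl t : 'rV[R]_n -> R^o).
Proof.
apply: (test_function_slice (rV_cons_embedding n t) (@continuous_rV_tail n)) tf.
  by move=> x; exact: rV_tail_cons.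
by move=> x bx i; have := bx (lift ord0 i); rewrite rV_consS.
Qed.

Lemma Lfun2_slice_cons t : sl t \in Lfun m1 2%:E.
Proof. by rewrite rV_sfmE; exact: test_function_Lfun2 (test_function_slice_cons t). Qed.

Let cL q : cell (n := n) q \in Lfun m1 2%:E.
Proof. by rewrite rV_sfmE; exact: Lfun2_cell. Qed.

Let F q := partial_inner m1 pr f (cell (n := n) q).
Let FL q : F q \in Lfun leb 2%:E.
Proof. exact: (Lfun2_partial_inner PC). Qed.

Let cut (p : 'I_M) (z : 'rV[R]_n.+1) : R := f0 z * cell_indic a h p (rV_head z).

Let cutL p : cut p \in Lfun mu 2%:E.
Proof.
apply: Lfun2_mul_le1 => //.
  apply: (measurableT_comp (measurable_cell_indic a h p)).
  exact: (measurable_p2 PC).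
by move=> x; rewrite cell_indic_sqr; exact: cell_indic_le1.
Qed.

(** The one-dimensional bound along the first coordinate, integrated over the
    others. *)
Lemma slice_increment_le (p : 'I_M) t : cell_itv a h p t ->
  inner m1 (fun x => sl t x - sl (a + p%:R * h) x)
    (fun x => sl t x - sl (a + p%:R * h) x) <=
  h * inner mu (cut p) (cut p).
Proof.
set s := a + p%:R * h.
move=> pt; have /cell_itvP/andP[st th] := pt.
have dL := Lfun2B (Lfun2_slice_cons t) (Lfun2_slice_cons s).
rewrite -lee_fin -integral_sqrE// EFinM -integral_sqrE//.
have mc2 : measurable_fun setT (fun z => (cut p z ^+ 2)%:E).
  by apply/measurable_EFinP/measurable_funX; exact: Lfun2_measurable (cutL p).
have c20 z : (0 <= (cut p z ^+ 2)%:E)%E by rewrite lee_fin sqr_ge0.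
rewrite (ge0_integral_product PC)// fubini_tonelli1//; last first.
  exact: (measurableT_comp mc2 (measurable_pr PC)).
have mF := measurable_fun_fubini_tonelli_F (m2 := leb) _
  (measurableT_comp mc2 (measurable_pr PC)) (fun z => c20 _).
rewrite -ge0_integralZl ?lee_fin ?(ltW h0)//; last first.
  by move=> x _; apply: integral_ge0.
apply: ge0_le_integral => //.
- by move=> x _; rewrite lee_fin sqr_ge0.
- by apply/measurable_EFinP/measurable_funX; exact: Lfun2_measurable dL.
- exact: measurable_funeM.
move=> x _.
have [Cf _ _] := tf; have [Cf0 _ _] := tf0.
have /(_ (Ck_continuous (Cf0 0%N))) cg :
    continuous f0 -> continuous (fun r : R => f0 (rV_cons (r, x)) : R^o).
  move=> cf0 r; apply: (@continuous_comp _ _ _ (fun r : R => rV_cons (r, x)) f0);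
    last exact: cf0.
  apply: continuous_rV => i; case: (unliftP ord0 i) => [j ->|->].
    by under eq_fun do rewrite rV_consS; exact: cst_continuous.
  by under eq_fun do rewrite rV_cons0; move=> ?; exact: cvg_id.
have dG (r : R) : is_derive (r : R^o) 1 (fun r => f (rV_cons (r, x)) : R^o)
    (f0 (rV_cons (r, x))).
  by apply: is_derive_first; have [_ /(_ ord0)[df _]] := Cf 1%N; exact: df.
apply: le_trans (sqr_increment_le st dG cg) _.
have ts : t - s <= h by move: th; rewrite -natr1 /s; lra.
apply: lee_pmul => //; first by rewrite lee_fin subr_ge0.
  by apply: integral_ge0 => r _; rewrite lee_fin sqr_ge0.
apply: ge0_le_integral => //.
- by move=> r _; rewrite lee_fin sqr_ge0.
- apply/measurable_EFinP/measurable_funX; apply: measurable_funM.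
    exact: continuous_measurable_fun.
  by apply: measurable_indic; exact: measurable_itv.
- apply: (measurableT_comp (measurableT_comp mc2 (measurable_pr PC))).
  exact: pair1_measurable.
move=> r _; rewrite lee_fin /cut/= /rV_swap_cons/= rV_head_cons !exprMn.
rewrite ler_wpM2l ?sqr_ge0// cell_indic_sqr indicE.
have [rst|] := boolP (r \in _); last by rewrite expr0n /cell_indic indicE ler0n.
rewrite expr1n cell_indicT//; apply/cell_itvP.
by move: rst; rewrite inE/= in_itv/= -/s => /andP[-> rt]; lra.
Qed.

Lemma sum_cut_le : \sum_p inner mu (cut p) (cut p) <= inner mu f0 f0.
Proof.
have := @sum_inner_le _ _ _ mu 'I_M 'I_1 cut (fun=> f0) cutL (fun=> f0L).
rewrite big_ord1; apply => x; rewrite big_ord1 /cut.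
under eq_bigr do rewrite exprMn cell_indic_sqr.
by rewrite -mulr_sumr ler_piMr ?sqr_ge0// sum_cell_indic_le1.
Qed.

Let FB q t t' : F q t - F q t' = inner m1 (fun x => sl t x - sl t' x) (cell q).
Proof. by rewrite (innerBl (Lfun2_slice_cons t) (Lfun2_slice_cons t') (cL q)). Qed.

(** On a slab, replacing each coefficient by its mean costs its oscillation;
    Bessel's inequality bounds the oscillations of all coefficients together by
    that of the slice. *)
Lemma sum_cut_coefficient_le (p : 'I_M) :
  \sum_q inner leb (fun t => F q t * cell_indic a h p t)
    (fun t => F q t * cell_indic a h p t) <=
  \sum_q inner leb (F q) (cell1 a h p) ^+ 2 + h ^+ 2 * inner mu (cut p) (cut p).
Proof.
pose s := a + p%:R * h; pose E := inner mu (cut p) (cut p).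
pose G q t := (F q t - F q s) * cell_indic a h p t.
have GL q : G q \in Lfun leb 2%:E.
  rewrite (_ : G q = fun t => F q t * cell_indic a h p t -
      F q s * cell_indic a h p t); last by apply/funext => t; exact: mulrBl.
  apply: Lfun2B; first exact: Lfun2_cut.
  by apply: Lfun2Z; exact: Lfun2_cell_indic.
have mean_le q : inner leb (fun t => F q t * cell_indic a h p t)
      (fun t => F q t * cell_indic a h p t) <=
    inner leb (F q) (cell1 a h p) ^+ 2 + inner leb (G q) (G q).
  exact: (cut_mean a h0 p (F q s) (FL q)).
apply: le_trans (ler_sum _ (fun q _ => mean_le q)) _.
rewrite big_split/= lerD2l -lee_fin -(integral_sum_sqr GL) -/E.
apply: (@le_trans _ _ (\int[leb]_t ((h * E)%:E * (cell_indic a h p t)%:E))%E).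
  apply: ge0_le_integral => //.
  - by move=> t _; rewrite lee_fin sumr_ge0// => q _; exact: sqr_ge0.
  - exact: measurable_sum_sqr.
  - apply: measurable_funeM; apply/measurable_EFinP.
    exact: measurable_cell_indic.
  move=> t _; rewrite -EFinM lee_fin.
  have [pt|pt] := pselect (cell_itv a h p t); last first.
    rewrite cell_indicF// mulr0 big1// => q _.
    by rewrite /G cell_indicF// mulr0 expr0n.
  rewrite cell_indicT// mulr1; apply: le_trans (slice_increment_le pt).
  under eq_bigr do rewrite /G cell_indicT// mulr1 FB.
  have := bessel_cell (n := n) (g := fun x => sl t x - sl s x).
  rewrite rV_sfmE; apply; rewrite -rV_sfmE.
  exact: Lfun2B (Lfun2_slice_cons t) (Lfun2_slice_cons s).
have E0 : 0 <= E by exact: inner_ge0.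
rewrite ge0_integralZl//; last 3 first.
- by apply/measurable_EFinP; exact: measurable_cell_indic.
- by move=> t _; rewrite lee_fin /cell_indic indicE ler0n.
- by rewrite lee_fin mulr_ge0// ltW.
by rewrite integral_cell_indic// -EFinM lee_fin expr2 mulrAC.
Qed.

(** The coefficients vanish outside the slabs because f is supported in the
    box. *)
Lemma coefficient_le_cut q : inner leb (F q) (F q) <=
  \sum_(p < M) inner leb (fun t => F q t * cell_indic a h p t)
    (fun t => F q t * cell_indic a h p t).
Proof.
have := @sum_inner_le _ _ _ leb 'I_1 'I_M (fun=> F q)
  (fun p t => F q t * cell_indic a h p t) (fun=> FL q)
  (fun p => Lfun2_cut a h p (FL q)).
rewrite big_ord1; apply => t; rewrite big_ord1.
under [leRHS]eq_bigr do rewrite exprMn cell_indic_sqr.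
rewrite -mulr_sumr.
have [/(sum_cell_indic_ge1 h0) ht|ht] := boolP (a <= t < a + M%:R * h).
  by rewrite ler_peMr ?sqr_ge0.
rewrite (_ : F q t = 0) ?expr0n ?mul0r//.
rewrite /F /partial_inner (_ : (fun x => _) = fun=> 0) ?inner_0l//.
apply/funext => x; apply: (test_function_support tf) => /(_ ord0).
by rewrite rV_cons0 => /andP[t1 t2]; move: ht; rewrite t2 (ltW t1).
Qed.

Lemma sum_coefficients_le :
  \sum_q inner leb (F q) (F q) <=
  \sum_q inner mu f (cell (n := n.+1) q) ^+ 2 + h ^+ 2 * inner mu f0 f0.
Proof.
apply: le_trans (ler_sum _ (fun q _ => coefficient_le_cut q)) _.
rewrite exchange_big/=.
apply: le_trans (ler_sum _ (fun p _ => sum_cut_coefficient_le p)) _.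
rewrite big_split/= -mulr_sumr; apply: lerD; last first.
  by rewrite ler_wpM2l ?sqr_ge0// sum_cut_le.
rewrite exchange_big/= pair_bigA/=.
by apply: ler_sum => -[q p] _; rewrite -(inner_partial_inner PC)// Lfun2_cell1.
Qed.

Hypothesis IH : forall g : 'rV[R]_n -> R^o, test_function (box n) g ->
  inner (rV_lebesgue n) g g <=
  \sum_q inner (rV_lebesgue n) g (cell q) ^+ 2 +
  h ^+ 2 * \sum_i inner (rV_lebesgue n) (partial i g) (partial i g).

Let fi (i : 'I_n) := partial (lift ord0 i) f.
Let fiL i : (fi i : 'rV[R]_n.+1 -> R) \in Lfun mu 2%:E.
Proof. by apply: test_function_Lfun2; exact: test_function_partial tf. Qed.

(** Poincare's inequality in the tail variables, integrated over the first one. *)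
Lemma inner_le_slices : inner mu f f <= \sum_q inner leb (F q) (F q) +
  h ^+ 2 * \sum_i inner mu (fi i) (fi i).
Proof.
have m0 u t : (0 <= \int[m1]_x (u (pr (x, t)) ^+ 2 : R)%:E)%E.
  by apply: integral_ge0 => x _; rewrite lee_fin sqr_ge0.
have E i : (inner mu (fi i) (fi i))%:E =
    (\int[leb]_t \int[m1]_x (fi i (pr (x, t)) ^+ 2)%:E)%E.
  by rewrite (integral_sqr_slice PC (fiL i)).
rewrite -lee_fin EFinD EFinM -[in X in (_ * X)%E]sumEFin.
rewrite [X in (_ * X)%E](eq_bigr _ (fun i _ => E i)).
rewrite -(integral_sum_sqr FL) -(integral_sqr_slice PC fL).
have mS i : measurable_fun setT
    (fun t => \int[m1]_x (fi i (pr (x, t)) ^+ 2)%:E)%E.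
  exact: (measurable_sqr_slice PC (fiL i)).
rewrite -ge0_integral_sum//.
rewrite -ge0_integralZl ?lee_fin ?sqr_ge0//; last 2 first.
- exact: emeasurable_sum.
- by move=> t _; apply: sume_ge0 => i _; exact: m0.
rewrite -ge0_integralD//; last 4 first.
- by move=> t _; rewrite lee_fin sumr_ge0// => q _; exact: sqr_ge0.
- exact: measurable_sum_sqr.
- move=> t _; rewrite mule_ge0 ?lee_fin ?sqr_ge0//.
  by apply: sume_ge0 => i _; exact: m0.
- by apply: measurable_funeM; exact: emeasurable_sum.
apply: ge0_le_integral => //.
- exact: (measurable_sqr_slice PC fL).
- apply: emeasurable_funD; first exact: measurable_sum_sqr.
  by apply: measurable_funeM; exact: emeasurable_sum.
move=> t _; have tt := test_function_slice_cons t.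
rewrite (integral_sqrE (Lfun2_slice_cons t)).
have E2 i : (\int[m1]_x (fi i (pr (x, t)) ^+ 2)%:E)%E =
    (inner m1 (partial i (sl t)) (partial i (sl t)))%:E.
  rewrite -integral_sqrE.
    apply: eq_integral => x _; congr (_ ^+ 2)%:E.
    by rewrite (partial_embedding (rV_cons_embedding n t)).
  by rewrite rV_sfmE; exact: test_function_Lfun2 (test_function_partial i tt).
rewrite [X in (_ * X)%E](eq_bigr _ (fun i _ => E2 i)).
rewrite sumEFin -EFinM -EFinD lee_fin.
by have := IH tt; rewrite -rV_sfmE.
Qed.

End PoincareStep.

(** Induction on the dimension. In the tail variables each slice is controlled by
    its coefficients on the lower-dimensional cells; these are functions of the
    first coordinate, to which the one-dimensional inequality applies. *)
Lemma poincare_cells n (f : 'rV[R]_n -> R^o) : test_function (box n) f ->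
  inner (rV_lebesgue n) f f <=
  \sum_q inner (rV_lebesgue n) f (cell q) ^+ 2 +
  h ^+ 2 * \sum_i inner (rV_lebesgue n) (partial i f) (partial i f).
Proof.
elim: n f => [|n IH] f tf.
  have fL := test_function_Lfun2 tf.
  rewrite big_ord0 mulr0 addr0 (big_pred1 tt); last by case.
  by rewrite !integrable_row0// ?mulr1// (Lfun2_cell (n := 0) tt).
apply: le_trans (inner_le_slices tf IH) _.
rewrite big_ord_recl/= mulrDr addrA lerD2r.
exact: sum_coefficients_le.
Qed.

End Cells.

(** * Counting eigenvalues *)

Section EigenvalueCounting.
Context {R : realType} {n : nat}.
Variable Omega : set 'rV[R]_n.
Hypothesis bOmega : bounded_set Omega.
Local Notation mu := (rV_lebesgue n).

Lemma bounded_in_cube : exists2 L : R, 0 < L &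
  forall x i, Omega x -> - L < x 0 i < L.
Proof.
have [M [_ bM]] := bOmega; exists (Num.max 1 (M + 2)).
  by rewrite lt_max ltr01.
move=> x i Ox; rewrite -ltr_norml lt_max; apply/orP; right.
have xM : `|x| < M + 2.
  have M1 : M < M + 1 by rewrite ltrDl.
  have /= := bM _ M1 x Ox; lra.
have e0 : 0 < M + 2 by apply: le_lt_trans xM; exact: normr_ge0.
have : ball (0 : 'rV[R]_n) (M + 2) x by rewrite -ball_normE /= sub0r normrN.
by move=> /(ball_rVP _ _ e0)/(_ i); rewrite mxE sub0r normrN.
Qed.

Lemma test_functionS (D E : set 'rV[R]_n) psi : D `<=` E ->
  test_function D psi -> test_function E psi.
Proof. by move=> DE [Cp cp sp]; split => //; exact: subset_trans DE. Qed.

(** Both sides are continuous for H^1 convergence of test functions. *)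
Lemma poincare_H10 a h M u g : 0 < h -> Omega `<=` box a h M (n := n) ->
  H10_gradient Omega u g ->
  L2inner Omega u u <=
  \sum_(q : cell_idx M n) inner mu (u \_ Omega) (cell a h q) ^+ 2 +
  h ^+ 2 * \sum_i L2inner Omega (g i) (g i).
Proof.
move=> h0 OB [uL gL _ [psi [tp pu pg]]].
have pL j : (psi j : 'rV[R]_n -> R) \in Lfun mu 2%:E := test_function_Lfun2 (tp j).
have lhs := inner_sqr_cvg pL uL pu.
have rhs : \sum_(q : cell_idx M n) inner mu (psi j) (cell a h q) ^+ 2 +
    h ^+ 2 * \sum_i inner mu (partial i (psi j)) (partial i (psi j))
    @[j --> \oo] -->
    \sum_(q : cell_idx M n) inner mu (u \_ Omega) (cell a h q) ^+ 2 +
    h ^+ 2 * \sum_i L2inner Omega (g i) (g i).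
  apply: cvgD; last apply: cvgMr.
    apply: cvg_sumr => q; rewrite expr2; under eq_fun do rewrite expr2.
    by apply: cvgM; apply: inner_cvg => //; exact: Lfun2_cell.
  apply: cvg_sumr => i; rewrite L2innerE.
  apply: inner_sqr_cvg (pg i) => //.
  - by move=> j; exact: test_function_Lfun2 (test_function_partial i (tp j)).
  - exact: gL.
rewrite L2innerE.
apply: ler_cvg_to lhs rhs _; apply: nearW => j.
by apply: poincare_cells => //; exact: test_functionS (tp j).
Qed.

(** A polynomial Weyl bound. On a grid of mesh about 1/Lambda, Poincare's
    inequality leaves at least half of the mass of a normalized eigenfunction of
    eigenvalue at most Lambda in the span of the cells. Summing over an
    orthonormal family and applying Bessel's inequality to each cell, the number
    of eigenfunctions is at most twice the number of cells. *)
Lemma eigenvalue_count : exists2 A : R, 0 <= A &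
  forall (phi : nat -> 'rV[R]_n -> R^o) (lambda : nat -> R),
    (forall k, dirichlet_eigenfunction Omega (lambda k) (phi k)) ->
    (forall k l, L2inner Omega (phi k) (phi l) = (k == l)%:R) ->
  forall (Lambda : R) N, 0 < Lambda ->
  \sum_(k < N | lambda k <= Lambda) 1 <= 2 * (A * Lambda + 1) ^+ n.
Proof.
have [L L0 OL] := bounded_in_cube.
exists (8 * L ^+ 2); first by rewrite mulr_ge0 ?sqr_ge0.
move=> phi lambda eig orth Lambda N Lambda0.
(* With h = 2 L / M, taking M >= 8 L^2 Lambda makes h^2 Lambda <= 1 / (2 M). *)
pose M := (Num.truncn (8 * L ^+ 2 * Lambda)).+1.
have LL : 0 < L ^+ 2 * Lambda by rewrite mulr_gt0 ?exprn_gt0.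
have M1 : 1 <= M%:R :> R by rewrite ler1n.
have M2 : 8 * L ^+ 2 * Lambda <= M%:R by exact: ltW (truncnS_gt _).
have M3 : M%:R <= 8 * L ^+ 2 * Lambda + 1.
  by rewrite /M -natr1 lerD2r; rewrite truncn_le// -mulrA mulr_ge0// ltW.
pose h := 2 * L / M%:R.
have M0 : 0 < M%:R :> R by lra.
have h0 : 0 < h by rewrite divr_gt0 ?mulr_gt0.
have OB : Omega `<=` box (- L) h M (n := n).
  move=> x Ox i; rewrite (_ : - L + M%:R * h = L); first exact: OL.
  by rewrite /h mulrC divfK ?gt_eqF//; ring.
have hL2 : h ^+ 2 * Lambda <= 2^-1.
  have -> : h ^+ 2 * Lambda = 4 * (L ^+ 2 * Lambda) / M%:R ^+ 2.
    by rewrite /h; field; rewrite gt_eqF.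
  rewrite ler_pdivrMr ?exprn_gt0//; nra.
pose phi' k := phi k \_ Omega.
have phiL k : (phi' k : 'rV[R]_n -> R) \in Lfun mu 2%:E by have [[]] := eig k.
have phi1 k l : inner mu (phi' k) (phi' l) = (k == l)%:R by rewrite -L2innerE.
have half k : lambda k <= Lambda ->
    2^-1 <= \sum_(q : cell_idx M n) inner mu (phi' k) (cell (- L) h q) ^+ 2.
  move=> kL; have [/H10P[g Hg] _ ek] := eig k.
  have k1 : L2inner Omega (phi k) (phi k) = 1 by rewrite orth eqxx.
  have := poincare_H10 h0 OB Hg; rewrite -(eigenvalue_gradient ek Hg k1) k1.
  have : h ^+ 2 * lambda k <= h ^+ 2 * Lambda by rewrite ler_wpM2l ?sqr_ge0.
  lra.
have : \sum_(k < N | lambda k <= Lambda) 2^-1 <= M%:R ^+ n :> R.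
  apply: (@le_trans _ _ (\sum_(k < N | lambda k <= Lambda)
      \sum_(q : cell_idx M n) inner mu (phi' k) (cell (- L) h q) ^+ 2)).
    by apply: ler_sum => k; exact: half.
  rewrite exchange_big/=; apply: (@le_trans _ _ (\sum_(q : cell_idx M n) 1)).
    apply: ler_sum => q _; apply: le_trans (inner_cell_le1 (- L) h0 q).
    apply: le_trans (bessel phiL phi1 N (Lfun2_cell (- L) h0 q)).
    rewrite big_mkcond; apply: ler_sum => k _.
    by rewrite innerC; case: ifP => // _; exact: sqr_ge0.
  by rewrite sumr_const card_cell_idx natrX.
have -> : \sum_(k < N | lambda k <= Lambda) (1 : R) =
    2 * \sum_(k < N | lambda k <= Lambda) 2^-1.
  by rewrite mulr_sumr; apply: eq_bigr => k _; rewrite divff.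
have : M%:R ^+ n <= (8 * L ^+ 2 * Lambda + 1) ^+ n :> R.
  by apply: lerXn2r; rewrite ?nnegrE; lra.
lra.
Qed.

(** Infinitely many indices would make the count unbounded. *)
Lemma eigenvalues_finite (phi : nat -> 'rV[R]_n -> R^o) (lambda : nat -> R) Lambda :
  (forall k, dirichlet_eigenfunction Omega (lambda k) (phi k)) ->
  (forall k l, L2inner Omega (phi k) (phi l) = (k == l)%:R) ->
  exists N : nat, forall k, lambda k <= Lambda -> (k < N)%N.
Proof.
move=> eig orth; have [A A0 count] := eigenvalue_count.
apply: contrapT => nN.
have {}nN N : exists2 k, (N <= k)%N & lambda k <= Lambda.
  apply: contrapT => Nk; apply: nN; exists N => k kL.
  by rewrite ltnNge; apply/negP => Nlek; apply: Nk; exists k.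
pose Lambda' := Num.max Lambda 1.
have L'0 : 0 < Lambda' by rewrite lt_max ltr01 orbT.
pose g k : R := if lambda k <= Lambda' then 1 else 0.
have g0 k : 0 <= g k by rewrite /g; case: ifP.
have many m : exists N, m%:R <= \sum_(k < N) g k.
  elim: m => [|m [N mN]]; first by exists 0%N; rewrite big_ord0.
  have [k Nk kL] := nN N; exists k.+1.
  rewrite big_ord_recr/= {2}/g le_max kL/= -natr1 lerD2r; apply: le_trans mN _.
  rewrite (big_ord_widen k g Nk) big_mkcond/=; apply: ler_sum => i _.
  by case: ifP.
pose B := 2 * (A * Lambda' + 1) ^+ n.
have [N BN] := many (Num.truncn B).+1.
have := count _ _ eig orth Lambda' N L'0.
rewrite big_mkcond => /(le_trans BN).
by rewrite leNgt truncnS_gt.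
Qed.

End EigenvalueCounting.

(** * Tensor products of eigenfunctions *)

Section ProductSwap.
Context d d1 d2 (T : measurableType d) (T1 : measurableType d1)
  (T2 : measurableType d2) (R : realType).
Variables (mu : {measure set T -> \bar R})
  (m1 : {sigma_finite_measure set T1 -> \bar R})
  (m2 : {sigma_finite_measure set T2 -> \bar R}).
Variables (pr : T1 * T2 -> T) (p1 : T -> T1) (p2 : T -> T2).
Hypothesis PC : product_coordinates mu m1 m2 pr p1 p2.

Lemma product_coordinates_swap :
  product_coordinates mu m2 m1 (fun z => pr (z.2, z.1)) p2 p1.
Proof.
have [mpr mp1 mp2 k1 k2 muE] := PC.
have msw : measurable_fun setT (fun z : T2 * T1 => (z.2, z.1)).
  by apply: measurable_fun_pair; [exact: measurable_snd|exact: measurable_fst].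
split=> // [|A mA]; first exact: (measurableT_comp mpr msw).
rewrite muE//; have mP : measurable (pr @^-1` A).
  by rewrite -[X in measurable X]setTI; exact: mpr.
transitivity (\int[m1 \x m2]_z (\1_(pr @^-1` A) z)%:E)%E.
  by rewrite integral_indic// setIT.
rewrite fubini_tonelli2//; last first.
  by apply/measurable_EFinP; exact: measurable_indic.
apply: eq_integral => y _; rewrite indic_fubini_tonelli_GE//.
Qed.

(** By Fubini both sides integrate over y a pairing of slices against b, which
    vanishes off D2. *)
Lemma inner_slicewise (D2 : set T2) c (f f' : T -> R) a a' b :
  f \in Lfun mu 2%:E -> f' \in Lfun mu 2%:E ->
  a \in Lfun m1 2%:E -> a' \in Lfun m1 2%:E -> b \in Lfun m2 2%:E ->
  (forall y, ~ D2 y -> b y = 0) ->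
  (forall y, D2 y -> inner m1 (fun x => f (pr (x, y))) a =
    c * inner m1 (fun x => f' (pr (x, y))) a') ->
  inner mu f (tensor p1 p2 a b) = c * inner mu f' (tensor p1 p2 a' b).
Proof.
move=> fL f'L aL a'L bL b0 ff'.
rewrite !(inner_partial_inner PC)//.
have U'L := Lfun2_partial_inner PC f'L a'L.
rewrite -innerZl//; apply: eq_Rintegral => y _.
have [Dy|Dy] := pselect (D2 y); last by rewrite b0// !mulr0.
by rewrite /partial_inner ff'.
Qed.

(** Inner products of tensors factor, so that the squared distance expands into
    products of convergent quantities. *)
Lemma tensor_cvg (w : nat -> T1 -> R) (w' : nat -> T2 -> R) f g :
  (forall j, w j \in Lfun m1 2%:E) -> (forall j, w' j \in Lfun m2 2%:E) ->
  f \in Lfun m1 2%:E -> g \in Lfun m2 2%:E ->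
  inner m1 (fun x => w j x - f x) (fun x => w j x - f x) @[j --> \oo] --> 0 ->
  inner m2 (fun x => w' j x - g x) (fun x => w' j x - g x) @[j --> \oo] --> 0 ->
  inner mu (fun z => tensor p1 p2 (w j) (w' j) z - tensor p1 p2 f g z)
    (fun z => tensor p1 p2 (w j) (w' j) z - tensor p1 p2 f g z)
    @[j --> \oo] --> 0.
Proof.
move=> wL w'L fL gL wf w'g.
have h : inner m1 (w j) (w j) * inner m2 (w' j) (w' j) -
    2 * (inner m1 (w j) f * inner m2 (w' j) g) +
    inner m1 f f * inner m2 g g @[j --> \oo] -->
    inner m1 f f * inner m2 g g - 2 * (inner m1 f f * inner m2 g g) +
    inner m1 f f * inner m2 g g.
  apply: cvgD; last exact: cvg_cst.
  apply: cvgB; first by apply: cvgM; exact: inner_sqr_cvg.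
  by apply: cvgMr; apply: cvgM; exact: inner_cvg.
rewrite (_ : _ + _ = 0) in h; last by ring.
apply: (eq_cvg_to h) => j.
by rewrite inner_sqrB ?(Lfun2_tensor PC)// !(inner_tensor PC).
Qed.

End ProductSwap.

Section TensorEigenfunctions.
Context {R : realType} {n1 n2 : nat}.
Variables (Omega1 : set 'rV[R]_n1) (Omega2 : set 'rV[R]_n2).
Local Notation Omega := (rV_setX Omega1 Omega2).
Local Notation mu := (rV_lebesgue (n1 + n2)).
Implicit Types (u : 'rV[R]_n1 -> R^o) (v : 'rV[R]_n2 -> R^o).

Let PC := @row_mx_coordinates R n1 n2.
Let PC' := product_coordinates_swap PC.

Lemma rV_tensorC u v :
  rV_tensor u v = tensor (@rsubmx R 1 n1 n2) (@lsubmx R 1 n1 n2) v u.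
Proof. by apply/funext => z; rewrite /rV_tensor /tensor mulrC. Qed.

Lemma L2_tensor u v : L2 Omega1 u -> L2 Omega2 v -> L2 Omega (rV_tensor u v).
Proof.
move=> uL vL; rewrite /L2 restrict_tensor.
by apply: (Lfun2_tensor PC); rewrite rV_sfmE.
Qed.

Lemma L2inner_tensor u v u' v' : L2 Omega1 u -> L2 Omega2 v ->
  L2 Omega1 u' -> L2 Omega2 v' ->
  L2inner Omega (rV_tensor u v) (rV_tensor u' v') =
  L2inner Omega1 u u' * L2inner Omega2 v v'.
Proof.
move=> uL vL u'L v'L; rewrite !L2innerE !restrict_tensor.
rewrite [LHS](inner_tensor PC)//; by rewrite !rV_sfmE.
Qed.

(** Reduces a weak identity on the product to its slices. *)
Lemma L2inner_slice_l c u u' v (f f' : 'rV[R]_(n1 + n2) -> R^o) :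
  L2 Omega1 u -> L2 Omega1 u' -> L2 Omega2 v -> L2 Omega f -> L2 Omega f' ->
  (forall y, Omega2 y -> L2inner Omega1 u (fun x => f (row_mx x y)) =
    c * L2inner Omega1 u' (fun x => f' (row_mx x y))) ->
  L2inner Omega (rV_tensor u v) f = c * L2inner Omega (rV_tensor u' v) f'.
Proof.
move=> uL u'L vL fL f'L ff'; rewrite !L2innerE !restrict_tensor ![inner _ (rV_tensor _ _) _]innerC.
apply: (inner_slicewise PC (D2 := Omega2)) => //; rewrite ?rV_sfmE//.
  by move=> y Oy; rewrite restrict_out.
move=> y Oy; have E (k : 'rV[R]_(n1 + n2) -> R^o) :
    (fun x => k (row_mx x y) : R^o) \_ Omega1 =
    fun x => (k \_ Omega) (row_mx x y).
  apply/funext => x; have [Ox|Ox] := pselect (Omega1 x).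
    by rewrite !restrict_in//; split; rewrite ?row_mxKl ?row_mxKr.
  by rewrite !restrict_out// => -[]; rewrite row_mxKl.
rewrite /= -!E innerC -L2innerE [X in _ = c * X]innerC -L2innerE.
exact: ff'.
Qed.

Lemma L2inner_slice_r c u v v' (f f' : 'rV[R]_(n1 + n2) -> R^o) :
  L2 Omega1 u -> L2 Omega2 v -> L2 Omega2 v' -> L2 Omega f -> L2 Omega f' ->
  (forall x, Omega1 x -> L2inner Omega2 v (fun y => f (row_mx x y)) =
    c * L2inner Omega2 v' (fun y => f' (row_mx x y))) ->
  L2inner Omega (rV_tensor u v) f = c * L2inner Omega (rV_tensor u v') f'.
Proof.
move=> uL vL v'L fL f'L ff'; rewrite !L2innerE !restrict_tensor ![inner _ (rV_tensor _ _) _]innerC.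
rewrite !rV_tensorC.
apply: (inner_slicewise PC' (D2 := Omega1)) => //; rewrite ?rV_sfmE//.
  by move=> y Oy; rewrite restrict_out.
move=> x Ox; have E (k : 'rV[R]_(n1 + n2) -> R^o) :
    (fun y => k (row_mx x y) : R^o) \_ Omega2 =
    fun y => (k \_ Omega) (row_mx x y).
  apply/funext => y; have [Oy|Oy] := pselect (Omega2 y).
    by rewrite !restrict_in//; split; rewrite ?row_mxKl ?row_mxKr.
  by rewrite !restrict_out// => -[]; rewrite row_mxKr.
rewrite /= -!E innerC -L2innerE [X in _ = c * X]innerC -L2innerE.
exact: ff'.
Qed.

Definition tensor_gradient u v (g : 'I_n1 -> 'rV[R]_n1 -> R^o)
    (h : 'I_n2 -> 'rV[R]_n2 -> R^o) (i : 'I_(n1 + n2)) :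
    'rV[R]_(n1 + n2) -> R^o :=
  match fintype.split i with
  | inl j => rV_tensor (g j) v
  | inr j => rV_tensor u (h j)
  end.

Lemma tensor_gradient_l u v g h i :
  tensor_gradient u v g h (lshift n2 i) = rV_tensor (g i) v.
Proof. by rewrite /tensor_gradient -[lshift _ _]/(unsplit (inl i)) unsplitK. Qed.

Lemma tensor_gradient_r u v g h i :
  tensor_gradient u v g h (rshift n1 i) = rV_tensor u (h i).
Proof. by rewrite /tensor_gradient -[rshift _ _]/(unsplit (inr i)) unsplitK. Qed.

(** Tensors of approximating test functions approximate the tensor, and each weak
    derivative of the tensor is a weak derivative of one factor on every slice. *)
Lemma H10_gradient_tensor u v g h : H10_gradient Omega1 u g ->
  H10_gradient Omega2 v h ->
  H10_gradient Omega (rV_tensor u v) (tensor_gradient u v g h).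
Proof.
move=> [uL gL wg [psi [tpsi pu pg]]] [vL hL wh [chi [tchi pv ph]]].
have tens := test_function_tensor (tpsi _) (tchi _).
split.
- exact: L2_tensor.
- move=> i; case: (split_ordP i) => j ->.
    by rewrite tensor_gradient_l; exact: L2_tensor.
  by rewrite tensor_gradient_r; exact: L2_tensor.
- move=> i theta tth; case: (split_ordP i) => j ->.
    rewrite tensor_gradient_l -[RHS]mulN1r.
    apply: L2inner_slice_l => //.
    + exact: test_function_L2 (test_function_partial _ tth).
    + exact: test_function_L2 tth.
    + move=> y Oy; rewrite mulN1r -wg; last exact: (test_function_slice_l Oy tth).
      congr (L2inner _ _ _); apply/funext => x.
      by rewrite (partial_embedding (row_mxl_embedding n1 y)).
  rewrite tensor_gradient_r -[RHS]mulN1r.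
  apply: L2inner_slice_r => //.
  + exact: test_function_L2 (test_function_partial _ tth).
  + exact: test_function_L2 tth.
  + move=> x Ox; rewrite mulN1r -wh; last exact: (test_function_slice_r Ox tth).
    congr (L2inner _ _ _); apply/funext => y.
    by rewrite (partial_embedding (row_mxr_embedding n2 x)).
exists (fun j => rV_tensor (psi j) (chi j)); split.
- by move=> j; exact: tens.
- rewrite restrict_tensor; apply: (tensor_cvg PC); rewrite ?rV_sfmE//.
  + by move=> j; exact: test_function_Lfun2 (tpsi j).
  + by move=> j; exact: test_function_Lfun2 (tchi j).
- move=> i; case: (split_ordP i) => j ->.
    rewrite tensor_gradient_l restrict_tensor.
    under eq_fun => k.
      have [/(_ 1%N) C1 _ _] := tpsi k.
      rewrite partial_tensor_l//; over.
    apply: (tensor_cvg PC); rewrite ?rV_sfmE//.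
    + by move=> k; exact: test_function_Lfun2 (test_function_partial j (tpsi k)).
    + by move=> k; exact: test_function_Lfun2 (tchi k).
    + exact: gL.
  rewrite tensor_gradient_r restrict_tensor.
  under eq_fun => k.
    have [/(_ 1%N) C1 _ _] := tchi k.
    rewrite partial_tensor_r//; over.
  apply: (tensor_cvg PC); rewrite ?rV_sfmE//.
  + by move=> k; exact: test_function_Lfun2 (tpsi k).
  + by move=> k; exact: test_function_Lfun2 (test_function_partial j (tchi k)).
  + exact: hL.
Qed.

Lemma eq_L2inner n (D : set 'rV[R]_n) (w f f' : 'rV[R]_n -> R^o) :
  (forall x, f x = f' x) -> L2inner D w f = L2inner D w f'.
Proof. by move=> /funext ->. Qed.

(** For fixed y a test function on the product restricts to one on Omega1, to
    which the equation of u applies; likewise for v, and the two halves of the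
    Laplacian add up. *)
Lemma eigenfunction_tensor lambda1 lambda2 u v :
  dirichlet_eigenfunction Omega1 lambda1 u ->
  dirichlet_eigenfunction Omega2 lambda2 v ->
  dirichlet_eigenfunction Omega (lambda1 + lambda2) (rV_tensor u v).
Proof.
move=> [/H10P[g Hg] cu eu] [/H10P[h Hh] cv ev].
have Hgh := H10_gradient_tensor Hg Hh.
have [uL _ _ _] := Hg; have [vL _ _ _] := Hh.
split.
- by apply/H10P; exists (tensor_gradient u v g h).
- move=> z; rewrite inE => -[Oz1 Oz2].
  by apply: continuous_tensor_at; [apply: cu|apply: cv]; rewrite inE.
move=> theta tth.
pose D1 z := \sum_i partial (lshift n2 i) (partial (lshift n2 i) theta) z.
pose D2 z := \sum_i partial (rshift n1 i) (partial (rshift n1 i) theta) z.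
have tD i : test_function Omega (partial i (partial i theta)).
  by apply: test_function_partial; exact: test_function_partial.
have D1L : L2 Omega (fun z => - D1 z).
  rewrite /L2 restrict_supported.
    by apply: Lfun2N; apply: Lfun2_sum => i _; exact: test_function_Lfun2 (tD _).
  move=> z Oz; rewrite /D1 big1 ?oppr0// => i _.
  exact: test_function_support (tD _) Oz.
have D2L : L2 Omega (fun z => - D2 z).
  rewrite /L2 restrict_supported.
    by apply: Lfun2N; apply: Lfun2_sum => i _; exact: test_function_Lfun2 (tD _).
  move=> z Oz; rewrite /D2 big1 ?oppr0// => i _.
  exact: test_function_support (tD _) Oz.
have thL := test_function_L2 tth.
have uvL := L2_tensor uL vL.
have -> : L2inner Omega (rV_tensor u v) (fun z => - laplacian theta z) =
    L2inner Omega (rV_tensor u v) (fun z => - D1 z) +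
    L2inner Omega (rV_tensor u v) (fun z => - D2 z).
  rewrite !L2innerE ![inner _ (rV_tensor _ _ \_ _) _]innerC -innerDl//.
  congr (inner _ _ _); apply/funext => z.
  have [Oz|Oz] := pselect (Omega z); last by rewrite !restrict_out// addr0.
  by rewrite !restrict_in// -opprD /laplacian big_split_ord.
rewrite mulrDl; congr (_ + _).
  apply: L2inner_slice_l => // y Oy.
  rewrite -eu; last exact: (test_function_slice_l Oy tth).
  by apply: eq_L2inner => x; rewrite (laplacian_slice_l theta x y).
apply: L2inner_slice_r => // x Ox.
rewrite -ev; last exact: (test_function_slice_r Ox tth).
by apply: eq_L2inner => y; rewrite (laplacian_slice_r theta x y).
Qed.

End TensorEigenfunctions.

(** * Eigenbases of a product *)

Section Eigenbases.
Context {R : realType}.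

Lemma exists_pair_enumeration :
  exists2 e : nat -> nat * nat, injective e & forall p, exists m, e m = p.
Proof.
have /card_esym/card_set_bijP[e [_ einj esurj]] := card_nat2.
exists e => [m m' emm'|p]; first by apply: einj; rewrite ?inE.
by have [m _ mp] := esurj p I; exists m.
Qed.

Section OneDomain.
Context {n : nat}.
Variables (Omega : set 'rV[R]_n) (phi : nat -> 'rV[R]_n -> R^o).
Local Notation mu := (rV_lebesgue n).
Local Notation phi' := (fun k => (phi k \_ Omega : 'rV[R]_n -> R)).
Hypothesis phiL : forall k, L2 Omega (phi k).
Hypothesis phi1 : forall k l, L2inner Omega (phi k) (phi l) = (k == l)%:R.

Lemma inner_restrict_orthonormal k l : inner mu (phi' k) (phi' l) = (k == l)%:R.
Proof. by rewrite -L2innerE. Qed.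

Lemma restrict_comb (c : nat -> R) N :
  (fun x => \sum_(k < N) c k * phi k x : R^o) \_ Omega =
  fun x => \sum_(k < N) c k * phi' k x.
Proof.
rewrite restrict_sum; apply/funext => x; apply: eq_bigr => k _.
by rewrite restrictZ.
Qed.

Lemma L2_comb (c : nat -> R) N :
  L2 Omega (fun x => \sum_(k < N) c k * phi k x).
Proof.
by rewrite /L2 restrict_comb; apply: Lfun2_sum => k _; exact: Lfun2Z (phiL k).
Qed.

Lemma L2norm_comb (c : nat -> R) N :
  L2norm Omega (fun x => \sum_(k < N) c k * phi k x) =
  (Num.sqrt (\sum_(k < N) c k ^+ 2))%:E.
Proof.
have := L2_comb c N; rewrite /L2 /L2norm restrict_comb => cL.
by rewrite Lnorm2_inner// (inner_comb_sqr phiL inner_restrict_orthonormal).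
Qed.

Lemma L2inner_comb (c : nat -> R) N l : (l < N)%N ->
  L2inner Omega (fun x => \sum_(k < N) c k * phi k x) (phi l) = c l.
Proof.
by move=> lN; rewrite L2innerE restrict_comb
  (inner_comb phiL inner_restrict_orthonormal).
Qed.

(** Turns convergence in norm into the form of completeness that passes to tensor
    products. *)
Lemma complete_parsevalP :
  (forall u, L2 Omega u ->
    L2norm Omega (fun x => \sum_(k < N) L2inner Omega u (phi k) * phi k x - u x)
    @[N --> \oo] --> 0%E) <->
  parseval_on mu Omega phi'.
Proof.
have E u N : L2norm Omega
      (fun x => \sum_(k < N) L2inner Omega u (phi k) * phi k x - u x) =
    ('N[mu]_2%:E[EFin \o (fun x => \sum_(k < N)
      inner mu (u \_ Omega) (phi' k) * phi' k x - (u \_ Omega) x)%R])%E.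
  rewrite /L2norm (_ : (fun x => _ - u x) =
    (fun x => \sum_(k < N) L2inner Omega u (phi k) * phi k x) \- u)//.
  rewrite restrictB (restrict_comb (fun k => L2inner Omega u (phi k))).
  congr (Lnorm _ _ (EFin \o _)); apply/funext => x; congr (_ - _).
  by apply: eq_bigr => k _; rewrite L2innerE.
split=> [h f fL f0|h u uL].
  have fE : f \_ Omega = f by apply: (@restrict_supported _ _ f) => x; exact: f0.
  have := h f; rewrite /L2 fE => /(_ fL).
  under eq_fun do rewrite E fE.
  by move/(parsevalP phiL inner_restrict_orthonormal fL).
under eq_fun do rewrite E.
apply/(parsevalP phiL inner_restrict_orthonormal uL); apply: h => // x Ox.
exact: restrict_out.
Qed.

End OneDomain.

Section TensorEigenbasis.
Context {n1 n2 : nat}.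
Variables (Omega1 : set 'rV[R]_n1) (Omega2 : set 'rV[R]_n2).
Variables (phi : nat -> 'rV[R]_n1 -> R^o) (lambda : nat -> R).
Variables (psi : nat -> 'rV[R]_n2 -> R^o) (mu : nat -> R).
Hypothesis Bphi : dirichlet_eigenbasis Omega1 phi lambda.
Hypothesis Bpsi : dirichlet_eigenbasis Omega2 psi mu.
Variable e : nat -> nat * nat.
Hypothesis einj : injective e.
Hypothesis esurj : forall p, exists m, e m = p.

Lemma tensor_eigenbasis : dirichlet_eigenbasis (rV_setX Omega1 Omega2)
  (fun m => rV_tensor (phi (e m).1) (psi (e m).2))
  (fun m => lambda (e m).1 + mu (e m).2).
Proof.
have [ephi ophi cphi] := Bphi; have [epsi opsi cpsi] := Bpsi.
have phiL k : L2 Omega1 (phi k) by have [[]] := ephi k.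
have psiL k : L2 Omega2 (psi k) by have [[]] := epsi k.
have tL m : L2 (rV_setX Omega1 Omega2) (rV_tensor (phi (e m).1) (psi (e m).2)).
  exact: L2_tensor.
have t1 k l : L2inner (rV_setX Omega1 Omega2)
    (rV_tensor (phi (e k).1) (psi (e k).2))
    (rV_tensor (phi (e l).1) (psi (e l).2)) = (k == l)%:R.
  rewrite L2inner_tensor// ophi opsi -natrM mulnb.
  rewrite (_ : (k == l) = (e k == e l)); last by rewrite inj_eq.
  by case: (e k) => a b; case: (e l) => a' b'; rewrite xpair_eqE.
split=> //; first by move=> m; exact: eigenfunction_tensor.
apply/(complete_parsevalP tL t1).
rewrite (_ : (fun m => _ \_ _) = tensor_basis (@lsubmx R 1 n1 n2)
    (@rsubmx R 1 n1 n2) (fun k => phi k \_ Omega1) (fun k => psi k \_ Omega2) e);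
  last by apply/funext => m; rewrite restrict_tensor.
apply: (parseval_tensor (row_mx_coordinates n1 n2)) => //.
- by move=> k; rewrite rV_sfmE; exact: phiL.
- by move=> k; rewrite rV_sfmE; exact: psiL.
- by move=> k l; rewrite rV_sfmE -L2innerE.
- by move=> k l; rewrite rV_sfmE -L2innerE.
- by rewrite rV_sfmE; exact/complete_parsevalP.
- by rewrite rV_sfmE; exact/complete_parsevalP.
Qed.

End TensorEigenbasis.

(** Distinct eigenvalues being orthogonal, only finitely many coefficients are
    nonzero and the residual has norm 0. It is also continuous, and therefore
    vanishes at every point of Omega and not just almost everywhere. *)
Lemma eigenfunction_expansion n (Omega : set 'rV[R]_n) phi lambda w nu N :
  open Omega -> dirichlet_eigenbasis Omega phi lambda ->
  dirichlet_eigenfunction Omega nu w ->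
  (forall k, lambda k = nu -> (k < N)%N) ->
  forall x, Omega x -> w x = \sum_(k < N) L2inner Omega w (phi k) * phi k x.
Proof.
move=> oO [ephi ophi cphi] ew kN.
have phiL k : L2 Omega (phi k) by have [[]] := ephi k.
have wL : L2 Omega w by have [[]] := ew.
have o' := inner_restrict_orthonormal ophi.
pose c k := inner (rV_lebesgue n) (w \_ Omega) (phi k \_ Omega).
have c0 k : (N <= k)%N -> c k = 0.
  move=> Nk; rewrite /c -L2innerE.
  apply: (eigenfunction_orthogonal ew (ephi k)).
  by apply: contraTneq Nk => lk; rewrite -ltnNge; apply: kN.
have sumc : \sum_(k < N) c k ^+ 2 = inner (rV_lebesgue n) (w \_ Omega) (w \_ Omega).
  have := (complete_parsevalP phiL ophi).1 cphi _ wL.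
  move=> /(_ (fun x Ox => restrict_out w Ox)).
  apply: cvg_unique => //.
  apply: cvg_near_cst; exists N => // M /= NM.
  rewrite [RHS](big_ord_widen M (fun k => c k ^+ 2) NM) [RHS]big_mkcond/=.
  apply: eq_bigr => k _; case: ltnP => // Nk.
  by rewrite -/(c k) c0// expr0n.
pose r x := \sum_(k < N) L2inner Omega w (phi k) * phi k x - w x : R^o.
have rE : r \_ Omega = fun x => \sum_(k < N) c k * (phi k \_ Omega) x - (w \_ Omega) x.
  rewrite (_ : r = (fun x => \sum_(k < N) L2inner Omega w (phi k) * phi k x) \- w)//.
  rewrite restrictB (restrict_comb Omega phi (fun k => L2inner Omega w (phi k))).
  apply/funext => x; congr (_ - _).
  by apply: eq_bigr => k _; rewrite L2innerE.
have r0 : inner (rV_lebesgue n) (r \_ Omega) (r \_ Omega) = 0.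
  by rewrite rE (inner_residual phiL o' _ wL) sumc subrr.
have rL : (r \_ Omega : 'rV[R]_n -> R) \in Lfun (rV_lebesgue n) 2%:E.
  by rewrite rE; apply: Lfun2B => //; apply: Lfun2_sum => k _; exact: Lfun2Z (phiL k).
have : {ae rV_lebesgue n, forall x, Omega x -> r x = 0}.
  have := inner_eq0_ae rL r0; apply: filterS => x /[swap] Ox.
  by rewrite restrict_in.
move=> /continuous_ae_eq0 h x Ox; apply/esym/eqP; rewrite -subr_eq0; apply/eqP.
apply: (h oO _ x Ox) => x' Ox'.
have cs : (\sum_(k < N) L2inner Omega w (phi k) * phi k y : R^o) @[y --> x'] -->
    (\sum_(k < N) L2inner Omega w (phi k) * phi k x' : R^o).
  apply: (@cvg_sumr R _ (nbhs x')) => k.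
  by apply: cvgMr; have [_ cp _] := ephi k; exact: cp.
have cw : w y @[y --> x'] --> w x' by have [_ cw _] := ew; exact: cw.
exact: cvgB cs cw.
Qed.

End Eigenbases.

(** * The inequality for finite combinations *)

Section SpectralInequality.
Context {R : realType}.

Lemma spectral_projectorE n (Omega : set 'rV[R]_n) phi lambda Lambda u N x :
  (forall k, lambda k <= Lambda -> (k < N)%N) ->
  spectral_projector Omega phi lambda Lambda u x =
  \sum_(k < N) (if lambda k <= Lambda then L2inner Omega u (phi k) else 0) * phi k x.
Proof.
move=> kN; rewrite /spectral_projector fsbig_mkcond.
rewrite -(@fsbig_widen _ _ _ _ `I_N)//=; last first.
  move=> k [_ /= kN']; rewrite patchE; case: ifPn => // /set_mem/= kL.
  by case: kN'; exact: kN.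
rewrite -fsbig_ord; apply: eq_bigr => k _; rewrite patchE.
by case: ifPn => [/set_mem/= ->//|/negP]; rewrite inE => /negP/negbTE ->; rewrite mul0r.
Qed.

(** The eigenfunctions of eigenvalue at most Lambda have the same span in both
    eigenbases. The identity holds at every point, as needed for a supremum over
    a set that may be null. *)
Lemma projector_change_basis n (Omega : set 'rV[R]_n) Phi Lam T nu u (Lambda : R) :
  open Omega -> bounded_set Omega -> dirichlet_eigenbasis Omega Phi Lam ->
  dirichlet_eigenbasis Omega T nu ->
  exists N (b : nat -> R), [/\ forall m, ~~ (nu m <= Lambda) -> b m = 0,
    forall m, nu m <= Lambda -> (m < N)%N &
    forall x, Omega x -> spectral_projector Omega Phi Lam Lambda u x =
      \sum_(m < N) b m * T m x].
Proof.
move=> oO bO BPhi BT; have [ePhi oPhi _] := BPhi; have [eT oT _] := BT.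
have [N1 N1P] := eigenvalues_finite bO Lambda ePhi oPhi.
have [N NP] := eigenvalues_finite bO Lambda eT oT.
pose d k := if Lam k <= Lambda then L2inner Omega u (Phi k) else 0.
exists N, (fun m => \sum_(k < N1) d k * L2inner Omega (Phi k) (T m)); split=> //.
  move=> m mL; rewrite big1// => k _; rewrite /d; case: ifPn => kL; last first.
    by rewrite mul0r.
  rewrite (eigenfunction_orthogonal (ePhi k) (eT m)) ?mulr0//.
  by apply: contraNneq mL => <-.
move=> x Ox; rewrite (spectral_projectorE _ _ _ _ N1P).
under [RHS]eq_bigr do rewrite mulr_suml.
rewrite exchange_big/=; apply: eq_bigr => k _; rewrite -/(d k).
under [RHS]eq_bigr do rewrite -mulrA.
rewrite -mulr_sumr /d; case: ifPn => kL; last by rewrite !mul0r.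
congr (_ * _); apply: (eigenfunction_expansion oO BT (ePhi k)) => // m mk.
by apply: NP; rewrite mk.
Qed.

(** A combination of eigenfunctions of eigenvalue at most Lambda is its own
    projection, and its norm is read off its coefficients. *)
Lemma spec_comb n (Omega : set 'rV[R]_n) omega C beta phi lambda Lambda N
    (c : nat -> R) S :
  spec Omega omega C beta ->
  dirichlet_eigenbasis Omega phi lambda -> 0 < C -> 0 < Lambda ->
  (forall k, ~~ (lambda k <= Lambda) -> c k = 0) ->
  (forall k, lambda k <= Lambda -> (k < N)%N) ->
  (forall x, omega x -> `|\sum_(k < N) c k * phi k x| <= S) ->
  \sum_(k < N) c k ^+ 2 <= (C * expR (C * Lambda `^ beta) * S) ^+ 2.
Proof.
move=> [_ sp] B C0 L0 cL kN cS; have [eig orth _] := B.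
have phiL k : L2 Omega (phi k) by have [[]] := eig k.
pose u := fun x => \sum_(k < N) c k * phi k x : R^o.
have uL : L2 Omega u by exact: L2_comb.
have Pu : spectral_projector Omega phi lambda Lambda u = u.
  apply/funext => x; rewrite (spectral_projectorE _ _ _ _ kN).
  apply: eq_bigr => k _; rewrite (L2inner_comb phiL orth)//.
  by case: ifPn => // /cL ->.
have := sp _ _ B Lambda u L0 uL; rewrite Pu (L2norm_comb phiL orth).
set K := C * _ => h.
have K0 : 0 <= K by rewrite mulr_ge0 ?expR_ge0 ?ltW.
have {h} : ((Num.sqrt (\sum_(k < N) c k ^+ 2))%:E <= K%:E * S%:E)%E.
  apply: (le_trans h); apply: lee_wpmul2l; first by rewrite lee_fin.
  by apply: ge_ereal_sup => _ [x wx <-]; rewrite lee_fin; exact: cS.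
rewrite -EFinM lee_fin => h.
have c0 : 0 <= \sum_(k < N) c k ^+ 2 by apply: sumr_ge0 => k _; exact: sqr_ge0.
rewrite -[leLHS]sqr_sqrtr//; apply: lerXn2r => //; rewrite nnegrE ?sqrtr_ge0//.
exact: le_trans (sqrtr_ge0 _) h.
Qed.

(** For Lambda > 1, Lambda^n is at most (Lambda^beta)^p as soon as n <= beta p,
    and the exponential series dominates this power. *)
Lemma polynomial_le_exp (A beta : R) n : 0 <= A -> 0 < beta ->
  exists2 B : R, 0 < B & forall Lambda : R, 0 < Lambda ->
  (A * Lambda + 1) ^+ n <= B * expR (Lambda `^ beta).
Proof.
move=> A0 b0; pose p := (Num.truncn (n%:R / beta)).+1.
have np : n%:R <= beta * p%:R.
  by rewrite mulrC -ler_pdivrMr//; exact: ltW (truncnS_gt _).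
have A1 : 0 < A + 1 by lra.
have f1 : 1 <= p`!%:R :> R by rewrite ler1n fact_gt0.
exists ((A + 1) ^+ n * p`!%:R); first by rewrite mulr_gt0 ?exprn_gt0//; lra.
move=> Lambda L0; have lb0 : 0 <= Lambda `^ beta by exact: powR_ge0.
have e1 : 1 <= expR (Lambda `^ beta) by rewrite -expR0 ler_expR.
rewrite -mulrA.
have [L1|L1] := leP Lambda 1.
  apply: (@le_trans _ _ ((A + 1) ^+ n)).
    by apply: lerXn2r; rewrite ?nnegrE; nra.
  by rewrite ler_peMr ?exprn_ge0 ?(ltW A1)//; nra.
apply: (@le_trans _ _ ((A + 1) ^+ n * Lambda ^+ n)).
  by rewrite -exprMn; apply: lerXn2r; rewrite ?nnegrE; nra.
rewrite ler_wpM2l ?exprn_ge0 ?(ltW A1)//.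
have := expR_ge1Dxn p.-1 lb0; rewrite -/p => he.
apply: (@le_trans _ _ ((Lambda `^ beta) ^+ p)).
  rewrite -!powR_mulrn ?powR_ge0 ?(ltW L0)// -powRrM.
  by apply: ler_powR => //; exact: ltW.
rewrite mulrC -ler_pdivrMr ?(lt_le_trans ltr01)//.
by apply: le_trans he; rewrite lerDr.
Qed.

End SpectralInequality.

Section ProductInequality.
Context {R : realType} {n1 n2 : nat}.
Variables (Omega1 : set 'rV[R]_n1) (Omega2 : set 'rV[R]_n2).
Variables (omega : set 'rV[R]_(n1 + n2)) (C beta : R).
Hypothesis C0 : 0 < C.
Hypothesis spec2 : spec Omega2 (proj_right omega) C beta.
Hypothesis spec1 : forall y, proj_right omega y ->
  spec Omega1 (hslice Omega1 omega y) C beta.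
Variables (phi : nat -> 'rV[R]_n1 -> R^o) (lambda : nat -> R).
Variables (psi : nat -> 'rV[R]_n2 -> R^o) (mu : nat -> R).
Hypothesis Bphi : dirichlet_eigenbasis Omega1 phi lambda.
Hypothesis Bpsi : dirichlet_eigenbasis Omega2 psi mu.

(** For fixed y the inequality in x bounds the coefficients a_i(y) of the slice;
    the inequality in y then applies to each a_i separately. Summing over i costs
    the number of eigenvalues of Omega1 up to Lambda. *)
Lemma coefficients_le (Lambda : R) N (c : nat -> nat -> R) (S : R) : 0 < Lambda ->
  (forall i, lambda i <= Lambda -> (i < N)%N) ->
  (forall j, mu j <= Lambda -> (j < N)%N) ->
  (forall i j, ~~ (lambda i <= Lambda) -> c i j = 0) ->
  (forall i j, ~~ (mu j <= Lambda) -> c i j = 0) ->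
  (forall z, omega z -> `|\sum_(i < N) \sum_(j < N)
     c i j * (phi i (lsubmx z) * psi j (rsubmx z))| <= S) ->
  \sum_(i < N) \sum_(j < N) c i j ^+ 2 <=
  (\sum_(i < N | lambda i <= Lambda) 1) *
  ((C * expR (C * Lambda `^ beta)) ^+ 2 * S) ^+ 2.
Proof.
move=> L0 iN jN ci cj vS; set K := C * _.
have K0 : 0 <= K by rewrite mulr_ge0 ?expR_ge0 ?ltW.
pose a i y := \sum_(j < N) c i j * psi j y.
have sliceS y : proj_right omega y -> \sum_(i < N) a i y ^+ 2 <= (K * S) ^+ 2.
  move=> wy; apply: (spec_comb (c := a^~ y) (spec1 wy) Bphi C0 L0) => //.
    by move=> i li; rewrite /a big1// => j _; rewrite ci ?mul0r.
  move=> x [z [wz [Oz zy]] <-]; have := vS z wz; congr (`|_| <= _).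
  apply: eq_bigr => i _; rewrite /a mulr_suml; apply: eq_bigr => j _.
  by rewrite -zy; ring.
have aS i y : proj_right omega y -> (i < N)%N -> `|a i y| <= K * `|S|.
  move=> wy iN'; have := sliceS y wy; rewrite (bigD1 (Ordinal iN'))//=.
  have h0 : 0 <= \sum_(i0 < N | i0 != Ordinal iN') a i0 y ^+ 2.
    by apply: sumr_ge0 => k _; exact: sqr_ge0.
  move=> h; rewrite -(@ler_pXn2r _ 2)// ?nnegrE ?(mulr_ge0 K0)//.
  by rewrite exprMn !real_normK ?num_real// -exprMn; lra.
rewrite mulr_suml [leRHS]big_mkcond/=; apply: ler_sum => i _.
case: ifPn => li; last first.
  by rewrite big1// => j _; rewrite ci// expr0n.
rewrite mul1r.
have := spec_comb (c := c i) spec2 Bpsi C0 L0 (cj i) jN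
  (fun y wy => aS i y wy (ltn_ord i)).
by rewrite -/K mulrA -expr2 exprMn real_normK ?num_real// -exprMn.
Qed.

(** Regroups a sum along e into a sum over pairs: as e is injective, each pair
    collects at most one term. *)
Lemma tensor_coefficients_le (e : nat -> nat * nat) (Lambda : R) N (b : nat -> R)
    (S : R) :
  injective e -> 0 < Lambda ->
  (exists M, forall i, lambda i <= Lambda -> (i < M)%N) ->
  (exists M, forall j, mu j <= Lambda -> (j < M)%N) ->
  (forall m, ~~ (lambda (e m).1 <= Lambda) -> b m = 0) ->
  (forall m, ~~ (mu (e m).2 <= Lambda) -> b m = 0) ->
  (forall z, omega z ->
    `|\sum_(m < N) b m * rV_tensor (phi (e m).1) (psi (e m).2) z| <= S) ->
  exists M, \sum_(m < N) b m ^+ 2 <=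
    (\sum_(i < M | lambda i <= Lambda) 1) *
    ((C * expR (C * Lambda `^ beta)) ^+ 2 * S) ^+ 2.
Proof.
move=> einj L0 [M1 iM] [M2 jM] b1 b2 vS.
pose M := (M1 + M2 + \sum_(m < N) ((e m).1 + (e m).2)).+1.
have M_gt1 (m : 'I_N) : ((e m).1 < M)%N.
  rewrite ltnS (bigD1 m)//=; lia.
have M_gt2 (m : 'I_N) : ((e m).2 < M)%N.
  rewrite ltnS (bigD1 m)//=; lia.
pose h (m : 'I_N) : 'I_M * 'I_M := (Ordinal (M_gt1 m), Ordinal (M_gt2 m)).
have hinj : injective h.
  move=> m m' [e1 e2]; apply/val_inj/einj => /=.
  by rewrite (surjective_pairing (e m)) (surjective_pairing (e m')) e1 e2.
pose c i j := \sum_(m < N | e m == (i, j)) b m.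
have cE i j : c (val i) (val j) = \sum_(m < N | h m == (i, j)) b m.
  by apply: eq_bigl => m; rewrite [e m]surjective_pairing.
have sum_h (G : 'I_N -> R) :
    \sum_(m < N) G m = \sum_(i < M) \sum_(j < M) \sum_(m < N | h m == (i, j)) G m.
  by rewrite pair_bigA/= (partition_big h xpredT).
exists M; apply: (@le_trans _ _ (\sum_(i < M) \sum_(j < M) c i j ^+ 2)).
  rewrite sum_h; apply: ler_sum => i _; apply: ler_sum => j _; rewrite cE.
  have [m /eqP hm|hn] := pickP [pred m | h m == (i, j)]; last first.
    by rewrite big_pred0// sqr_ge0.
  have h1 : (fun m' => h m' == (i, j)) =1 pred1 m.
    by move=> m' /=; rewrite -hm inj_eq.
  by rewrite !(big_pred1 m).
apply: coefficients_le => //.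
- by move=> i /iM; rewrite /M; lia.
- by move=> j /jM; rewrite /M; lia.
- by move=> i j li; rewrite /c big1// => m /eqP em; rewrite b1// em.
- by move=> i j lj; rewrite /c big1// => m /eqP em; rewrite b2// em.
move=> z /vS; rewrite sum_h; congr (`|_| <= _).
apply: eq_bigr => i _; apply: eq_bigr => j _; rewrite cE mulr_suml.
apply: eq_bigr => m /eqP hm; rewrite /rV_tensor.
by have [<- <-] : (e m).1 = i /\ (e m).2 = j by case: hm => <- <-.
Qed.

End ProductInequality.

(** * The spectral inequality on the product *)

Lemma open_rV_setX (R : realType) n1 n2 (A : set 'rV[R]_n1) (B : set 'rV[R]_n2) :
  open A -> open B -> open (rV_setX A B).
Proof.
move=> oA oB; apply: openI.
  apply: (open_comp _ oA) => z _; exact: continuous_lsubmx.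
apply: (open_comp _ oB) => z _; exact: continuous_rsubmx.
Qed.

Lemma bounded_rV_setX (R : realType) n1 n2 (A : set 'rV[R]_n1)
    (B : set 'rV[R]_n2) :
  bounded_set A -> bounded_set B -> bounded_set (rV_setX A B).
Proof.
move=> /bounded_in_cube[L1 L10 bA] /bounded_in_cube[L2 L20 bB].
exists (L1 + L2); split; first exact: num_real.
move=> M LM z [Az Bz] /=; have M0 : 0 < M by lra.
have : ball (0 : 'rV[R]_(n1 + n2)) M z.
  apply/(ball_rVP _ _ M0) => i; rewrite mxE sub0r normrN.
  case: (split_ordP i) => j ->; rewrite ltr_norml.
    by have := bA _ j Az; rewrite mxE; lra.
  by have := bB _ j Bz; rewrite mxE; lra.
by rewrite -ball_normE /= sub0r normrN => /ltW.
Qed.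

(** The supremum over the empty set is -oo, which no norm is at most. *)
Lemma spec_neq0 (R : realType) n (Omega omega : set 'rV[R]_n) (C beta : R) :
  0 < C -> spec Omega omega C beta -> omega !=set0.
Proof.
move=> C0 [[phi [lambda B]] sp]; apply: contrapT => /set0P/negP/negPn/eqP w0.
have [/(_ 0%N)[[phiL _] _ _] _ _] := B.
have := sp phi lambda B 1 _ ltr01 phiL.
rewrite w0 image_set0 ereal_sup0 gt0_muleNy ?lte_fin ?mulr_gt0 ?expR_gt0//.
by rewrite leNgt /L2norm (lt_le_trans ltNy0)// Lnorm_ge0.
Qed.

Section ProductProjector.
Context {R : realType} {n1 n2 : nat}.
Variables (Omega1 : set 'rV[R]_n1) (Omega2 : set 'rV[R]_n2).
Hypotheses (oO1 : open Omega1) (bO1 : bounded_set Omega1).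
Hypotheses (oO2 : open Omega2) (bO2 : bounded_set Omega2).
Variables (omega : set 'rV[R]_(n1 + n2)) (C beta : R).
Hypothesis homega : omega `<=` rV_setX Omega1 Omega2.
Hypotheses (C0 : 0 < C) (beta0 : 0 < beta).
Hypothesis spec2 : spec Omega2 (proj_right omega) C beta.
Hypothesis spec1 : forall y, proj_right omega y ->
  spec Omega1 (hslice Omega1 omega y) C beta.

Lemma product_spec : exists C' : R,
  0 < C' /\ spec (rV_setX Omega1 Omega2) omega C' beta.
Proof.
have [_ [z0 wz0 _]] := spec_neq0 C0 spec2.
have [phi [lambda Bphi]] := (spec1 (ex_intro2 _ _ z0 wz0 erefl)).1.
have [psi [mu Bpsi]] := spec2.1.
have [ephi ophi _] := Bphi; have [epsi opsi _] := Bpsi.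
have lambda0 i : 0 <= lambda i.
  by apply: (eigenvalue_ge0 (ephi i)); rewrite ophi eqxx.
have mu0 j : 0 <= mu j by apply: (eigenvalue_ge0 (epsi j)); rewrite opsi eqxx.
have [e einj esurj] := exists_pair_enumeration.
have BT := tensor_eigenbasis Bphi Bpsi einj esurj.
have [A A0 count] := eigenvalue_count bO1.
have [B B0 polyB] := polynomial_le_exp n1 A0 beta0.
(* The count is at most t' = 2 B exp(Lambda^beta), and t <= t'^2 compensates the
   square root in the norm. The value of C' dominates both the factor 2 B C^2 and
   the exponent 2 C + 1 of t' K^2. *)
pose C' := 2 * B * C ^+ 2 + 2 * C + 1.
have BC : 0 < 2 * B * C ^+ 2 by rewrite !mulr_gt0 ?exprn_gt0.
have C'0 : 0 < C' by rewrite /C' !addr_gt0 ?mulr_gt0.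
exists C'; split=> //; split.
  by do 2 eexists; exact: BT.
move=> Phi Lam BPhi Lambda u L0 uL.
set v := spectral_projector _ _ _ _ _; set K' := C' * _.
have K'0 : 0 < K' by rewrite mulr_gt0 ?expR_gt0.
have [N [b [b0 NP vE]]] := projector_change_basis u Lambda
  (open_rV_setX oO1 oO2) (bounded_rV_setX bO1 bO2) BPhi BT.
set Om := rV_setX Omega1 Omega2 in BT BPhi uL vE *.
have -> : L2norm Om v = (Num.sqrt (\sum_(m < N) b m ^+ 2))%:E.
  have [eT oT _] := BT.
  rewrite -(L2norm_comb (fun m => let: And3 h _ _ := eT m in h.1) oT).
  rewrite /L2norm; congr (Lnorm _ _ (EFin \o _)).
  apply/funext => x; have [Ox|Ox] := pselect (Om x).
    by rewrite !restrict_in// /v vE.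
  by rewrite !restrict_out.
set sup := ereal_sup _.
have vsup z : omega z -> (`|v z|%:E <= sup)%E.
  by move=> wz; apply: ereal_sup_ubound; exists z.
have : (0 <= sup)%E by apply: le_trans (vsup _ wz0); rewrite lee_fin.
case: sup vsup => [S||] vS S0 //; last by rewrite gt0_muley ?lte_fin// leey.
rewrite -EFinM lee_fin; rewrite lee_fin in S0.
have [|||M sumb] := tensor_coefficients_le C0 spec2 spec1 Bphi Bpsi einj L0
  (eigenvalues_finite bO1 Lambda ephi ophi)
  (eigenvalues_finite bO2 Lambda epsi opsi) (N := N) (b := b) (S := S).
- by move=> m ml; apply: b0; apply: contraNN ml; have := mu0 (e m).2; lra.
- by move=> m ml; apply: b0; apply: contraNN ml; have := lambda0 (e m).1; lra.
- by move=> z wz; rewrite -vE; [rewrite -lee_fin; exact: vS|exact: homega].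
set E := expR (Lambda `^ beta).
have {}polyB := polyB _ L0.
have {}count := count _ _ ephi ophi _ M L0.
set t := \sum_(i < M | _) 1 in count sumb.
pose t' := 2 * (B * E).
have tt' : t <= t' ^+ 2.
  have p1 : 1 <= (A * Lambda + 1) ^+ n1.
    by rewrite exprn_ege1// lerDr mulr_ge0// ltW.
  have t'1 : 2 * (A * Lambda + 1) ^+ n1 <= t' by rewrite ler_pM2l.
  apply: le_trans count (le_trans t'1 _).
  by rewrite expr2 ler_peMr; lra.
set K := C * _ in sumb.
have K0 : 0 <= K by rewrite mulr_ge0 ?expR_ge0 ?ltW.
have t'0 : 0 <= t' by rewrite /t' !mulr_ge0 ?expR_ge0 ?ltW.
have h : Num.sqrt (\sum_(m < N) b m ^+ 2) <= t' * (K ^+ 2 * S).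
  have r0 : 0 <= t' * (K ^+ 2 * S) by exact: mulr_ge0 t'0 (mulr_ge0 (sqr_ge0 _) S0).
  rewrite -(ger0_norm r0) -sqrtr_sqr.
  rewrite ler_wsqrtr// (le_trans sumb)// [leRHS]exprMn ler_wpM2r//; exact: sqr_ge0.
apply: (le_trans h); rewrite mulrA ler_wpM2r//.
have -> : t' * K ^+ 2 = 2 * B * C ^+ 2 * expR ((2 * C + 1) * Lambda `^ beta).
  have -> : expR ((2 * C + 1) * Lambda `^ beta) =
      expR (C * Lambda `^ beta) ^+ 2 * E.
    by rewrite -expRM_natl -expRD; congr expR; ring.
  by rewrite /t' /K exprMn; ring.
have P0 : 0 <= Lambda `^ beta by exact: powR_ge0.
apply: ler_pM; rewrite ?expR_ge0 ?(ltW BC)//.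
  by rewrite /C' -addrA lerDl addr_ge0 ?mulr_ge0 ?ltW.
by rewrite ler_expR ler_wpM2r// /C' -addrA lerDr ltW.
Qed.

End ProductProjector.

Theorem proposition3p7 (R : realType) (n1 n2 : nat)
    (hn1 : (0 < n1)%N) (hn2 : (0 < n2)%N)
    (Omega1 : set 'rV[R]_n1) (Omega2 : set 'rV[R]_n2)
    (hOmega1 : star_shaped_lipschitz_domain Omega1)
    (hOmega2 : star_shaped_lipschitz_domain Omega2)
    (omega : set 'rV[R]_(n1 + n2))
    (homega : omega `<=` rV_setX Omega1 Omega2)
    (C beta : R) (hC : 0 < C) (hbeta : 0 < beta)
    (hspec2 : spec Omega2 (proj_right omega) C beta)
    (hspec1 : forall y, proj_right omega y -> spec Omega1 (hslice Omega1 omega y) C beta) :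
  exists C' : R, 0 < C' /\ spec (rV_setX Omega1 Omega2) omega C' beta.
Proof.
have [oO1 bO1 _ _ _] := hOmega1; have [oO2 bO2 _ _ _] := hOmega2.
exact: (product_spec oO1 bO1 oO2 bO2 homega hC hbeta hspec2 hspec1).
Qed.
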